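(* Let $p\in[2,\infty)$, $p'=p/(p-1)$, $f\in L^{p'}(\Omega)$, and let the penalty parameter $\sigma$ and the weights $\mathbf{w}$ be chosen as described in the context. Let $u_h\in S^{\mathbf{r}}_{\mathcal{T}}$ be a solution of the discrete problem $$B_{\mathcal{T}}(u_h;u_h,v_h)=\int_\Omega f v_h\,\mathrm{d}\mathbf{x}\qquad\forall v_h\in S^{\mathbf{r}}_{\mathcal{T}}.$$ Then $$|||u_h|||_p^{\,p-1}\leq 2\,C_{\mathrm{PF}}\,\|f\|_{L^{p'}(\Omega)},$$ where $C_{\mathrm{PF}}>0$ is the constant of the broken Poincaré inequality $\|v_h\|_{L^p(\Omega)}\le C_{\mathrm{PF}}|||v_h|||_p$ for all $v_h\in S^{\mathbf{r}}_{\mathcal{T}}$ (it depends only on $\Omega$ and $p$).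
   Context: Mesh. $\Omega\subset\mathbb{R}^d$, $d\in\{1,2,3\}$, is a bounded polytopic domain; $\mathcal{T}$ is a mesh of $\Omega$ by simplices, from a shape-regular family ($h_K/\rho_K\le c_{\mathrm{sr}}$ for all $K\in\mathcal T$, $h_K=\operatorname{diam}K$, $\rho_K$ = inradius, $c_{\mathrm{sr}}$ independent of the mesh); hanging nodes/edges are allowed. $\Gamma=\bigcup_{K}\partial K$. An interface is a set $F=\partial K^+\cap\partial K^-$ (of dimension $d-1$) for two adjacent elements, or a boundary face $F=\partial K^+\cap\partial\Omega$; $\mathcal{F}$ is the set of interfaces. $m_K$ is the number of interfaces contained in $\partial K$. For $F\in\mathcal F$, $F\subset\partial K$, $F_K$ denotes the unique face of the simplex $K$ containing $F$. Integrals over $\Gamma$ are sums over $F\in\mathcal F$. For $d=1$ faces are points of measure 1. Spaces. $\mathbf r=(r_K)_{K\in\mathcal T}$, $r_K\in\mathbb N$; $S^{\mathbf r}_{\mathcal T}=\{v\in L^p(\Omega): v|_K\in\mathcal P_{r_K}(K)\ \forall K\in\mathcal T\}$, where $\mathcal P_r(K)$ are polynomials of total degree $\le r$. $\nabla_h$ is the elementwise gradient. Jumps and averages. On an interior interface, $v^\pm$ are the traces from $K^\pm$ and $\mathbf n^\pm$ the outward unit normals; $[\![v]\!]=v^+\mathbf n^++v^-\mathbf n^-$ and $\{v\}_{\mathbf w}=w_F^+v^++w_F^-v^-$ (also for vector fields and for nonlinear expressions, evaluated from each side), with $w_F^\pm\in[0,1]$, $w_F^++w_F^-=1$. On a boundary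 face, $\mathbf w|_F=(1,0)$ and $v^-=0$, so $[\![v]\!]=v^+\mathbf n^+$, $\{v\}_{\mathbf w}=v^+$. Nonlinear form, with fixed $\theta\in[-1,1]$ and interface-wise constant $\sigma|_F=\sigma_F>0$: $$B_{\mathcal T}(z;u,v)=\int_\Omega|\nabla_hu|^{p-2}\nabla_hu\cdot\nabla_hv\,\mathrm d\mathbf x+\int_\Gamma\sigma\{(|\nabla z|^2+\sigma^2|[\![u]\!]|^2)^{\frac{p-2}2}\}_{\mathbf w}[\![u]\!]\cdot[\![v]\!]\,\mathrm ds-\int_\Gamma\{|\nabla u|^{p-2}\nabla u\}_{\mathbf w}\cdot[\![v]\!]\,\mathrm ds+\theta\int_\Gamma\{(|\nabla z|^2+\sigma^2|[\![u]\!]|^2)^{\frac{p-2}2}\nabla v\}_{\mathbf w}\cdot[\![u]\!]\,\mathrm ds.$$ Norm. $|||u|||_p=\big(\int_\Omega|\nabla_hu|^p\,\mathrm d\mathbf x+\int_\Gamma\sigma^{p-1}|[\![u]\!]|^p\,\mathrm ds\big)^{1/p}$. Constants. $C_{1,p},C_{2,p}>0$ are constants depending only on $p$ such that, for all $\mathbf y,\mathbf z\in\mathbb R^d$, $a\ge0$, $|(a^2+|\mathbf y|^2)^{\frac{p-2}2}\mathbf y-(a^2+|\mathbf z|^2)^{\frac{p-2}2}\mathbf z|\le C_{1,p}(a+|\mathbf y|+|\mathbf z|)^{p-2}|\mathbf y-\mathbf z|$ and $((a^2+|\mathbf y|^2)^{\frac{p-2}2}\mathbf y-(a^2+|\mathbf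 z|^2)^{\frac{p-2}2}\mathbf z)\cdot(\mathbf y-\mathbf z)\ge C_{2,p}(a+|\mathbf y|+|\mathbf z|)^{p-2}|\mathbf y-\mathbf z|^2$. Put $\tilde C_p=(2^{p-1}+2^{2p-4}+2^{2p-3})C_{1,p}+1$ and $$\varepsilon=\min\Big\{\frac{2^{1-p}C_{2,p}}{2^{p-2}C_{1,p}+\tilde C_p+(2^{p-1}+1)|\theta|},\ \frac{2^{4-p}}{|\theta|},\ \frac{p'}4\Big(\frac p4\Big)^{\frac1{p-1}},\ \frac14\Big\}$$ (second entry omitted if $\theta=0$), $\mu_\varepsilon=\max\{1,(4\varepsilon)^{-1}\}$. Penalty and weights. $\mathcal G_{K,F}=C_p\,C_{\mathrm{inv},d}\,\dfrac{(2(r_K-1)^2+1)|F_K|}{d|K|}$, with $C_{\mathrm{inv},d}=1,4,8$ for $d=1,2,3$; here $C_p$ is any fixed constant $\ge2^{p+1}$, or, if $p\in(2,\infty)\cap\mathbb Q$ with $p=2+2\ell_p/k_p$, $k_p,\ell_p\in\mathbb N$, $C_p=2^{p/2+1/k_p}p^2k_p^2$. Set $\zeta_F^\pm=\varepsilon/(m_{K^\pm}\mu_\varepsilon\mathcal G_{K^\pm,F})$ and $w_F^\pm=\zeta_F^\pm/(\zeta_F^++\zeta_F^-)$, $\sigma_F=1/(\zeta_F^++\zeta_F^-)$; on boundary faces $\zeta_F^-=0$. *)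

(* Defs.v *)
From HB Require Import structures.
From mathcomp Require Import all_boot all_order all_algebra.
From mathcomp Require Import all_classical all_reals all_analysis.
From mathcomp Require mpoly.
Import (canonicals, coercions) mpoly.

Set Implicit Arguments.
Unset Strict Implicit.
Unset Printing Implicit Defensive.
Import Order.TTheory GRing.Theory Num.Theory.
Import numFieldNormedType.Exports.
Local Open Scope classical_set_scope.
Local Open Scope ring_scope.

Definition rV_display : measure_display -> measure_display.
Proof. exact. Qed.

Section measurable_rV.
Context {R : realType}.
Variable n : nat.

Definition rV_coord (i : 'I_n) (x : 'rV[R]_n) : measurableTypeR R := x ord0 i.

Let rV_set0 : g_sigma_preimage rV_coord set0.
Proof. exact: sigma_algebra0. Qed.

Let rV_setC A : g_sigma_preimage rV_coord A -> g_sigma_preimage rV_coord (~` A).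
Proof. exact: sigma_algebraC. Qed.

Let rV_bigcup (F : (set 'rV[R]_n)^nat) :
  (forall i, g_sigma_preimage rV_coord (F i)) ->
  g_sigma_preimage rV_coord (\bigcup_i (F i)).
Proof. exact: sigma_algebra_bigcup. Qed.

HB.instance Definition _ := @isMeasurable.Build (rV_display default_measure_display)
  'rV[R]_n (g_sigma_preimage rV_coord) rV_set0 rV_setC rV_bigcup.

End measurable_rV.

Section measurable_rV_lemmas.
Context {R : realType}.

Lemma measurable_rV_coord n (i : 'I_n) :
  measurable_fun [set: 'rV[R]_n] (rV_coord i).
Proof.
move=> _ Y mY; rewrite setTI; apply: sub_sigma_algebra => /=.
rewrite -bigcup_seq/=; exists i => /=; first by rewrite mem_index_enum.
by exists Y => //; rewrite setTI.
Qed.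

Lemma measurable_fun_rVP d (T : measurableType d) n (f : T -> 'rV[R]_n) :
  (forall i, measurable_fun [set: T] (rV_coord i \o f)) ->
  measurable_fun [set: T] f.
Proof.
move=> mf; suff : g_sigma_preimage (fun i => rV_coord i \o f) `<=` measurable.
  rewrite g_sigma_preimage_comp => H _ A mA.
  by apply: H; exists A.
apply: smallest_sub; first exact: sigma_algebra_measurable.
case: n => [|n] in f mf *; first by rewrite big_ord0.
rewrite -bigcup_mkord_ord; apply: bigcup_sub => i Ii.
by move=> A [B mB <-]; exact: mf.
Qed.

Definition rV_cons n (xt : measurableTypeR R * 'rV[R]_n) : 'rV[R]_n.+1 :=
  row_mx (const_mx xt.1 : 'rV[R]_1) xt.2.

Lemma measurable_rV_cons n : measurable_fun setT (@rV_cons n).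
Proof.
apply: measurable_fun_rVP => i; rewrite (_ : _ \o _ =
  (fun xt => if fintype.split (i : 'I_(1 + n)) is inr j then rV_coord j xt.2 else xt.1)); last first.
  by apply/funext => -[x t]; rewrite /= /rV_coord /rV_cons mxE; case: fintype.split => j //; rewrite mxE.
case: fintype.split => j; first exact: measurable_fst.
exact: (measurableT_comp (measurable_rV_coord j)).
Qed.

Definition rV_uncons n (x : 'rV[R]_n.+1) : measurableTypeR R * 'rV[R]_n :=
  (x ord0 ord0, rsubmx (x : 'rV_(1 + n))).

Lemma measurable_rV_uncons n : measurable_fun setT (@rV_uncons n).
Proof.
apply/measurable_fun_pairP; split; first exact: (measurable_rV_coord ord0).
apply: measurable_fun_rVP => i.
rewrite (_ : _ \o _ = rV_coord (rshift 1 i : 'I_n.+1)).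
  exact: measurable_rV_coord.
by apply/funext => x; rewrite /rV_coord /= !mxE.
Qed.

Lemma rV_consK n : cancel (@rV_cons n) (@rV_uncons n).
Proof.
move=> [x t]; rewrite /rV_uncons /rV_cons /= row_mxKr; congr pair.
by rewrite mxE; case: splitP => // j _; rewrite mxE.
Qed.

Section rV_cons_product.
Variables (n : nat) (mu : {sigma_finite_measure set 'rV[R]_n -> \bar R}).

Definition rV_cons_measure :=
  pushforward ((@lebesgue_measure R) \x mu)%E (@rV_cons n).

Let cons_push : {measure set 'rV[R]_n.+1 -> \bar R} :=
  measure_function_pushforward__canonical__measure_function_Measure
    ((@lebesgue_measure R) \x mu)%E (@measurable_rV_cons n).

HB.instance Definition _ := isMeasure.Build _ _ _ rV_cons_measure
  (measure0 cons_push) (measure_ge0 cons_push)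
  (@measure_semi_sigma_additive _ _ _ cons_push).

Lemma rV_cons_measure_sigma_finite : sigma_finite setT rV_cons_measure.
Proof.
have /sigma_finiteP[F [TF ndF Foo]] := sigma_finiteT (@lebesgue_measure R).
have /sigma_finiteP[G [TG ndG Goo]] := sigma_finiteT mu.
exists (fun k => @rV_uncons n @^-1` (F k `*` G k)).
  apply/esym; rewrite -subTset => x _.
  have [i _ Fi] : (\bigcup_k F k) (rV_uncons x).1 by rewrite -TF.
  have [j _ Gj] : (\bigcup_k G k) (rV_uncons x).2 by rewrite -TG.
  exists (maxn i j) => //; split.
    by move: Fi; exact/subsetPset/ndF/leq_maxl.
  by move: Gj; exact/subsetPset/ndG/leq_maxr.
move=> k; have [mF Fk] := Foo k; have [mG Gk] := Goo k; split.
  rewrite -[X in measurable X]setTI; apply: measurable_rV_uncons => //.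
  exact: measurableX.
rewrite /rV_cons_measure /pushforward -comp_preimage.
rewrite (_ : _ \o _ = id); last by apply/funext => x; exact: rV_consK.
by rewrite preimage_id product_measure1E// lte_mul_pinfty// ge0_fin_numE.
Qed.

HB.instance Definition _ := Measure_isSigmaFinite.Build _ _ _ rV_cons_measure
  rV_cons_measure_sigma_finite.

End rV_cons_product.

Fixpoint lebesgue_rV n : {sigma_finite_measure set 'rV[R]_n -> \bar R} :=
  match n with
  | 0 => \d_(0 : 'rV[R]_0)
  | m.+1 => rV_cons_measure (lebesgue_rV m)
  end.

End measurable_rV_lemmas.

Section euclidean.
Context {R : realType}.

(* The library norm `|x| on row vectors is the sup norm, hence this one. *)
Definition dotp d (x y : 'rV[R]_d) : R := \sum_i x ord0 i * y ord0 i.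
Definition enorm d (x : 'rV[R]_d) : R := Num.sqrt (dotp x x).

(* Closed simplices (and their faces) are given by the matrix of their
   vertices, one vertex per row. *)
Definition hull m d (V : 'M[R]_(m, d)) : set 'rV[R]_d :=
  [set x | exists l : 'rV[R]_m,
     [/\ forall i, 0 <= l ord0 i, \sum_i l ord0 i = 1 & x = l *m V]].

Definition aff_indep m d (V : 'M[R]_(m, d)) : bool :=
  row_free (row_mx (const_mx 1 : 'cV[R]_m) V).

Definition boundary d (A : set 'rV[R]_d) : set 'rV[R]_d := closure A `\` A°.

Definition diameter d (A : set 'rV[R]_d) : R :=
  sup [set enorm (x - y) | x in A & y in A].

Definition inradius d (A : set 'rV[R]_d) : R :=
  sup [set rho | 0 <= rho /\ exists c, forall x, enorm (x - c) <= rho -> A x].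

(* Openness and boundedness follow from the last clause. *)
Definition polytopic_domain d (Omega : set 'rV[R]_d) : Prop :=
  [/\ Omega !=set0, connected Omega &
      exists (m : nat) (V : 'I_m -> 'M[R]_(d.+1, d)),
        (forall i, aff_indep (V i)) /\
        Omega = (\bigcup_(i in [set: 'I_m]) hull (V i))°].

End euclidean.

(* Surface measure on the hyperplane through the rows w_0, ..., w_n of W: the
   image of Lebesgue measure on R^n under t |-> w_0 + sum_i t_i (w_i - w_0),
   times the Gram factor.  For n = 0 this is the Dirac mass at w_0. *)
Section surface_measure.
Context {R : realType}.
Variables (n : nat) (W : 'M[R]_n.+1).

Definition edges : 'M[R]_(n, n.+1) :=
  \matrix_(i, j) (W (lift ord0 i) j - W ord0 j).

Definition face_param (t : 'rV[R]_n) : 'rV[R]_n.+1 := row ord0 W + t *m edges.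

Lemma measurable_face_param : measurable_fun setT face_param.
Proof.
apply: measurable_fun_rVP => j.
rewrite (_ : _ \o _ = (fun t => W ord0 j + \sum_(i < n) rV_coord i t * edges i j)).
  apply: measurable_realfun.measurable_funD => //.
  apply: measurable_sum => i; apply: measurable_realfun.measurable_funM => //.
  exact: measurable_rV_coord.
by apply/funext => t; rewrite /rV_coord /face_param /= !mxE.
Qed.

Lemma gram_ge0 : 0 <= Num.sqrt (\det (edges *m edges^T)).
Proof. exact: sqrtr_ge0. Qed.

Definition surface_measure : {measure set 'rV[R]_n.+1 -> \bar R} :=
  mscale (NngNum gram_ge0)
    (measure_function_pushforward__canonical__measure_function_Measure
       (lebesgue_rV n) measurable_face_param).

End surface_measure.

Section mesh.
Context {R : realType}.

Record mesh n (Omega : set 'rV[R]_n.+1) := Mesh {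
  nelt : nat;
  vert : 'I_nelt -> 'M[R]_(n.+2, n.+1);
  mesh_nondegenerate : forall K, aff_indep (vert K);
  mesh_disjoint : forall K L, K != L ->
    (hull (vert K))° `&` (hull (vert L))° = set0;
  mesh_cover : \bigcup_(K in [set: 'I_nelt]) hull (vert K) = closure Omega }.

Variables (n : nat) (Omega : set 'rV[R]_n.+1) (T : mesh Omega).

Definition elt (K : 'I_(nelt T)) : set 'rV[R]_n.+1 := hull (vert K).

Definition face_vert (K : 'I_(nelt T)) (k : 'I_n.+2) : 'M[R]_n.+1 :=
  row' k (vert K).

Definition face (K : 'I_(nelt T)) (k : 'I_n.+2) : set 'rV[R]_n.+1 :=
  hull (face_vert K k).

Definition shape_regular (csr : R) : Prop :=
  forall K, diameter (elt K) / inradius (elt K) <= csr.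

(* Candidate interfaces: inl (K, L) stands for the intersection of the
   boundaries of K and L; inr (K, k) for the part of the boundary of Omega on
   the k-th face of K (an element may have several faces on the boundary). *)
Definition ifc : finType :=
  ('I_(nelt T) * 'I_(nelt T) + 'I_(nelt T) * 'I_n.+2)%type.

Definition ifc_set (F : ifc) : set 'rV[R]_n.+1 :=
  match F with
  | inl KL => boundary (elt KL.1) `&` boundary (elt KL.2)
  | inr Kk => face Kk.1 Kk.2 `&` boundary Omega
  end.

Definition has_codim1 (A : set 'rV[R]_n.+1) : Prop :=
  exists W : 'M[R]_n.+1, aff_indep W /\ hull W `<=` A.

(* The condition KL.1 < KL.2 lists each interior interface once and fixes which
   of its two elements is K^+. *)
Definition is_ifc (F : ifc) : bool :=
  `[< has_codim1 (ifc_set F) >] &&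
  (if F is inl KL then (KL.1 < KL.2)%N else true).

Definition eplus (F : ifc) : 'I_(nelt T) :=
  match F with inl KL => KL.1 | inr Kk => Kk.1 end.

Definition eminus (F : ifc) : option 'I_(nelt T) :=
  match F with inl KL => Some KL.2 | inr _ => None end.

Definition n_ifc (K : 'I_(nelt T)) : nat :=
  #|[pred F : ifc | is_ifc F && `[< ifc_set F `<=` boundary (elt K) >]]|.

(* Vertices of the face F_K of K containing the interface F. *)
Definition face_of (K : 'I_(nelt T)) (F : ifc) : 'M[R]_n.+1 :=
  face_vert K (odflt ord0 [pick k | `[< ifc_set F `<=` face K k >]]).

Definition outer_normal (K : 'I_(nelt T)) (F : ifc) : 'rV[R]_n.+1 :=
  xget 0 [set nu | [/\ enorm nu = 1,
    forall x y, hull (face_of K F) x -> hull (face_of K F) y ->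
      dotp (x - y) nu = 0 &
    forall x y, elt K x -> hull (face_of K F) y -> dotp (x - y) nu <= 0]].

Definition face_area (K : 'I_(nelt T)) (F : ifc) : R :=
  fine (surface_measure (face_of K F) (hull (face_of K F))).

Definition volume (K : 'I_(nelt T)) : R := fine (lebesgue_rV n.+1 (elt K)).

Definition int_Gamma (g : ifc -> 'rV[R]_n.+1 -> R) : R :=
  \sum_(F | is_ifc F)
    \int[surface_measure (face_of (eplus F) F)]_(x in ifc_set F) g F x.

(* An element of the discrete space is given by its polynomial on each element
   of the mesh, which determines its traces from either side. *)
Definition broken : Type := 'I_(nelt T) -> mpoly.mpoly n.+1 R.

Definition in_space (r : 'I_(nelt T) -> nat) (v : broken) : Prop :=
  forall K, (mpoly.msize (v K) <= (r K).+1)%N.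

Definition pval (P : mpoly.mpoly n.+1 R) (x : 'rV[R]_n.+1) : R :=
  mpoly.meval (fun i => x ord0 i) P.

Definition pgrad (P : mpoly.mpoly n.+1 R) (x : 'rV[R]_n.+1) : 'rV[R]_n.+1 :=
  \row_i pval (mpoly.mderiv i P) x.

(* Function on Omega; the value on the mesh skeleton, a null set, is 0. *)
Definition bval (v : broken) (x : 'rV[R]_n.+1) : R :=
  \sum_K \1_((elt K)°) x * pval (v K) x.

Definition bgrad (v : broken) (x : 'rV[R]_n.+1) : 'rV[R]_n.+1 :=
  \sum_K \1_((elt K)°) x *: pgrad (v K) x.

Definition jump (F : ifc) (v : broken) (x : 'rV[R]_n.+1) : 'rV[R]_n.+1 :=
  pval (v (eplus F)) x *: outer_normal (eplus F) F +
  (if eminus F is Some L then pval (v L) x *: outer_normal L F else 0).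

(* {g}_w on F, where g K is the quantity evaluated from the side of K. *)
Definition avg (V : lmodType R) (w : ifc -> 'I_(nelt T) -> R) (F : ifc)
    (g : 'I_(nelt T) -> V) : V :=
  w F (eplus F) *: g (eplus F) +
  (if eminus F is Some L then w F L *: g L else 0).

Definition flux (p : R) (y : 'rV[R]_n.+1) : 'rV[R]_n.+1 :=
  enorm y `^ (p - 2) *: y.

Definition stab (p : R) (sigma : ifc -> R) (F : ifc) (z u : broken)
    (x : 'rV[R]_n.+1) (K : 'I_(nelt T)) : R :=
  (enorm (pgrad (z K) x) ^+ 2 + sigma F ^+ 2 * enorm (jump F u x) ^+ 2)
    `^ ((p - 2) / 2).

Definition B_form (p theta : R) (sigma : ifc -> R)
    (w : ifc -> 'I_(nelt T) -> R) (z u v : broken) : R :=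
  \int[lebesgue_rV n.+1]_(x in Omega) dotp (flux p (bgrad u x)) (bgrad v x)
  + int_Gamma (fun F x =>
      sigma F * avg (V := R^o) w F (stab p sigma F z u x)
        * dotp (jump F u x) (jump F v x))
  - int_Gamma (fun F x =>
      dotp (avg w F (fun K => flux p (pgrad (u K) x))) (jump F v x))
  + theta * int_Gamma (fun F x =>
      dotp (avg w F (fun K => stab p sigma F z u x K *: pgrad (v K) x))
        (jump F u x)).

Definition dgnorm (p : R) (sigma : ifc -> R) (u : broken) : R :=
  (\int[lebesgue_rV n.+1]_(x in Omega) enorm (bgrad u x) `^ p
   + int_Gamma (fun F x => sigma F `^ (p - 1) * enorm (jump F u x) `^ p))
  `^ p^-1.

Definition LpNorm (q : R) (g : 'rV[R]_n.+1 -> R) : \bar R :=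
  'N[lebesgue_rV n.+1]_q%:E[EFin \o (g \_ Omega)].

Definition in_Lp (q : R) (g : 'rV[R]_n.+1 -> R) : Prop :=
  g \_ Omega \in Lfun (lebesgue_rV n.+1) q%:E.

Definition Cinv : R := match n with 0 => 1 | 1 => 4 | _ => 8 end.

Definition Gconst (Cp : R) (r : 'I_(nelt T) -> nat) (K : 'I_(nelt T))
    (F : ifc) : R :=
  Cp * Cinv * ((2 * ((r K)%:R - 1) ^+ 2 + 1) * face_area K F)
    / (n.+1%:R * volume K).

Definition mu_eps (eps : R) : R := Num.max 1 (4 * eps)^-1.

Definition zeta (eps Cp : R) (r : 'I_(nelt T) -> nat) (F : ifc)
    (K : 'I_(nelt T)) : R :=
  eps / ((n_ifc K)%:R * mu_eps eps * Gconst Cp r K F).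

Definition zeta_sum (eps Cp : R) (r : 'I_(nelt T) -> nat) (F : ifc) : R :=
  zeta eps Cp r F (eplus F) +
  (if eminus F is Some L then zeta eps Cp r F L else 0).

Definition penalty (eps Cp : R) (r : 'I_(nelt T) -> nat) (F : ifc) : R :=
  (zeta_sum eps Cp r F)^-1.

Definition weight (eps Cp : R) (r : 'I_(nelt T) -> nat) (F : ifc)
    (K : 'I_(nelt T)) : R :=
  zeta eps Cp r F K / zeta_sum eps Cp r F.

End mesh.

Section constants.
Context {R : realType}.

Definition conjugate p : R := p / (p - 1).

Definition plap_map d (p a : R) (y : 'rV[R]_d) : 'rV[R]_d :=
  (a ^+ 2 + enorm y ^+ 2) `^ ((p - 2) / 2) *: y.

Definition growth_constant d (p C1 : R) : Prop :=
  0 < C1 /\ forall (y z : 'rV[R]_d) (a : R), 0 <= a ->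
    enorm (plap_map p a y - plap_map p a z)
      <= C1 * (a + enorm y + enorm z) `^ (p - 2) * enorm (y - z).

Definition monotonicity_constant d (p C2 : R) : Prop :=
  0 < C2 /\ forall (y z : 'rV[R]_d) (a : R), 0 <= a ->
    C2 * (a + enorm y + enorm z) `^ (p - 2) * enorm (y - z) ^+ 2
      <= dotp (plap_map p a y - plap_map p a z) (y - z).

Definition Ctilde (p C1 : R) : R :=
  (2 `^ (p - 1) + 2 `^ (2 * p - 4) + 2 `^ (2 * p - 3)) * C1 + 1.

Definition epsilon (p theta C1 C2 : R) : R :=
  let e1 := 2 `^ (1 - p) * C2 /
    (2 `^ (p - 2) * C1 + Ctilde p C1 + (2 `^ (p - 1) + 1) * `|theta|) in
  let e2 := 2 `^ (4 - p) / `|theta| in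
  let e3 := conjugate p / 4 * (p / 4) `^ (p - 1)^-1 in
  let e := Num.min e1 (Num.min e3 4^-1) in
  if theta == 0 then e else Num.min e2 e.

Definition inverse_constant (p Cp : R) : Prop :=
  2 `^ (p + 1) <= Cp \/
  exists k l : nat, [/\ (0 < k)%N, (0 < l)%N, p = 2 + 2 * l%:R / k%:R &
    Cp = 2 `^ (p / 2 + k%:R^-1) * p ^+ 2 * k%:R ^+ 2].

End constants.

(* Main.v *)
Require Import Defs.
From HB Require Import structures.
From mathcomp Require Import all_boot all_order all_algebra.
From mathcomp Require Import all_classical all_reals all_analysis.
From mathcomp Require Import measurable_realfun.
From mathcomp Require mpoly.
Import (canonicals, coercions) mpoly.
From mathcomp Require Import ring lra zify.

Set Implicit Arguments.
Unset Strict Implicit.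
Unset Printing Implicit Defensive.
Import Order.TTheory GRing.Theory Num.Theory.
Import numFieldNormedType.Exports.
Local Open Scope classical_set_scope.
Local Open Scope ring_scope.


(** Testing with v = u_h, everything reduces to the coercivity estimate
    |||u|||_p^p <= 2 B(u; u, u), after which Hoelder and Poincare conclude.

    On an interface, with a the gradient norm from one side, j the norm of the
    jump and s = sigma j, the three interface terms are homogeneous of degree p
    in (a, s).  They are bounded below by s^p / 2 - c a^p, distinguishing s >= 4 a
    from s < 4 a, with c of the order of 16^p; epsilon is of the order of 4^-p,
    so that 4 c epsilon^2 <= 1/2.

    The terms in a^p are paid for by the trace inequality
    int_F |grad u|^p <= G_{K,F} int_K |grad u|^p.  From a point x of the face, go
    along the segment parallel to the edge joining the apex to the j-th vertex of
    the face: it stays in K on a length proportional to the barycentric coordinate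
    l_j(x), and a one-dimensional inequality bounds l_j |grad u(x)|^p by the
    integral over it.  Summing over j (sum_j l_j = 1) and integrating over the face
    covers K at most d times, and d <= C_inv.

    In dimension one, for a polynomial q of degree s on [0, L] and p <= 2 N,
    |q(0)|^p L <= (N s + 1)^2 int |q|^p: at a point where M = max |q| is reached,
    apply the sharp L^2 endpoint inequality to q^N on both sides and use
    |q|^(2 N) <= M^(2 N - p) |q|^p. *)

(** * Endpoint inequality for polynomials *)

Section primitive.
Context {R : numFieldType}.
Implicit Types (q : {poly R}).

(** The interface terms fit together because [weight] is [zeta] times [penalty] and, unless
    [zeta_sum] vanishes, the weights of the sides sum to 1: the jump term is counted once, and the
    side of K costs only zeta a^p. As zeta carries the factor 1 / (m_K G), the constant G cancels
    against the trace inequality and m_K against the number of interfaces of K, which leaves eps /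
    mu_eps = 4 eps^2 times the integral over K, eps being at most 1/4. The trace constant must
    therefore not exceed G. With N minimal such that p <= 2 N and s = r - 1, this rests on (N s +
    1)^2 <= (N^2 / 2 + 1) (2 s^2 + 1) and on N^2 / 2 + 1 <= C_p, which holds for both choices of
    C_p. Hanging nodes shape the geometry: an interface may be only a part of a face, so the trace
    inequality is stated on a part; and since integrals over an interface use the face of K^+, the
    side of K^- requires that both faces induce the same surface measure. *)

Definition prim q : {poly R} := \poly_(i < (size q).+1) (q`_i.-1 / i%:R).

(** The formula includes i = 0: there 0^-1 = 0 makes the constant term vanish, so this is the
    antiderivative that is zero at 0. *)
Lemma coef_prim q i : (prim q)`_i = q`_i.-1 / i%:R.
Proof.
rewrite coef_poly; case: ltnP => // hi.
by rewrite nth_default ?mul0r// -ltnS (leq_trans hi)// leqSpred.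
Qed.

Lemma deriv_prim q : (prim q)^`() = q.
Proof.
apply/polyP => i; rewrite coef_deriv coef_prim /=.
by rewrite -[LHS]mulr_natr divfK ?pnatr_eq0.
Qed.

Lemma prim_deriv q : prim q^`() = q - (q`_0)%:P.
Proof.
apply/polyP => -[|i]; rewrite coef_prim coefB coefC /=.
  by rewrite invr0 mulr0 subrr.
by rewrite coef_deriv -[X in X / _]mulr_natr mulfK ?pnatr_eq0// subr0.
Qed.

Fact prim_linear : linear prim.
Proof.
by move=> a p q; apply/polyP => i; rewrite !(coefD, coefZ, coef_prim) mulrDl mulrA.
Qed.
HB.instance Definition _ := GRing.isLinear.Build R {poly R} {poly R} _ prim prim_linear.

Definition integ01 q : R := (prim q).[1].

Lemma integ01_linear : scalar integ01.
Proof. by move=> a p q; rewrite /integ01 linearP hornerD hornerZ. Qed.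
HB.instance Definition _ := GRing.isLinear.Build R {poly R} R _ integ01 integ01_linear.

Lemma integ01_deriv q : integ01 q^`() = q.[1] - q.[0].
Proof. by rewrite /integ01 prim_deriv hornerD hornerN hornerC horner_coef0. Qed.

Lemma integ01Xn i : integ01 'X^i = i.+1%:R^-1 :> R.
Proof.
have -> : ('X^i : {poly R}) = (i.+1%:R^-1 : R) *: (deriv 'X^(i.+1)).
  by rewrite derivXn/= -[X in _ *: X]scaler_nat scalerA mulVf ?pnatr_eq0// scale1r.
by rewrite linearZ/= integ01_deriv !hornerXn expr1n expr0n subr0 mulr1.
Qed.

End primitive.

Section endpoint_kernel.
Context {R : numFieldType}.
Variable s : nat.

Let P : {poly R} := \prod_(i < s) (i.+1%:R%:P - 'X).
Let D (j : 'I_s.+1) : {poly R} := \prod_(m < s.+1 | m != j) ('X + m.+1%:R%:P).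
Let c (j : 'I_s.+1) : R := (D j).[- j.+1%:R].
(* First row of the inverse of the Hilbert matrix: these are the residues in
   sum_j k_j / (t + j + 1) = (s + 1) prod_{i=1..s} (i - t) / prod_j (t + j + 1). *)
Definition endpoint_coef (j : 'I_s.+1) : R := s.+1%:R * P.[- j.+1%:R] / c j.

Let c_neq0 j : c j != 0.
Proof.
rewrite /c /D horner_prod; apply/prodf_neq0 => m mj.
rewrite hornerD hornerX hornerC addrC subr_eq0 eqr_nat eqSS.
by apply: contraNneq mj => /val_inj ->.
Qed.

Let DE (j m : 'I_s.+1) : (D j).[- m.+1%:R] = if m == j then c j else 0.
Proof.
case: eqVneq => [->//|mj].
rewrite /D horner_prod (bigD1 m)//= hornerD hornerX hornerC addNr mul0r//.
Qed.

(** Both sides have degree at most s and agree at the s + 1 points -1, ..., -(s + 1), at each of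
    which only one [D j] is nonzero. *)
Let lagrange : \sum_j endpoint_coef j *: D j = s.+1%:R *: P.
Proof.
apply/eqP; rewrite -subr_eq0; set Q := _ - _.
apply/eqP; apply: (@roots_geq_poly_eq0 _ _ [seq - (j : 'I_s.+1).+1%:R | j <- enum 'I_s.+1]).
- apply/allP => x /mapP[j _ ->]; rewrite /root /Q hornerD hornerN hornerZ.
  rewrite horner_sum (bigD1 j)//= big1 => [|i ij]; last first.
    by rewrite hornerZ DE eq_sym (negbTE ij) mulr0.
  by rewrite hornerZ DE eqxx addr0 /endpoint_coef divfK// subrr.
- by rewrite map_inj_uniq ?enum_uniq// => i j /oppr_inj/eqP; rewrite eqr_nat eqSS => /eqP/val_inj.
- rewrite size_map size_enum_ord /Q (leq_trans (size_polyD _ _))// geq_max.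
  have szP : (size P <= s.+1)%N.
    rewrite /P; apply: leq_trans (size_poly_prod_leq _ _) _.
    rewrite leq_subLR; apply: (@leq_trans (\sum_(i < s) 2).+1).
      rewrite ltnS; apply: leq_sum => i _.
      by rewrite (leq_trans (size_polyD _ _))// geq_max size_polyN size_polyX (leq_trans (size_polyC_leq1 _)).
    by rewrite sum_nat_const card_ord addnS muln2 -addnn.
  apply/andP; split; last first.
    by rewrite size_polyN (leq_trans (size_scale_leq _ _)).
  apply: (leq_trans (size_sum _ _ _)); apply/bigmax_leqP => j _.
  apply: (leq_trans (size_scale_leq _ _)).
  rewrite /D; apply: leq_trans (size_poly_prod_leq _ _) _.
  have hc : #|[pred m : 'I_s.+1 | m != j]| = s by rewrite (cardC1 j) card_ord.
  rewrite leq_subLR; apply: (@leq_trans (\sum_(m < s.+1 | m != j) 2).+1).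
    rewrite ltnS; apply: leq_sum => i _.
    by rewrite (leq_trans (size_polyD _ _))// geq_max size_polyX (leq_trans (size_polyC_leq1 _)).
  by rewrite sum_nat_const hc addnS muln2 -addnn.
Qed.

Let full_prod (i : nat) : \prod_(m < s.+1) (i%:R + m.+1%:R) != 0 :> R.
Proof. by apply/prodf_neq0 => m _; rewrite -natrD pnatr_eq0 addnS. Qed.

(** Evaluate [lagrange] at t = i and divide by the product of the i + m + 1. On the right P vanishes
    at 1, ..., s, while at i = 0 both the right side and the product are (s + 1)!. *)
Lemma endpoint_coefP i : (i <= s)%N ->
  \sum_j endpoint_coef j / (i + j).+1%:R = (i == 0%N)%:R.
Proof.
move=> si; apply: (mulIf (full_prod i)); rewrite mulr_suml.
transitivity (\sum_j endpoint_coef j *: D j).[i%:R].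
  rewrite horner_sum; apply: eq_bigr => j _; rewrite hornerZ /D horner_prod.
  rewrite (bigD1 j)//= -addnS natrD -mulrA mulKf -?natrD ?pnatr_eq0 ?addnS//.
  by congr (_ * _); apply: eq_bigr => m _; rewrite hornerD hornerX hornerC.
rewrite lagrange hornerZ /P horner_prod.
case: i si => [_|i si]; last first.
  by rewrite (bigD1 (Ordinal si))//= hornerD hornerN hornerX hornerC subrr !mul0r mulr0.
rewrite mul1r big_ord_recr/= add0r mulrC; congr (_ * _).
by apply: eq_bigr => m _; rewrite hornerD hornerN hornerX hornerC subr0 add0r.
Qed.

Lemma endpoint_coef0 : endpoint_coef ord0 = s.+1%:R ^+ 2.
Proof.
rewrite /endpoint_coef; have := c_neq0 ord0.
have -> : c ord0 = \prod_(i < s) i.+1%:R.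
  rewrite /c /D big_mkcond big_ord_recl/= mul1r horner_prod.
  by apply: eq_bigr => i _; rewrite /= /bump /= add1n hornerD hornerX hornerC addrC -natrB.
move=> h; apply: (mulIf h); rewrite divfK//.
rewrite expr2 -mulrA; congr (_ * _).
have -> : P.[-1] = \prod_(i < s) i.+2%:R.
  by rewrite /P horner_prod; apply: eq_bigr => i _; rewrite hornerD hornerN hornerX hornerC opprK natr1.
transitivity (\prod_(i < s.+1) i.+1%:R : R).
  by rewrite big_ord_recl/= mul1r.
by rewrite big_ord_recr/= mulrC.
Qed.

(** The Riesz representer, in L^2(0, 1), of evaluation at 0 on polynomials of degree at most s. *)
Definition endpoint_kernel : {poly R} := \sum_(j < s.+1) endpoint_coef j *: 'X^j.

Lemma endpoint_kernelP (q : {poly R}) : (size q <= s.+1)%N ->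
  integ01 (endpoint_kernel * q) = q.[0].
Proof.
move=> sq; rewrite -[in LHS](coefK q) poly_def mulr_sumr linear_sum/=.
rewrite horner_coef0.
rewrite (eq_bigr (fun i : 'I_(size q) => q`_i * (i == 0%N :> nat)%:R)); last first.
  move=> i _; rewrite -scalerAr linearZ/=; congr (_ * _).
  rewrite -endpoint_coefP; last by rewrite -ltnS (leq_trans (ltn_ord i)).
  rewrite /endpoint_kernel mulr_suml linear_sum/=; apply: eq_bigr => j _.
  by rewrite -scalerAl linearZ/= -exprD integ01Xn addnC.
case szq: (size q) => [|m].
  by rewrite big_ord0 nth_default ?szq.
by rewrite big_ord_recl big1 ?addr0 ?mulr1// => i _; rewrite mulr0.
Qed.

Lemma size_endpoint_kernel : (size endpoint_kernel <= s.+1)%N.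
Proof.
apply: (leq_trans (size_sum _ _ _)); apply/bigmax_leqP => j _.
by rewrite (leq_trans (size_scale_leq _ _))// size_polyXn.
Qed.

(** Since the kernel represents evaluation at 0, this value is also its squared L^2 norm, that is
    the sharp constant of [endpoint_L2]. *)
Lemma endpoint_kernel0 : endpoint_kernel.[0] = s.+1%:R ^+ 2.
Proof.
rewrite /endpoint_kernel horner_sum big_ord_recl big1 => [|i _].
  by rewrite addr0 hornerZ expr0 hornerC mulr1 endpoint_coef0.
by rewrite hornerZ hornerXn expr0n mulr0.
Qed.

End endpoint_kernel.

Section one_dimensional.
Context {R : realType}.
Notation mu := (@lebesgue_measure R).
Implicit Types q : {poly R}.

Lemma measurable_horner q : measurable_fun setT (horner q).
Proof. by apply: continuous_measurable_fun => x; exact: continuous_horner. Qed.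

Lemma measurable_norm_horner_powR q p :
  measurable_fun setT (fun x : R => `|q.[x]| `^ p).
Proof.
apply: (measurableT_comp (measurable_powR p)).
apply: (measurableT_comp (@normr_measurable R setT)).
exact: measurable_horner.
Qed.

Lemma integral_itv_horner q (a b : R) : a <= b ->
  (\int[mu]_(x in `[a, b]) (q.[x])%:E = ((prim q).[b] - (prim q).[a])%:E)%E.
Proof.
rewrite le_eqVlt => /predU1P[->|ab].
  by rewrite set_itv1 integral_set1 subrr.
rewrite (@continuous_FTC2 _ _ (horner (prim q)))//.
- by apply: continuous_subspaceT => x; exact: continuous_horner.
- split.
  + by move=> x _; exact: derivable_horner.
  + by apply: cvg_at_right_filter; exact: continuous_horner.
  + by apply: cvg_at_left_filter; exact: continuous_horner.
- by move=> x _; rewrite -[in RHS](deriv_prim q) derivE.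
Qed.

Lemma integ01_ge0 q : (forall x, 0 <= q.[x]) -> 0 <= integ01 q.
Proof.
move=> q0; have := integral_itv_horner q (@ler01 R).
rewrite [(prim q).[0]]horner_coef0 coef_prim invr0 mulr0 subr0 => h.
rewrite -lee_fin /integ01 -h.
by apply: integral_ge0 => x _; rewrite lee_fin.
Qed.

(** Cauchy-Schwarz for q(0) = int k q with int k^2 = c, obtained by expanding int (c q - q(0) k)^2 =
    c (c int q^2 - q(0)^2) >= 0. *)
Lemma endpoint_L2 q s : (size q <= s.+1)%N ->
  q.[0] ^+ 2 <= s.+1%:R ^+ 2 * integ01 (q ^+ 2).
Proof.
move=> sq; pose k : {poly R} := endpoint_kernel s; pose c : R := s.+1%:R ^+ 2.
have c0 : 0 < c by rewrite exprn_gt0.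
have kk : integ01 (k * k) = c by rewrite endpoint_kernelP ?size_endpoint_kernel// endpoint_kernel0.
have kq : integ01 (k * q) = q.[0] by rewrite endpoint_kernelP.
have : 0 <= integ01 ((c *: q - q.[0] *: k) ^+ 2).
  by apply: integ01_ge0 => x; rewrite horner_exp sqr_ge0.
have -> : (c *: q - q.[0] *: k) ^+ 2 =
    c ^+ 2 *: q ^+ 2 - (c * q.[0] + c * q.[0]) *: (k * q) + q.[0] ^+ 2 *: (k * k).
  by rewrite -!mul_polyC !expr2 !(polyCM, polyCD); ring.
rewrite linearD linearB/= !linearZ/= kk kq /GRing.scale/= => h.
have {}h : 0 <= c * (c * integ01 (q ^+ 2) - q.[0] ^+ 2).
  by apply: le_trans h _; rewrite le_eqVlt; apply/orP; left; apply/eqP; ring.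
by rewrite -subr_ge0; rewrite pmulr_rge0 in h.
Qed.

Lemma endpoint_L2_itv q s (a b : R) : (size q <= s.+1)%N -> a <= b ->
  let I := (prim (q ^+ 2)).[b] - (prim (q ^+ 2)).[a] in
  q.[a] ^+ 2 * (b - a) <= s.+1%:R ^+ 2 * I /\
  q.[b] ^+ 2 * (b - a) <= s.+1%:R ^+ 2 * I.
Proof.
move=> sq ab I.
(* J is the mean of q^2 between x and y in either order; taking y < x yields the right endpoint from
   the left one. *)
have key x y : exists J, q.[x] ^+ 2 <= s.+1%:R ^+ 2 * J /\
    (y - x) * J = (prim (q ^+ 2)).[y] - (prim (q ^+ 2)).[x].
  pose l : {poly R} := x%:P + (y - x) *: 'X; exists (integ01 ((q \Po l) ^+ 2)).
  have l0 : l.[0] = x by rewrite /l hornerD hornerZ hornerX hornerC mulr0 addr0.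
  have l1 : l.[1] = y by rewrite /l hornerD hornerZ hornerX hornerC mulr1 addrC subrK.
  split.
    have := @endpoint_L2 (q \Po l) s; rewrite horner_comp l0; apply.
    have [yx|xy] := eqVneq y x.
      rewrite /l yx subrr scale0r addr0 comp_polyCr.
      exact: leq_trans (size_polyC_leq1 _) _.
    rewrite size_comp_poly2// /l addrC size_polyDl size_scale ?subr_eq0// size_polyX//.
    by rewrite size_polyC; case: (x == 0).
  rewrite -[LHS]linearZ/= -l0 -l1 -!horner_comp -[RHS]integ01_deriv; congr integ01.
  rewrite deriv_comp deriv_prim /l derivD derivC derivZ derivX add0r l0 l1.
  by rewrite -scalerAr mulr1 !expr2 comp_polyM.
have [J [J1 J2]] := key a b; have [J' [J1' J2']] := key b a.
have ba0 : 0 <= b - a by rewrite subr_ge0.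
split.
  by apply: le_trans (ler_wpM2r ba0 J1) _; rewrite -mulrA ler_wpM2l// mulrC J2.
apply: le_trans (ler_wpM2r ba0 J1') _; rewrite -mulrA ler_wpM2l//.
by rewrite mulrC -opprB mulNr J2' opprB.
Qed.

Lemma poly_endpoint_Lp q (s N : nat) (p L : R) :
  (size q <= s.+1)%N -> 0 <= L -> 0 < p -> p <= (2 * N)%:R ->
  ((`|q.[0]| `^ p * L)%:E <= ((N * s).+1%:R ^+ 2)%:E *
     \int[mu]_(x in `[0%R, L]) (`|q.[x]| `^ p)%:E)%E.
Proof.
move=> sq L0 p0 pN.
have [|x0 x0L maxx0] := @EVT_max R (fun x => `|q.[x]|) 0 L L0.
  apply: continuous_subspaceT => x; apply: continuous_comp.
    exact: continuous_horner.
  exact: norm_continuous.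
pose M : R := `|q.[x0]|; rewrite -/M in maxx0.
have Iq0 : (0 <= \int[mu]_(x in `[0%R, L]) (`|q.[x]| `^ p)%:E)%E.
  by apply: integral_ge0 => x _; rewrite lee_fin powR_ge0.
have q0M : `|q.[0]| <= M by apply: maxx0; rewrite in_itv/= lexx.
have [M0|M0] := eqVneq M 0.
  have -> : `|q.[0]| = 0 by apply/eqP; rewrite eq_le normr_ge0 andbT; move: q0M; rewrite M0.
  by rewrite powR0 ?gt_eqF// mul0r mule_ge0// lee_fin sqr_ge0.
have {}M0 : 0 < M by rewrite lt_def M0 normr_ge0.
(* For non-even p, |q|^p is not a polynomial. The passage to q^(2 N) costs |q|^(2 N) <= c |q|^p,
   with equality at the maximum point, so the factor c cancels. *)
pose c := M `^ ((2 * N)%:R - p); have c0 : 0 < c by rewrite powR_gt0.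
have cM : c * M `^ p = M ^+ (2 * N).
  by rewrite /c -powRD ?subrK ?powR_mulrn ?(ltW M0)// (gt_eqF M0) implybT.
pose Q := q ^+ N; have sQ : (size Q <= (N * s).+1)%N.
  apply: leq_trans (size_poly_exp_leq _ _) _.
  by rewrite ltnS mulnC leq_mul2l -subn1 leq_subLR add1n sq orbT.
move: x0L; rewrite in_itv/= => /andP[x00 x0L].
have [_ h1] := endpoint_L2_itv sQ x00.
have [h2 _] := endpoint_L2_itv sQ x0L.
have h : M ^+ (2 * N) * L <= (N * s).+1%:R ^+ 2 *
    ((prim (Q ^+ 2)).[L] - (prim (Q ^+ 2)).[0]).
  have -> : M ^+ (2 * N) = Q.[x0] ^+ 2.
    by rewrite /Q /M horner_exp exprM real_normK ?num_real// -!exprM mulnC.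
  have := lerD h1 h2; rewrite -!mulrDr subr0.
  by rewrite addrC subrK [in X in _ <= X -> _]addrC subrKA.
rewrite -(@lee_pmul2l _ c%:E)//. 
apply: (@le_trans _ _ (M ^+ (2 * N) * L)%:E).
  rewrite -EFinM lee_fin mulrA -cM ler_wpM2r// ler_wpM2l// ?(ltW c0)//.
  by rewrite ge0_ler_powR ?nnegrE ?(ltW p0)// ltW.
rewrite muleCA; apply: (@le_trans _ _ (((N * s).+1%:R ^+ 2)%:E *
    ((prim (Q ^+ 2)).[L] - (prim (Q ^+ 2)).[0])%:E)%E).
  by rewrite -EFinM lee_fin.
apply: lee_wpmul2l; first by rewrite lee_fin sqr_ge0.
rewrite -integral_itv_horner// -ge0_integralZl//=; first last.
- by rewrite lee_fin ltW.
- apply/measurable_EFinP; apply: (measurable_funTS).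
  exact: measurable_norm_horner_powR.
apply: ge0_le_integral => //.
- by move=> x _; rewrite lee_fin /Q horner_exp sqr_ge0.
- apply/measurable_EFinP; apply: (measurable_funTS).
  exact: measurable_horner.
- apply: measurable_funeM; apply/measurable_EFinP; apply: (measurable_funTS).
  exact: measurable_norm_horner_powR.
move=> x /= xL; rewrite -EFinM lee_fin /Q !horner_exp -exprM mulnC.
have xM : `|q.[x]| <= M by apply: maxx0.
have -> : q.[x] ^+ (2 * N) = `|q.[x]| `^ (2 * N)%:R.
  by rewrite powR_mulrn// !exprM real_normK ?num_real.
have -> : ((2 * N)%:R = ((2 * N)%:R - p) + p :> R) by rewrite subrK.
rewrite powRD; last by rewrite subrK (gt_eqF (lt_le_trans p0 pN)).
by rewrite ler_wpM2r ?powR_ge0// ge0_ler_powR ?nnegrE ?subr_ge0// ltW.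
Qed.

End one_dimensional.


(** * Affine change of variables *)

Section change_of_variables.
Context {R : realType}.
Notation mu := (@lebesgue_measure R).

Lemma measurable_affine m n (A : 'M[R]_(m, n)) (b : 'rV[R]_n) :
  measurable_fun setT (fun y : 'rV[R]_m => b + y *m A).
Proof.
apply: measurable_fun_rVP => j.
rewrite (_ : _ \o _ = (fun y => b ord0 j + \sum_(i < m) rV_coord i y * A i j)).
  apply: measurable_funD => //.
  apply: measurable_sum => i; apply: measurable_funM => //.
  exact: measurable_rV_coord.
by apply/funext => t; rewrite /rV_coord /= !mxE.
Qed.

Lemma measurable_affineR (a b : R) :
  measurable_fun [set: measurableTypeR R] ((fun x : R => x * a + b) : measurableTypeR R -> measurableTypeR R).
Proof. by apply: measurable_funD => //; apply: measurable_funM. Qed.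

(** The pushforward of Lebesgue measure under x -> a x + b, times |a|, agrees with Lebesgue measure
    on half-open intervals, hence everywhere. For a < 0 the closed end of the interval changes
    side. *)
Lemma ge0_integral_affineR (a b : R) (h : R -> \bar R) : a != 0 ->
  measurable_fun [set: measurableTypeR R] h -> (forall x, 0 <= h x)%E ->
  (\int[mu]_x h x = `|a|%:E * \int[mu]_x h ((x : R) * a + b)%R)%E.
Proof.
move=> a0 mh h0.
pose nu : {measure set (measurableTypeR R) -> \bar R} :=
  mscale (NngNum (normr_ge0 a))
    (measure_function_pushforward__canonical__measure_function_Measure
       mu (measurable_affineR a b)).
have munu : forall A, measurable A -> mu A = nu A.
  apply: lebesgue_measure_unique => X [[u v]/= uv <-].
  rewrite /nu /mscale/= /pushforward.
  have [ap|an|a0'] := ltgtP 0 a; last by rewrite a0' eqxx in a0.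
  - rewrite (_ : _ @^-1` _ = `](u - b) / a, (v - b) / a]%classic); last first.
      apply/seteqP; split => x /=; rewrite !in_itv/= ltr_pdivrMr// ler_pdivlMr//;
      by rewrite ltrBlDr lerBrDr.
    rewrite !lebesgue_measure_itv/= !lte_fin ltr_pM2r ?invr_gt0// ltrD2r.
    case: ifP => _; last by rewrite mule0.
    rewrite -!EFinB -EFinM gtr0_norm//; congr EFin.
    by rewrite -mulrBl opprB addrA subrK mulrC divfK.
  - rewrite (_ : _ @^-1` _ = `[(v - b) / a, (u - b) / a[%classic); last first.
      apply/seteqP; split => x /=; rewrite !in_itv/= ltr_ndivlMr// ler_ndivrMr//;
      by rewrite ltrBlDr lerBrDr andbC.
    rewrite !lebesgue_measure_itv/= !lte_fin ltr_nM2r ?invr_lt0// ltrD2r.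
    case: ifP => _; last by rewrite mule0.
    rewrite -!EFinB -EFinM ltr0_norm//; congr EFin.
    by rewrite -mulrBl opprB addrA subrK mulNr mulrC divfK// opprB.
rewrite (@eq_measure_integral _ _ _ _ nu)//; last by move=> A mA _; exact: munu.
rewrite ge0_integral_mscale//; congr (_ * _)%E.
by rewrite ge0_integral_pushforward//; exact: measurable_affineR.
Qed.

Lemma ge0_integral_rV_cons n (h : 'rV[R]_n.+1 -> \bar R) :
  measurable_fun setT h -> (forall x, 0 <= h x)%E ->
  (\int[lebesgue_rV n.+1]_y h y = \int[mu]_x \int[lebesgue_rV n]_t h (rV_cons (x, t)))%E.
Proof.
move=> mh h0.
transitivity (\int[mu \x lebesgue_rV n]_z (h \o @rV_cons R n) z)%E.
    have := @ge0_integral_pushforward _ _ _ _ _ _ (@measurable_rV_cons R n)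
    ((@lebesgue_measure R) \x lebesgue_rV n)%E setT h.
  by rewrite preimage_setT; apply => //; move=> x _.
rewrite fubini_tonelli1//; last by move=> x; exact: h0.
by apply: measurableT_comp => //; exact: measurable_rV_cons.
Qed.

Lemma ge0_integral_rV_cons_swap n (h : 'rV[R]_n.+1 -> \bar R) :
  measurable_fun setT h -> (forall x, 0 <= h x)%E ->
  (\int[lebesgue_rV n.+1]_y h y = \int[lebesgue_rV n]_t \int[mu]_x h (rV_cons (x, t)))%E.
Proof.
move=> mh h0; rewrite ge0_integral_rV_cons//.
apply: (fubini_tonelli (m1 := mu) (m2 := lebesgue_rV n) (h \o @rV_cons R n)).
  by apply: measurableT_comp => //; exact: measurable_rV_cons.
by move=> x; exact: h0.
Qed.

(** A predicate on the matrix and the translation, since it is stable under composition and can thus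
    be checked on the factors of a matrix. *)
Definition change_var n (A : 'M[R]_n) (b : 'rV[R]_n) : Prop :=
  forall h : 'rV[R]_n -> \bar R, measurable_fun setT h -> (forall x, 0 <= h x)%E ->
    (\int[lebesgue_rV n]_x h x = `|\det A|%:E * \int[lebesgue_rV n]_y h (b + y *m A)%R)%E.

Lemma change_varM n (A A' : 'M[R]_n) b b' :
  change_var A b -> change_var A' b' -> change_var (A' *m A) (b + b' *m A).
Proof.
move=> cA cA' h mh h0; rewrite cA// cA'//; last first.
  by apply: measurableT_comp => //; exact: measurable_affine.
rewrite muleA -EFinM -normrM det_mulmx mulrC; congr (_ * _)%E.
by apply: eq_integral => y _; rewrite mulmxDl mulmxA addrA.
Qed.

Lemma change_varM0 n (A A' : 'M[R]_n) b :
  change_var A b -> change_var A' 0 -> change_var (A' *m A) b.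
Proof. by move=> cA cA'; rewrite -[b]addr0 -[X in _ + X](mul0mx _ A); exact: change_varM. Qed.

(** For a fixed first coordinate x, the remaining coordinates undergo A and a translation by b + x
    c; hence the hypothesis for all translations. *)
Lemma change_var_ublock n (a : R) (c : 'rV[R]_n) (A : 'M[R]_n)
    (b0 : 'rV[R]_1) (b : 'rV[R]_n) : a != 0 -> (forall b', change_var A b') ->
  change_var (block_mx a%:M c 0 A : 'M[R]_(1 + n)) (row_mx b0 b).
Proof.
move=> a0 cA h mh h0; rewrite ge0_integral_rV_cons//.
rewrite det_ublock det_scalar1 normrM EFinM.
pose H x := (\int[lebesgue_rV n]_t h (rV_cons (x, t)))%E.
have mhc : measurable_fun setT (h \o @rV_cons R n).
  by apply: measurableT_comp => //; exact: measurable_rV_cons.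
have H0 x : (0 <= H x)%E by apply: integral_ge0 => t _.
have mH : measurable_fun setT H.
  exact: (measurable_fun_fubini_tonelli_F (m2 := lebesgue_rV n) (h \o @rV_cons R n) mhc (fun x => h0 _)).
rewrite (ge0_integral_affineR (b0 ord0 ord0) a0 mH H0) -muleA; congr (_ * _)%E.
rewrite ge0_integral_rV_cons//; last first.
  by apply: measurableT_comp => //; exact: measurable_affine.
rewrite -ge0_integralZl//; first last.
- by move=> x _; apply: integral_ge0.
- pose k := h \o (fun y => row_mx b0 b + y *m (block_mx a%:M c 0 A : 'M[R]_(1 + n))) \o @rV_cons R n.
  apply: (measurable_fun_fubini_tonelli_F (m2 := lebesgue_rV n) k) => [|z]; last exact: h0.
  apply: measurableT_comp; last exact: measurable_rV_cons.
  by apply: measurableT_comp => //; exact: measurable_affine.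
apply: eq_integral => x _; rewrite /H.
rewrite (cA (b + x *: c) (fun t => h (rV_cons (x * a + b0 ord0 ord0, t))))//; last first.
  apply: (measurableT_comp mhc).
  exact: pair1_measurable.
congr (_ * _)%E; apply: eq_integral => t _; congr h.
rewrite /rV_cons/= mul_row_block add_row_mx mulmx0 addr0; congr row_mx.
  by rewrite mul_mx_scalar; apply/rowP => i; rewrite !ord1 !mxE addrC [a * x]mulrC.
rewrite -addrA; congr (_ + (_ + _)).
by apply/rowP => i; rewrite !mxE big_ord1 mxE.
Qed.

(** With the other coordinates t fixed, the first one is merely translated by t c, so it has to be
    integrated first. *)
Lemma change_var_lblock n (c : 'M[R]_(n, 1)) :
  change_var (block_mx 1%:M 0 c 1%:M : 'M[R]_(1 + n)) 0.
Proof.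
move=> h mh h0; rewrite det_lblock !det1 mulr1 normr1 mul1e.
rewrite !ge0_integral_rV_cons_swap//; last first.
  by apply: measurableT_comp => //; exact: measurable_affine.
apply: eq_integral => t _.
rewrite (@ge0_integral_affineR 1 ((t *m c) ord0 ord0)) ?oner_eq0//; last first.
  apply: (@measurableT_comp _ _ _ _ _ _ h _ (fun x => rV_cons (x, t))) => //.
  apply: measurableT_comp; first exact: measurable_rV_cons.
  exact: pair2_measurable.
rewrite normr1 mul1e; apply: eq_integral => x _; congr h.
rewrite /rV_cons/= add0r mul_row_block !mulmx1 mulmx0 add0r; congr row_mx.
by apply/rowP => i; rewrite !ord1 !mxE mulr1.
Qed.

(* When A 0 0 <> 0, A is a lower transvection times a block upper triangular
   matrix; otherwise add to the first row one with a nonzero first entry. *)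
Lemma change_var_unitmx n (A : 'M[R]_n) (b : 'rV[R]_n) :
  A \in unitmx -> change_var A b.
Proof.
elim: n A b => [|n IHn] A b uA.
  by move=> h mh h0; rewrite det_mx00 normr1 mul1e; apply: eq_integral => y _; rewrite [RHS](_ : _ = h y)// thinmx0 (thinmx0 y).
have key (B : 'M[R]_(1 + n)) b' : B \in unitmx -> B ord0 ord0 != 0 -> change_var B b'.
  move=> uB; set a := B ord0 ord0 => a0.
  pose c := a^-1 *: dlsubmx B.
  (* The Schur complement of the entry a, invertible because det B = a det S. *)
  pose S := drsubmx B - c *m ursubmx B.
  have BE : B = block_mx 1%:M 0 c 1%:M *m block_mx a%:M (ursubmx B) 0 S.
    rewrite mulmx_block !mul1mx !mul0mx !addr0 [_ *m _ + S]addrC subrK.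
    rewrite mul_mx_scalar /c scalerA mulfV// scale1r.
    rewrite -[LHS]submxK; congr block_mx.
    by rewrite [LHS]mx11_scalar; congr (_ %:M); rewrite !mxE; congr (B _ _); apply/val_inj.
  have uS : S \in unitmx.
    move: uB; rewrite unitmxE BE det_mulmx det_lblock !det1 !mul1r det_ublock.
    by rewrite unitrM unitmxE => /andP[].
  rewrite {}BE; apply: change_varM0; last exact: change_var_lblock.
  by rewrite -[b']hsubmxK; apply: change_var_ublock => // b''; exact: IHn.
have [A0|A0] := eqVneq (A ord0 ord0) 0; last exact: (key A).
have [i Ai] : exists i, A (lift ord0 i) ord0 != 0.
  apply/existsP; apply: contraLR uA; rewrite negb_exists => /forallP h.
  rewrite unitmxE (expand_det_col _ ord0) big_ord_recl A0 mul0r add0r big1 ?unitr0// => j _.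
  by have := h j; rewrite negbK => /eqP ->; rewrite mul0r.
pose E (s : R) : 'M[R]_(1 + n) := block_mx 1%:M (s *: delta_mx ord0 i) 0 1%:M.
have E1 : E (-1) *m E 1 = 1%:M.
  rewrite /E mulmx_block !mulmx0 !mul0mx !mul1mx !mulmx1 !addr0 add0r.
  by rewrite scaleN1r scale1r subrr -scalar_mx_block.
pose A1 : 'M[R]_(1 + n) := A.
have o0 : ord0 = lshift n (ord0 : 'I_1) by exact/val_inj.
have EA00 : (E 1 *m A1) ord0 ord0 != 0.
  rewrite -[A1]submxK /E mulmx_block o0 block_mxEul mul1mx scale1r -rowE.
  rewrite !mxE -o0 [A1 _ _]A0 add0r.
  by rewrite (_ : rshift 1 i = lift ord0 i)//; exact/val_inj.
have uE s : E s \in unitmx by rewrite unitmxE det_ublock !det1 mulr1 unitr1.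
rewrite -[A](mul1mx A1) -E1 -mulmxA.
apply: change_varM0; first by apply: key => //; rewrite unitmx_mul uE.
by apply: key => //; rewrite o0 /E block_mxEul mxE eqxx oner_eq0.
Qed.

Lemma ge0_integral_affine n (A : 'M[R]_n) (b : 'rV[R]_n) (h : 'rV[R]_n -> \bar R) :
  A \in unitmx -> measurable_fun setT h -> (forall x, 0 <= h x)%E ->
  (\int[lebesgue_rV n]_x h x =
   `|\det A|%:E * \int[lebesgue_rV n]_y h (b + y *m A)%R)%E.
Proof. by move=> uA; exact: change_var_unitmx. Qed.

End change_of_variables.


(** * Simplices *)

Section open_measurable.
Context {R : realType}.

(** The measurable sets are generated by the coordinates, the open ones by the sup norm: an open set
    is the countable union of the rational boxes that it contains. *)
Lemma open_measurable_rV n (A : set 'rV[R]_n) : open A -> measurable A.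
Proof.
move=> oA; pose box (ab : 'rV[rat]_n * 'rV[rat]_n) : set 'rV[R]_n :=
  \bigcap_(i in [set: 'I_n]) (rV_coord i @^-1` `]ratr (ab.1 ord0 i), ratr (ab.2 ord0 i)[).
have mbox ab : measurable (box ab).
  apply: fin_bigcap_measurable => // i _; rewrite -[X in measurable X]setTI.
  exact: measurable_rV_coord.
have -> : A = \bigcup_ab (if `[< box ab `<=` A >] then box ab else set0).
  apply/seteqP; split => [x Ax|x [ab _]]; last by case: asboolP => // + bx; exact.
  have /nbhs_ballP[e /= e0 xeA] := oA x Ax.
  have /boolp.choice[a Pa] : forall i, exists q : rat, ratr q \in `]x ord0 i - e, x ord0 i[%R.
    by move=> i; apply: rat_in_itvoo; rewrite ltrBlDr ltrDl.
  have /boolp.choice[b Pb] : forall i, exists q : rat, ratr q \in `]x ord0 i, x ord0 i + e[%R.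
    by move=> i; apply: rat_in_itvoo; rewrite ltrDl.
  exists (\row_i a i, \row_i b i) => //.
  case: asboolP => [_ i _|[]]; rewrite /= ?mxE.
    by move: (Pa i) (Pb i); rewrite !in_itv/= => /andP[_ ->] /andP[->].
  move=> y xy; apply: xeA; split => // i j; rewrite ord1 /ball/=.
  have := xy j I; rewrite /= /rV_coord !mxE in_itv/=.
  move: (Pa j) (Pb j); rewrite !in_itv/= => /andP[a1 a2] /andP[b1 b2] /andP[y1 y2].
  by rewrite ltr_distlC; apply/andP; split; [exact: lt_trans y1|exact: lt_trans b2].
apply: countable_bigcupT_measurable => [|ab]; first exact: countableP.
by case: ifP.
Qed.

Lemma closed_measurable_rV n (A : set 'rV[R]_n) : closed A -> measurable A.
Proof.
by move=> cA; rewrite -[A]setCK; apply: measurableC; apply: open_measurable_rV; exact: closed_openC.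
Qed.

End open_measurable.

Section barycentric.
Context {R : realType}.
Variables (d : nat) (V : 'M[R]_(d.+1, d)).

Definition homog_mx : 'M[R]_(d.+1) := row_mx (const_mx 1 : 'cV_d.+1) V.
Definition homog (x : 'rV[R]_d) : 'rV[R]_(d.+1) := row_mx (const_mx 1 : 'rV_1) x.

(** The single linear system l (1 | V) = (1 | x) encodes both that l sums to 1 and that l V = x; the
    barycentric coordinates are thereby defined on the whole space. *)
Definition bary (x : 'rV[R]_d) : 'rV[R]_(d.+1) := homog x *m invmx homog_mx.

Lemma homog0 x : homog x ord0 ord0 = 1.
Proof.
have o0 : ord0 = lshift d (ord0 : 'I_1) :> 'I_d.+1 by exact/val_inj.
by rewrite o0; apply: etrans (row_mxEl (const_mx 1 : 'rV_1) x ord0 ord0) _; rewrite mxE.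
Qed.

Lemma homogS x j : homog x ord0 (lift ord0 j) = x ord0 j.
Proof.
have oS : lift ord0 j = rshift 1 j :> 'I_d.+1 by exact/val_inj.
by rewrite oS; exact: (row_mxEr (const_mx 1 : 'rV_1) x ord0 j).
Qed.

Lemma mul_homog_mx (l : 'rV[R]_d.+1) :
  l *m homog_mx = row_mx (\sum_i l ord0 i)%:M (l *m V) :> 'rV_(1 + d).
Proof.
rewrite -[LHS]/(l *m (row_mx (const_mx 1 : 'cV_d.+1) V : 'M[R]_(d.+1, 1 + d))).
rewrite mul_mx_row; congr row_mx.
by apply/rowP => i; rewrite !mxE ord1 eqxx mulr1n; apply: eq_bigr => j _; rewrite mxE mulr1.
Qed.

Hypothesis aV : aff_indep V.

Lemma homog_mx_unit : homog_mx \in unitmx.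
Proof. by rewrite -row_free_unit. Qed.

Lemma baryP x : \sum_i bary x ord0 i = 1 /\ bary x *m V = x.
Proof.
have := mul_homog_mx (bary x); rewrite /bary mulmxKV ?homog_mx_unit// /homog.
by move=> /eq_row_mx[/rowP/(_ ord0)]; rewrite !mxE eqxx mulr1n => <- <-.
Qed.

Lemma bary_sum x : \sum_i bary x ord0 i = 1. Proof. by have [] := baryP x. Qed.
Lemma baryK x : bary x *m V = x. Proof. by have [] := baryP x. Qed.

Lemma bary_uniq (l : 'rV[R]_d.+1) x : \sum_i l ord0 i = 1 -> l *m V = x -> bary x = l.
Proof.
move=> l1 lx; apply: (can_inj (mulmxK homog_mx_unit)).
rewrite /bary mulmxKV ?homog_mx_unit// mul_homog_mx l1 lx.
apply: (congr1 (fun c : 'rV_1 => row_mx c x)).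
by apply/rowP => i; rewrite !mxE ord1 eqxx.
Qed.

Lemma hullE : hull V = [set x | forall i, 0 <= bary x ord0 i].
Proof.
apply/seteqP; split => x.
  by move=> [l [l0 l1 xl]] i; rewrite (@bary_uniq l).
by move=> x0; exists (bary x); split => //; [exact: bary_sum|rewrite baryK].
Qed.

Lemma baryD x y z (s : R) : bary (x + s *: (y - z)) = bary x + s *: (bary y - bary z).
Proof.
rewrite /bary -mulmxBl scalemxAl -mulmxDl; congr (_ *m _).
apply/rowP => i.
transitivity (homog x ord0 i + s * (homog y ord0 i - homog z ord0 i)); last by rewrite !mxE.
case: (unliftP ord0 i) => [j ->|->]; rewrite !(homogS, homog0) ?subrr ?mulr0 ?addr0//.
by rewrite !mxE.
Qed.

Lemma baryDE x y z (s : R) i : bary (x + s *: (y - z)) ord0 i =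
  bary x ord0 i + s * (bary y ord0 i - bary z ord0 i).
Proof.
by rewrite baryD; move: (bary x) (bary y) (bary z) => a b c; rewrite !mxE.
Qed.

Lemma bary_continuous i : continuous (fun x => bary x ord0 i).
Proof.
have -> : (fun x : 'rV[R]_d => bary x ord0 i) = (fun x : 'rV[R]_d =>
    (invmx homog_mx) ord0 i + \sum_(j < d) x ord0 j * (invmx homog_mx) (lift ord0 j) i).
  apply/funext => x; rewrite /bary mxE big_ord_recl homog0 mul1r; congr (_ + _).
  by apply: eq_bigr => j _; rewrite homogS.
move=> x; pose f y := \sum_(j < d) (y : 'rV[R]_d) ord0 j * (invmx homog_mx) (lift ord0 j) i.
have cf : {for x, continuous f}.
  apply: continuous_big => [y|j _]; first exact: add_continuous.
  move=> y; apply: (@continuousM _ _ (fun z : 'rV[R]_d => z ord0 j) (cst _) y).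
    exact: coord_continuous.
  exact: cst_continuous.
apply: (@continuousD _ _ _ (cst (invmx homog_mx ord0 i)) f x) cf.
exact: cst_continuous.
Qed.

Lemma bary_vertex k i : bary (row k V) ord0 i = (i == k)%:R.
Proof.
rewrite (@bary_uniq (delta_mx ord0 k)) ?mxE ?eqxx//; last by rewrite rowE.
rewrite (bigD1 k)//= big1 ?addr0 ?mxE ?eqxx// => j jk.
by rewrite mxE (negbTE jk) andbF.
Qed.

Lemma closed_hull : closed (hull V).
Proof.
rewrite hullE (_ : [set x | _] = \bigcap_(i in [set: 'I_d.+1]) [set x | 0 <= bary x ord0 i]); last first.
  by apply/seteqP; split => [x h i _|x h i]; exact: h.
apply: closed_bigI => i _; have /continuous_closedP := @bary_continuous i.
by move=> /(_ [set y | 0 <= y]); apply; exact: closed_ge.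
Qed.

(** If the k-th coordinate of x is 0, then moving x away from the k-th vertex makes it negative at
    once, so x is not interior. The converse is the continuity of finitely many coordinates. *)
Lemma interior_hull : (hull V)° = [set x | forall i, 0 < bary x ord0 i].
Proof.
apply/seteqP; split => [x xV|].
  have Vx := interior_subset xV; rewrite hullE in Vx.
  move=> k; rewrite lt_neqAle Vx andbT eq_sym; apply/negP => /eqP xk.
  have : (fun s : R => x + s *: (x - row k V)) @ (0:R) --> x.
    rewrite [X in _ --> X](_ : x = x + (0 : R) *: (x - row k V)); last first.
      by rewrite scale0r addr0.
    apply: (@continuousD _ _ _ (cst x) (fun s : R => s *: (x - row k V)) 0).
      exact: cst_continuous.
    by apply: cvgZr_tmp.
  move=> /(_ _ xV); rewrite near_simpl => /nbhs_ballP[e /= e0 he].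
  have : hull V (x + (e / 2) *: (x - row k V)).
    apply: he; rewrite /ball/= sub0r normrN gtr0_norm ?divr_gt0//.
    by rewrite ltr_pdivrMr// mulrDr mulr1 ltrDl.
  rewrite hullE => /(_ k); rewrite baryDE xk add0r bary_vertex eqxx.
  by rewrite sub0r mulrN1 oppr_ge0 leNgt divr_gt0.
rewrite -open_subsetE.
  by move=> x x0; rewrite hullE => i; exact/ltW/x0.
rewrite openE => x x0.
apply: (@filter_forall _ _ (fun i => [set y | 0 < bary y ord0 i]) _ (nbhs_filter x)) => i.
have : nbhs (bary x ord0 i) [set y | 0 < y].
  by apply: open_nbhs_nbhs; split; [exact: open_gt|exact: x0].
by move/(@bary_continuous i x).
Qed.

End barycentric.


Lemma measurable_sqrt (R : realType) : measurable_fun setT (@Num.sqrt R).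
Proof. by apply: continuous_measurable_fun; exact: sqrt_continuous. Qed.

Lemma measurable_fun_sqrt d (T : measurableType d) (R : realType) (f : T -> R) :
  measurable_fun setT f -> measurable_fun setT (fun x => Num.sqrt (f x)).
Proof. by move=> mf; apply: (measurableT_comp (@measurable_sqrt R)). Qed.

Section euclidean_lemmas.
Context {R : realType}.
Variable d : nat.
Implicit Types x y z : 'rV[R]_d.

Lemma dotpC x y : dotp x y = dotp y x.
Proof. by apply: eq_bigr => i _; rewrite mulrC. Qed.

Lemma dotpDl x y z : dotp (x + y) z = dotp x z + dotp y z.
Proof. by rewrite /dotp -big_split; apply: eq_bigr => i _; rewrite mxE mulrDl. Qed.

Lemma dotpZl (a : R) x y : dotp (a *: x) y = a * dotp x y.
Proof. by rewrite /dotp mulr_sumr; apply: eq_bigr => i _; rewrite mxE mulrA. Qed.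

Lemma dotpDr x y z : dotp z (x + y) = dotp z x + dotp z y.
Proof. by rewrite dotpC dotpDl !(dotpC z). Qed.

Lemma dotpZr (a : R) x y : dotp x (a *: y) = a * dotp x y.
Proof. by rewrite dotpC dotpZl dotpC. Qed.

Lemma dotp0l x : dotp 0 x = 0.
Proof. by apply: big1 => i _; rewrite mxE mul0r. Qed.

Lemma dotpxx_ge0 x : 0 <= dotp x x.
Proof. by apply: sumr_ge0 => i _; rewrite -expr2 sqr_ge0. Qed.

Lemma enorm_ge0 x : 0 <= enorm x. Proof. exact: sqrtr_ge0. Qed.

Lemma enorm_sqr x : enorm x ^+ 2 = dotp x x.
Proof. by rewrite sqr_sqrtr// dotpxx_ge0. Qed.

Lemma enorm0_eq0 x : enorm x = 0 -> x = 0.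
Proof.
move=> x0; have /eqP : dotp x x = 0 by rewrite -enorm_sqr x0 expr0n.
rewrite psumr_eq0 => [/allP h|i _]; last by rewrite -expr2 sqr_ge0.
apply/rowP => i; rewrite mxE; apply/eqP; have := h i (mem_index_enum _).
by rewrite /= mulf_eq0 orbb.
Qed.

Lemma dotp_le x y : dotp x y <= enorm x * enorm y.
Proof.
have [x0|x0] := eqVneq (enorm x) 0.
  by rewrite (enorm0_eq0 x0) dotp0l mulr_ge0// enorm_ge0.
have [y0|y0] := eqVneq (enorm y) 0.
  by rewrite (enorm0_eq0 y0) dotpC dotp0l mulr_ge0// enorm_ge0.
have xp : 0 < enorm x by rewrite lt_def x0 enorm_ge0.
have yp : 0 < enorm y by rewrite lt_def y0 enorm_ge0.
have := dotpxx_ge0 (enorm y *: x + (- enorm x) *: y).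
rewrite !(dotpDl, dotpDr, dotpZl, dotpZr) -!enorm_sqr (dotpC y x) => h.
rewrite -subr_ge0 -(pmulr_rge0 _ (mulr_gt0 xp yp)).
by rewrite -(@pmulr_rge0 _ 2)//; apply: le_trans h _; rewrite le_eqVlt; apply/orP; left; apply/eqP; ring.
Qed.

Lemma normr_dotp_le x y : `|dotp x y| <= enorm x * enorm y.
Proof.
rewrite ler_norml dotp_le andbT lerNl -[- dotp x y]mulN1r -dotpZl.
apply: le_trans (dotp_le _ _) _; rewrite le_eqVlt; apply/orP; left; apply/eqP; congr (_ * _).
by rewrite /enorm dotpZl dotpZr !mulN1r opprK.
Qed.

End euclidean_lemmas.

(** * Polynomial fields along a line *)

Section line_restriction.
Context {R : realType}.
Variable n : nat.
Implicit Types (P : mpoly.mpoly n.+1 R) (x v : 'rV[R]_n.+1).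

(** The total degree, and not the degree in each variable, bounds the degree along every line. *)
Lemma pval_line P s x v : (mpoly.msize P <= s.+1)%N ->
  exists2 q : {poly R}, (size q <= s.+1)%N & forall t, q.[t] = pval P (x + t *: v).
Proof.
move=> sP; pose l i : {poly R} := (x ord0 i)%:P + v ord0 i *: 'X.
pose mono (m : mpoly.multinom n.+1) : {poly R} := \prod_i l i ^+ (m i).
exists (\sum_(m <- mpoly.msupp P) mpoly.mcoeff m P *: mono m).
  have szl i : (size (l i) <= 2)%N.
    rewrite /l (leq_trans (size_polyD _ _))// geq_max (leq_trans (size_polyC_leq1 _))//=.
    by rewrite (leq_trans (size_scale_leq _ _))// size_polyX.
  have szp i e : (size (l i ^+ e) <= e.+1)%N.
    apply: leq_trans (size_poly_exp_leq _ _) _; rewrite ltnS.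
    by rewrite -[leqRHS]mul1n leq_mul2r; case: (size (l i)) (szl i) => [|[|[]]]//; rewrite orbT.
  rewrite big_seq; apply: (leq_trans (size_sum _ _ _)); apply/bigmax_leqP_seq => m _ mP.
  apply: (leq_trans (size_scale_leq _ _)).
  apply: leq_trans (_ : (mpoly.mdeg m).+1 <= _)%N; last first.
    by apply: leq_trans sP; exact: mpoly.msize_mdeg_lt.
  apply: leq_trans (size_poly_prod_leq _ _) _; rewrite leq_subLR.
  apply: (@leq_trans (\sum_i (m i).+1).+1); first by rewrite ltnS leq_sum.
  rewrite mpoly.mdegE addnS ltnS; under eq_bigr do rewrite -addn1.
  by rewrite big_split /= sum1_card addnC.
move=> t; rewrite /pval mpoly.mevalE horner_sum; apply: eq_bigr => m _.
rewrite hornerZ horner_prod; congr (_ * _); apply: eq_bigr => i _.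
by rewrite horner_exp !hornerE !mxE mulrC.
Qed.

Definition vfield (P : 'I_n.+1 -> mpoly.mpoly n.+1 R) y : 'rV[R]_n.+1 :=
  \row_i pval (P i) y.

Lemma vfieldE (P : 'I_n.+1 -> mpoly.mpoly n.+1 R) y i : vfield P y ord0 i = pval (P i) y.
Proof. by rewrite mxE. Qed.

(** The norm of the field is not a polynomial. Its component along the fixed unit vector xi = g(x) /
    |g(x)| is one on the line, equals |g(x)| at t = 0, and is at most |g| elsewhere. *)
Lemma vector_endpoint_Lp (P : 'I_n.+1 -> mpoly.mpoly n.+1 R) (s N : nat) (p L : R) x v :
  (forall i, (mpoly.msize (P i) <= s.+1)%N) -> 0 <= L -> 0 < p -> p <= (2 * N)%:R ->
  ((enorm (vfield P x) `^ p * L)%:E <= ((N * s).+1%:R ^+ 2)%:E *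
     \int[lebesgue_measure]_(t in `[0%R, L]) (enorm (vfield P (x + t *: v)%R) `^ p)%:E)%E.
Proof.
move=> sP L0 p0 pN; pose g := vfield P; rewrite -/g.
have I0 : (0 <= \int[lebesgue_measure]_(t in `[0%R, L]) (enorm (g (x + t *: v)%R) `^ p)%:E)%E.
  by apply: integral_ge0 => t _; rewrite lee_fin powR_ge0.
have [gx0|gx0] := eqVneq (enorm (g x)) 0.
  by rewrite gx0 powR0 ?gt_eqF// mul0r mule_ge0// lee_fin sqr_ge0.
have gxp : 0 < enorm (g x) by rewrite lt_def gx0 enorm_ge0.
have /boolp.choice[q /all_and2[sq qE]] : forall i, exists q : {poly R},
    (size q <= s.+1)%N /\ forall t, q.[t] = pval (P i) (x + t *: v).
  by move=> i; have [q sq qE] := pval_line x v (sP i); exists q.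
pose xi := (enorm (g x))^-1 *: g x.
pose Q := \sum_i xi ord0 i *: q i.
have QE t : Q.[t] = dotp xi (g (x + t *: v)).
  by rewrite /Q horner_sum; apply: eq_bigr => i _; rewrite hornerZ qE /g vfieldE.
have sQ : (size Q <= s.+1)%N.
  apply: (leq_trans (size_sum _ _ _)); apply/bigmax_leqP => i _.
  by rewrite (leq_trans (size_scale_leq _ _)).
have Q0 : `|Q.[0]| = enorm (g x).
  rewrite QE scale0r addr0 dotpZl -enorm_sqr expr2 mulKf//.
  by rewrite ger0_norm// enorm_ge0.
have xi1 : enorm xi = 1.
  by apply/eqP; rewrite -(eqrXn2 (n := 2)) ?enorm_ge0// enorm_sqr dotpZl dotpZr -enorm_sqr expr2 mulKf// mulVf// expr1n.
have Qle t : `|Q.[t]| <= enorm (g (x + t *: v)).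
  by rewrite QE (le_trans (normr_dotp_le _ _))// xi1 mul1r.
rewrite -Q0; apply: le_trans (poly_endpoint_Lp sQ L0 p0 pN) _.
apply: lee_wpmul2l; first by rewrite lee_fin sqr_ge0.
apply: ge0_le_integral => //.
- apply/measurable_EFinP; apply: measurable_funTS; exact: measurable_norm_horner_powR.
- apply/measurable_EFinP; apply: measurable_funTS.
  apply: (measurableT_comp (measurable_powR p)).
  rewrite (_ : (fun t => _) = fun t => Num.sqrt (\sum_i (q i).[t] ^+ 2)); last first.
    apply/funext => t; rewrite /enorm; congr Num.sqrt.
    by apply: eq_bigr => i _; rewrite /g vfieldE -qE expr2.
  apply: measurable_fun_sqrt.
  by apply: measurable_sum => i; apply: measurable_funX; exact: measurable_horner.
move=> t _; rewrite lee_fin ge0_ler_powR ?nnegrE ?enorm_ge0 ?(ltW p0)//.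
Qed.

End line_restriction.


Lemma measure_integral_indic d (T : measurableType d) (R : realType)
    (m : {measure set T -> \bar R}) (A : set T) : measurable A ->
  m A = (\int[m]_x (\1_A x)%:E)%E.
Proof. by move=> mA; rewrite integral_indic// setIT. Qed.

Lemma eq_indic (R : realType) T U (A : set T) (B : set U) x y :
  (A x <-> B y) -> \1_A x = \1_B y :> R.
Proof.
move=> AB; rewrite !indicE; have -> // : (x \in A) = (y \in B).
by apply/idP/idP; rewrite !inE => /AB.
Qed.

(** * Volume of the standard simplex *)

Section standard_simplex.
Context {R : realType}.
Notation mu := (@lebesgue_measure R).

(** The size s is free because slices of the unit simplex, in the induction on the dimension, have
    size 1 - x. *)
Definition simplex_upto m (s : R) : set 'rV[R]_m :=
  [set t | (forall i, 0 <= t ord0 i) /\ \sum_i t ord0 i <= s].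

Lemma measurable_simplex_upto m s : measurable (@simplex_upto m s).
Proof.
rewrite (_ : simplex_upto s = (\bigcap_(i in [set: 'I_m]) (rV_coord i @^-1` `[0, +oo[)) `&`
    ((fun t : 'rV[R]_m => \sum_i rV_coord i t) @^-1` `]-oo, s])); last first.
  apply/seteqP; split => t; rewrite /simplex_upto/=.
    move=> [t0 ts]; split; last by rewrite in_itv.
    by move=> i _; rewrite /= in_itv/= andbT; exact: t0.
  move=> [t0 ts]; split; last by move: ts; rewrite in_itv.
  by move=> i; have := t0 i I; rewrite /= in_itv/= andbT.
apply: measurableI.
  apply: fin_bigcap_measurable => // i _; rewrite -[X in measurable X]setTI.
  exact: measurable_rV_coord.
rewrite -[X in measurable X]setTI; apply: measurable_sum => // i.
exact: measurable_rV_coord.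
Qed.

Lemma lebesgue_simplex_upto m s : 0 < s ->
  lebesgue_rV m (simplex_upto s) = ((s ^+ m)%:E * lebesgue_rV m (simplex_upto 1))%E.
Proof.
move=> s0; have ms := @measurable_simplex_upto m s.
have m1 := @measurable_simplex_upto m 1.
rewrite [LHS]measure_integral_indic//.
rewrite (@ge0_integral_affine _ m (s%:M) 0)//; first last.
- exact/measurable_EFinP.
- by rewrite unitmxE det_scalar unitrX// unitfE gt_eqF.
rewrite det_scalar ger0_norm ?exprn_ge0 ?ltW//; congr (_ * _)%E.
rewrite [RHS]measure_integral_indic//; apply: eq_integral => t _.
congr (_%:E); apply: eq_indic; rewrite /simplex_upto/= add0r mul_mx_scalar; split.
  move=> [t0 ts]; split => [i|]; first by have := t0 i; rewrite mxE pmulr_rge0.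
  rewrite -(ler_pM2l s0) mulr1 mulr_sumr; apply: le_trans ts.
  by apply: ler_sum => i _; rewrite mxE.
move=> [t0 ts]; split => [i|]; first by rewrite mxE pmulr_rge0.
rewrite -[leRHS]mulr1; have {}ts := ler_wpM2l (ltW s0) ts; apply: le_trans ts.
by rewrite mulr_sumr; apply: ler_sum => i _; rewrite mxE.
Qed.

Lemma simplex_upto_cons m s x (t : 'rV[R]_m) :
  simplex_upto s (rV_cons (x, t)) <-> 0 <= x /\ simplex_upto (s - x) t.
Proof.
have c0 : rV_cons (x, t) ord0 ord0 = x.
  have o0 : ord0 = lshift m (ord0 : 'I_1) :> 'I_m.+1 by exact/val_inj.
  by rewrite o0; apply: etrans (row_mxEl (const_mx x : 'rV_1) t ord0 ord0) _; rewrite mxE.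
have cS i : rV_cons (x, t) ord0 (lift ord0 i) = t ord0 i.
  have oS : lift ord0 i = rshift 1 i :> 'I_m.+1 by exact/val_inj.
  by rewrite oS; exact: (row_mxEr (const_mx x : 'rV_1) t ord0 i).
have sumE : \sum_i rV_cons (x, t) ord0 i = x + \sum_i t ord0 i.
  by rewrite big_ord_recl c0; congr (_ + _); apply: eq_bigr => i _; exact: cS.
rewrite /simplex_upto/= sumE lerBrDl; split.
  by move=> [h hs]; split; [have := h ord0; rewrite c0|split => // i; have := h (lift ord0 i); rewrite cS].
move=> [x0 [t0 ts]]; split => // i; case: (unliftP ord0 i) => [j ->|->].
  by rewrite cS.
by rewrite c0.
Qed.

Lemma integral_onesub_exp m :
  (\int[mu]_(x in `[0%R, 1%R]) ((1 - (x : R)) ^+ m)%:E = (m.+1%:R^-1)%:E)%E.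
Proof.
pose P : {poly R} := - (m.+1%:R^-1 *: (1 - 'X) ^+ m.+1).
have PE : P^`() = (1 - 'X) ^+ m.
  rewrite /P derivN derivZ deriv_exp derivB derivX derivC sub0r.
  by rewrite mulN1r mulNrn scalerN opprK -[X in _ *: X]scaler_nat scalerA mulVf ?pnatr_eq0// scale1r.
transitivity (\int[mu]_(x in `[0%R, 1%R]) ((P^`()).[x])%:E)%E.
  by apply: eq_integral => x _; rewrite PE horner_exp !hornerE.
rewrite integral_itv_horner// prim_deriv !hornerD !hornerN !hornerC.
rewrite !hornerZ !horner_exp !hornerE subrr expr0n /= mulr0 subr0 expr1n mulr1.
by congr (_%:E); ring.
Qed.

(** Slicing at first coordinate x leaves a simplex of volume (1 - x)^m / m!, and the integral of (1
    - x)^m is 1 / (m + 1). *)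
Lemma lebesgue_simplex m :
  lebesgue_rV m (simplex_upto 1) = (m`!%:R^-1)%:E :> \bar R.
Proof.
elim: m => [|m IH].
  rewrite /= diracE mem_set ?fact0 ?invr1//; split => [[]//|].
  by rewrite big_ord0.
have mS := @measurable_simplex_upto m.+1 1.
rewrite [LHS]measure_integral_indic// ge0_integral_rV_cons//; last exact/measurable_EFinP.
pose F x := (\int[lebesgue_rV m]_t (\1_(@simplex_upto m.+1 1) (rV_cons (x, t)))%:E)%E.
have F0 x : (0 <= F x)%E by apply: integral_ge0 => t _; rewrite lee_fin.
have FE x : F x = if 0 <= x then lebesgue_rV m (simplex_upto (1 - x)) else 0%E.
  rewrite /F; case: ifPn => x0; last first.
    apply: integral0_eq => t _; rewrite indicE memNset// => /simplex_upto_cons[].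
    by rewrite (negbTE x0).
  rewrite [RHS]measure_integral_indic//; last exact: measurable_simplex_upto.
  apply: eq_integral => t _; congr (_%:E); apply: eq_indic; split.
    by move/simplex_upto_cons => [].
  by move=> ?; apply/simplex_upto_cons.
have F1 x : 1 < x -> F x = 0%E.
  move=> x1; rewrite FE ifT ?(le_trans _ (ltW x1))//.
  rewrite [X in lebesgue_rV m X](_ : _ = set0) ?measure0//.
  apply/seteqP; split => // t [t0]; apply/negP; rewrite -ltNge.
  by apply: lt_le_trans (sumr_ge0 _ _) => //; rewrite subr_lt0.
have mF : measurable_fun setT F.
  apply: (measurable_fun_fubini_tonelli_F (m2 := lebesgue_rV m)
    (EFin \o \1_(@simplex_upto m.+1 1) \o @rV_cons R m)).
    apply: measurableT_comp; last exact: measurable_rV_cons.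
    exact/measurable_EFinP.
  by move=> z; rewrite lee_fin.
transitivity (\int[mu]_(x in `[0%R, 1%R]) F x)%E.
  rewrite [RHS]integral_mkcond; apply: eq_integral => x _; rewrite patchE.
  case: ifPn => //; rewrite notin_setE/= in_itv/= => /negP; rewrite negb_and -!ltNge => /orP[x0|x1].
    by rewrite -/(F x) FE leNgt x0.
  exact: F1.
(* The endpoint x = 1 is dropped because the scaling lemma needs a positive size 1 - x. *)
rewrite -integral_itv_bndo_bndc; last exact: measurable_funTS.
transitivity (\int[mu]_(x in `[0%R, 1%R[) ((1 - (x : R)) ^+ m * (m`!%:R)^-1)%:E)%E.
  apply: eq_integral => x; rewrite inE/= in_itv/= => /andP[x0 x1].
  by rewrite FE x0 lebesgue_simplex_upto ?subr_gt0// IH -EFinM.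
have mP : measurable_fun setT (fun x : R => (1 - x) ^+ m).
  by apply: measurable_funX; apply: measurable_funB.
rewrite integral_itv_bndo_bndc; last first.
  by apply/measurable_EFinP; apply: measurable_funM => //; exact: measurable_funTS.
under eq_integral do rewrite EFinM.
rewrite ge0_integralZr//; first last.
- by move=> x /=; rewrite in_itv/= => /andP[_ x1]; rewrite lee_fin exprn_ge0// subr_ge0.
- by apply/measurable_EFinP; exact: measurable_funTS.
by rewrite integral_onesub_exp -EFinM factS natrM invfM.
Qed.

End standard_simplex.


(** * Coordinates adapted to a face of a simplex *)

Section faces.
Context {R : realType}.
Variable n : nat.

Lemma rV_cons_surj (y : 'rV[R]_n.+1) : exists s t, y = rV_cons (s, t).
Proof.
pose y' : 'rV[R]_(1 + n) := y; exists (lsubmx y' ord0 ord0), (rsubmx y').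
transitivity (row_mx (lsubmx y') (rsubmx y')); first by symmetry; exact: (hsubmxK y').
rewrite /rV_cons/=; apply: (congr1 (fun c : 'rV[R]_1 => row_mx c (rsubmx y') : 'rV[R]_n.+1)).
by apply/rowP => i; rewrite ord1 [RHS]mxE.
Qed.

(** Barycentric coordinates of [face_param W t] with respect to W; the vertex w_0 takes the
    remaining weight. *)
Definition face_coord (t : 'rV[R]_n) : 'rV[R]_n.+1 :=
  \row_j if unlift ord0 j is Some i then t ord0 i else 1 - \sum_i t ord0 i.

Lemma face_coord0 t : face_coord t ord0 ord0 = 1 - \sum_i t ord0 i.
Proof. by rewrite mxE unlift_none. Qed.

Lemma face_coordS t i : face_coord t ord0 (lift ord0 i) = t ord0 i.
Proof. by rewrite mxE liftK. Qed.

Lemma face_coord_sum t : \sum_j face_coord t ord0 j = 1.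
Proof.
rewrite big_ord_recl face_coord0 [X in _ + X](eq_bigr (fun i => t ord0 i)) ?subrK// => i _.
exact: face_coordS.
Qed.

Lemma face_coord_ge0 t : (forall j, 0 <= face_coord t ord0 j) <-> simplex_upto 1 t.
Proof.
split=> [h|[t0 t1] j].
  split=> [i|]; first by have := h (lift ord0 i); rewrite face_coordS.
  by have := h ord0; rewrite face_coord0 subr_ge0.
by case: (unliftP ord0 j) => [i ->|->]; rewrite ?face_coordS// face_coord0 subr_ge0.
Qed.

Lemma face_paramE (W : 'M[R]_n.+1) t : face_param W t = face_coord t *m W.
Proof.
apply/rowP => j; rewrite /face_param [LHS]mxE [RHS]mxE mxE big_ord_recl face_coord0.
rewrite [X in _ + X]mxE [X in _ = _ + X](eq_bigr (fun i => t ord0 i * W (lift ord0 i) j)); last first.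
  by move=> i _; rewrite face_coordS.
under [X in _ + X = _]eq_bigr do rewrite /edges mxE mulrBr.
by rewrite sumrB -mulr_suml; ring.
Qed.

Lemma simplex_face_param (W : 'M[R]_n.+1) t : simplex_upto 1 t -> hull W (face_param W t).
Proof.
move/face_coord_ge0 => h; exists (face_coord t); split => //; last exact: face_paramE.
exact: face_coord_sum.
Qed.

Variables (V : 'M[R]_(n.+2, n.+1)) (k : 'I_n.+2).
Hypothesis aV : aff_indep V.
Let W : 'M[R]_n.+1 := row' k V.

Lemma row_row' j : row j W = row (lift k j) V.
Proof. by apply/rowP => i; rewrite !mxE. Qed.

Lemma bary_face (l : 'rV[R]_n.+1) : \sum_j l ord0 j = 1 ->
  bary V (l *m W) ord0 k = 0 /\ forall j, bary V (l *m W) ord0 (lift k j) = l ord0 j.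
Proof.
move=> l1; pose l' : 'rV[R]_n.+2 := \row_i if unlift k i is Some j then l ord0 j else 0.
have l'k : l' ord0 k = 0 by rewrite mxE unlift_none.
have l'S j : l' ord0 (lift k j) = l ord0 j by rewrite mxE liftK.
rewrite (@bary_uniq _ _ _ aV l').
- by split => // j.
- rewrite (bigD1_ord k)//= l'k add0r -l1; apply: eq_bigr => j _; exact: l'S.
- apply/rowP => i; rewrite !mxE (bigD1_ord k)//= l'k mul0r add0r.
  by apply: eq_bigr => j _; rewrite l'S !mxE.
Qed.

Lemma hull_row' : hull W = hull V `&` [set x | bary V x ord0 k = 0].
Proof.
apply/seteqP; split => x.
  move=> [l [l0 l1 ->]]; have [bk bS] := bary_face l1; split => //.
  by rewrite hullE// => i; case: (unliftP k i) => [j ->|->]; rewrite ?bk ?bS.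
move=> [+ /= xk]; rewrite hullE// => x0.
exists (\row_j bary V x ord0 (lift k j)); split.
- by move=> j; rewrite mxE.
- have := bary_sum aV x; rewrite (bigD1_ord k)//= xk add0r => <-.
  by apply: eq_bigr => j _; rewrite mxE.
- rewrite -[LHS](baryK aV); apply/rowP => i; rewrite ![LHS]mxE (bigD1_ord k)//= xk mul0r add0r.
  by rewrite [RHS]mxE; apply: eq_bigr => j _; rewrite [in RHS]mxE [W _ _]mxE.
Qed.

(** Only the coordinates of the apex and of vertex j change, by s and -s. For t in the unit simplex
    the point therefore stays in the hull exactly while 0 <= s <= l_j. *)
Lemma bary_line t s j : let y := face_param W t + s *: (row k V - row j W) in
  bary V y ord0 k = s /\
  forall i, bary V y ord0 (lift k i) = face_coord t ord0 i - s * (i == j)%:R.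
Proof.
move=> y; have [bk bS] := bary_face (face_coord_sum t).
split=> [|i]; rewrite /y baryDE// face_paramE row_row' !bary_vertex//.
  by rewrite bk eqxx (negbTE (neq_lift _ _)) subr0 mulr1 add0r.
rewrite bS eq_sym (negbTE (neq_lift _ _)).
by rewrite (inj_eq lift_inj) sub0r mulrN.
Qed.

(** Linear part of the map (s, t) -> point at parameter s on the line parallel to edge j through the
    face point of parameter t. *)
Definition line_mx j : 'M[R]_n.+1 :=
  col_mx (row k V - row j W : 'rV_n.+1) (edges W).

Lemma line_mxE s t j : face_param W t + s *: (row k V - row j W) =
  row ord0 W + rV_cons (s, t) *m line_mx j.
Proof.
rewrite /face_param -addrA; congr (_ + _).
have -> : rV_cons (s, t) *m line_mx j =
    (const_mx s : 'rV_1) *m (row k V - row j W) + t *m edges W.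
  exact: (mul_row_col (const_mx s : 'rV_1) t).
rewrite addrC; congr (_ + _).
by apply/rowP => i; rewrite [in RHS]mxE big_ord1 [const_mx _ _ _]mxE [LHS]mxE.
Qed.

(** Another choice of j only subtracts a row of [edges W] from the first row. All n + 1 directions
    thus share one Jacobian, and summing over them costs just a factor n + 1. *)
Lemma det_line_mx j : \det (line_mx j) = \det (line_mx ord0).
Proof.
case: (unliftP ord0 j) => [i ->|->//].
pose U : 'M[R]_(1 + n) := block_mx 1%:M (- delta_mx ord0 i) 0 1%:M.
have dU : \det U = 1 by rewrite /U det_ublock !det1 mulr1.
have -> : line_mx (lift ord0 i) = U *m line_mx ord0.
  have -> : U *m line_mx ord0 = col_mx (1%:M *m (row k V - row ord0 W) + (- delta_mx ord0 i) *m edges W)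
      (0 *m (row k V - row ord0 W) + 1%:M *m edges W) by exact: mul_block_col.
  rewrite !mul1mx mul0mx add0r mulNmx -rowE.
  rewrite /line_mx; apply: (congr1 (fun u : 'rV[R]_n.+1 => col_mx u (edges W) : 'M[R]_n.+1)).
  by rewrite -addrA; congr (_ + _); apply/rowP => m; rewrite !mxE; ring.
by rewrite det_mulmx [\det U]dU mul1r.
Qed.

(** Injectivity, as s and t can be read off the barycentric coordinates of the image point. *)
Lemma line_mx_unit j : line_mx j \in unitmx.
Proof.
rewrite unitmxE det_line_mx -unitmxE -row_free_unit; apply: inj_row_free => y yA.
have [s [t yst]] := rV_cons_surj y.
have e : face_param W t + s *: (row k V - row ord0 W) =
         face_param W 0 + 0 *: (row k V - row ord0 W).
  by rewrite line_mxE -yst yA scale0r addr0 addr0 /face_param mul0mx addr0.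
have [bk bS] := bary_line t s ord0; have [bk0 bS0] := bary_line 0 0 ord0.
have s0 : s = 0 by rewrite -bk e bk0.
have t0 : t = 0.
  apply/rowP => i; have := bS (lift ord0 i); rewrite e bS0 !face_coordS s0.
  by rewrite !mul0r !subr0 => <-.
by rewrite yst s0 t0 /rV_cons/= (_ : const_mx 0 = 0) ?row_mx0//; apply/rowP => i; rewrite !mxE.
Qed.

Let D : R := `|\det (line_mx ord0)|.

Lemma absdet_line_gt0 : 0 < D.
Proof. by rewrite normr_gt0 -unitfE -unitmxE line_mx_unit. Qed.

Lemma measurable_hull : measurable (hull V).
Proof. by apply: closed_measurable_rV; exact: closed_hull. Qed.

(** In the coordinates (s, t) with j = 0 the hull is the unit simplex, because the coordinate of w_0
    becomes 1 - s - sum_i t_i. *)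
Lemma hull_volume : lebesgue_rV n.+1 (hull V) = (D * n.+1`!%:R^-1)%:E.
Proof.
rewrite measure_integral_indic; last exact: measurable_hull.
rewrite (ge0_integral_affine (row ord0 W) (line_mx_unit ord0))//; last first.
  by apply/measurable_EFinP; apply: measurable_indic; exact: measurable_hull.
rewrite EFinM -lebesgue_simplex; congr (_ * _)%E.
rewrite [RHS]measure_integral_indic; last exact: measurable_simplex_upto.
apply: eq_integral => y _; congr (_%:E); apply: eq_indic.
have [s [t ->]] := rV_cons_surj y.
rewrite -line_mxE simplex_upto_cons hullE//=.
have [bk bS] := bary_line t s ord0.
split => [h|[s0 [t0 ts]] i].
  split; first by have := h k; rewrite bk.
  split => [i|].
    by have := h (lift k (lift ord0 i)); rewrite bS face_coordS mulr0 subr0.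
  by have := h (lift k ord0); rewrite bS face_coord0 mulr1 addrAC subr_ge0.
case: (unliftP k i) => [j ->|->]; last by rewrite bk.
rewrite bS; case: (unliftP ord0 j) => [m ->|->]; first by rewrite face_coordS mulr0 subr0.
by rewrite face_coord0 mulr1 addrAC subr_ge0.
Qed.

Lemma face_param_hull t : hull V (face_param W t) -> simplex_upto 1 t.
Proof.
rewrite hullE//= => h; apply/face_coord_ge0 => j.
by have [_ <-] := bary_face (face_coord_sum t); rewrite -face_paramE.
Qed.

End faces.


(** * Trace inequality *)

Section measurable_fields.
Context {R : realType}.
Variable n : nat.

Lemma measurable_pval (P : mpoly.mpoly n.+1 R) : measurable_fun setT (pval P).
Proof.
rewrite (_ : pval P = fun x => \sum_(m <- mpoly.msupp P)
    mpoly.mcoeff m P * \prod_i rV_coord i x ^+ m i); last first.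
  by apply/funext => x; rewrite /pval mpoly.mevalE.
apply: measurable_sum => m; apply: measurable_funM => //.
apply: measurable_prod => i _; apply: measurable_funX; exact: measurable_rV_coord.
Qed.

Lemma measurable_enorm d (T : measurableType d) (f : T -> 'rV[R]_n.+1) :
  (forall i, measurable_fun setT (fun x => f x ord0 i)) ->
  measurable_fun setT (fun x => enorm (f x)).
Proof.
move=> mf; apply: measurable_fun_sqrt.
by apply: measurable_sum => i; apply: measurable_funM; exact: mf.
Qed.

Lemma measurable_vfield_powR (P : 'I_n.+1 -> mpoly.mpoly n.+1 R) (p : R) :
  measurable_fun setT (fun x => enorm (vfield P x) `^ p).
Proof.
apply: (measurableT_comp (measurable_powR p)); apply: measurable_enorm => i.
rewrite (_ : (fun x => _) = pval (P i)); first exact: measurable_pval.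
by apply/funext => x; rewrite vfieldE.
Qed.

End measurable_fields.

Section trace.
Context {R : realType}.
Variable n : nat.
Variables (V : 'M[R]_(n.+2, n.+1)) (k : 'I_n.+2).
Hypothesis aV : aff_indep V.
Let W : 'M[R]_n.+1 := row' k V.
Let D : R := `|\det (line_mx V k ord0)|.
Notation mu := (@lebesgue_measure R).

Lemma trace_param (P : 'I_n.+1 -> mpoly.mpoly n.+1 R) (s N : nat) (p : R) :
  (forall i, (mpoly.msize (P i) <= s.+1)%N) -> 0 < p -> p <= (2 * N)%:R ->
  (D%:E * \int[lebesgue_rV n]_(t in simplex_upto 1) (enorm (vfield P (face_param W t)) `^ p)%:E
   <= (n.+1%:R * (N * s).+1%:R ^+ 2)%:E *
      \int[lebesgue_rV n.+1]_(x in hull V) (enorm (vfield P x) `^ p)%:E)%E.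
Proof.
move=> sP p0 pN; pose h x : R := enorm (vfield P x) `^ p.
have h0 x : 0 <= h x by exact: powR_ge0.
have mh : measurable_fun setT h by exact: measurable_vfield_powR.
have mV := measurable_hull aV.
pose H : 'rV[R]_n.+1 -> \bar R := (EFin \o h) \_ (hull V).
have H0 x : (0 <= H x)%E by apply: erestrict_ge0 => y _; rewrite lee_fin.
have mH : measurable_fun setT H.
  by apply/(measurable_restrictT _ _).1 => //; apply/measurable_EFinP; exact: measurable_funTS.
have HE : H = (EFin \o h) \_ (hull V) by [].
clearbody H.
set M : R := (N * s).+1%:R ^+ 2; have M0 : 0 <= M by exact: sqr_ge0.
(* The integrand, extended by 0 outside the simplex, in the coordinates (s, t) of direction j. *)
pose Hj j (y : 'rV[R]_n.+1) := H (row ord0 W + y *m line_mx V k j).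
have mHj j : measurable_fun setT (Hj j).
  exact: (measurableT_comp mH (measurable_affine (line_mx V k j) (row ord0 W))).
have Hj0 j y : (0 <= Hj j y)%E by exact: H0.
pose G j t := (\int[mu]_x Hj j (rV_cons (x, t)))%E.
have G0 j t : (0 <= G j t)%E by apply: integral_ge0 => x _; exact: Hj0.
have mG j : measurable_fun setT (G j).
  apply: (measurable_fun_fubini_tonelli_G (m1 := mu) (Hj j \o @rV_cons R n)) => [|z].
    exact: (measurableT_comp (mHj j) (@measurable_rV_cons R n)).
  exact: Hj0.
have mS := @measurable_simplex_upto R n 1.
have mphi : measurable_fun setT (fun t => h (face_param W t)).
  exact: (measurableT_comp mh (@measurable_face_param R n W)).
(* The value at the face point is split by sum_j l_j = 1. The segment [0, l_j] stays in the hull,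
   where [Hj j] is the integrand, so its integral is at most the one over the whole line. *)
have key t : simplex_upto 1 t -> ((h (face_param W t))%:E <= M%:E * \sum_j G j t)%E.
  move=> tS; have l0 := (face_coord_ge0 t).2 tS.
  rewrite -[h _]mulr1 -(face_coord_sum t) mulr_sumr -sumEFin ge0_sume_distrr//.
  apply: lee_sum => j _.
  apply: le_trans (vector_endpoint_Lp _ (row k V - row j W) sP (l0 j) p0 pN) _.
  apply: lee_wpmul2l; first by rewrite lee_fin.
  rewrite integral_mkcond; apply: ge0_le_integral => //.
  - by move=> x _; apply: erestrict_ge0 => y _; rewrite lee_fin powR_ge0.
  - apply/(measurable_restrictT _ _).1 => //; apply: measurable_funTS.
    apply/measurable_EFinP.
    apply: (measurableT_comp mh (g := fun x : R => face_param W t + x *: (row k V - row j W))).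
    apply: measurable_fun_rVP => i.
    rewrite (_ : _ \o _ = fun x => face_param W t ord0 i + x * (row k V - row j W) ord0 i); last first.
      by apply/funext => x; rewrite /rV_coord/= [LHS]mxE [X in _ + X]mxE.
    by apply: measurable_funD => //; apply: measurable_funM.
  - exact: (measurableT_comp (measurableT_comp (mHj j) (@measurable_rV_cons R n)) (pair2_measurable t)).
  move=> x _; rewrite patchE; case: ifPn; last by move=> _; exact: Hj0.
  rewrite inE/= in_itv/= => /andP[x0 xl].
  rewrite /Hj -line_mxE HE patchE ifT// inE hullE//= => i.
  have [bk bS] := bary_line k aV t x j.
  case: (unliftP k i) => [m ->|->]; last by rewrite bk.
  rewrite bS; case: eqVneq => [->|_]; first by rewrite mulr1 subr_ge0.
  by rewrite mulr0 subr0.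
apply: (@le_trans _ _ (D%:E * \int[lebesgue_rV n]_t (M%:E * \sum_j G j t))%E).
  apply: lee_wpmul2l; first by rewrite lee_fin normr_ge0.
  rewrite integral_mkcond; apply: ge0_le_integral => //.
  - by move=> x _; apply: erestrict_ge0 => y _; rewrite lee_fin powR_ge0.
  - by apply/(measurable_restrictT _ _).1 => //; apply: measurable_funTS; exact/measurable_EFinP.
  - by apply: measurable_funeM; apply: emeasurable_sum => j; exact: mG.
  move=> t _; rewrite patchE; case: ifPn => [|_]; first by rewrite inE => /key.
  by apply: mule_ge0; rewrite ?lee_fin//; apply: sume_ge0.
(* Integrating over the lines and over t recovers the integral over the element, with the same
   Jacobian D for every j. *)
have DG j : (D%:E * \int[lebesgue_rV n]_t G j t = \int[lebesgue_rV n.+1]_x H x)%E.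
  rewrite /G -ge0_integral_rV_cons_swap// [RHS](ge0_integral_affine (row ord0 W) (line_mx_unit k aV j))//.
  by rewrite det_line_mx.
rewrite ge0_integralZl//; last 2 first.
- by apply: emeasurable_sum => j; exact: mG.
- by move=> t _; apply: sume_ge0.
rewrite ge0_integral_sum// muleCA ge0_sume_distrr; last first.
  by move=> j _; apply: integral_ge0 => t _; exact: G0.
rewrite (eq_bigr (fun=> (\int[lebesgue_rV n.+1]_x H x)%E)) => [|j _]; last exact: DG.
rewrite [in leRHS]integral_mkcond -HE; set I := (\int[_]_x H x)%E.
have -> : (\sum_(i < n.+1) I = n.+1%:R%:E * I)%E.
  under eq_bigr do rewrite -[I]mul1e.
  by rewrite -ge0_sume_distrl// sumEFin sumr_const card_ord.
by rewrite muleA -EFinM mulrC.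
Qed.

Definition gram : R := Num.sqrt (\det (edges W *m (edges W)^T)).

Lemma ge0_integral_surface (A : set 'rV[R]_n.+1) (g : 'rV[R]_n.+1 -> R) :
  measurable A -> measurable_fun setT g -> (forall x, 0 <= g x) ->
  (\int[surface_measure W]_(x in A) (g x)%:E =
   gram%:E * \int[lebesgue_rV n]_(t in face_param W @^-1` A) (g (face_param W t))%:E)%E.
Proof.
move=> mA mg g0; rewrite ge0_integral_mscale//; last 2 first.
- by apply/measurable_EFinP; exact: measurable_funTS.
- by move=> x _; rewrite lee_fin.
congr (_ * _)%E.
have := @ge0_integral_pushforward _ _ _ _ _ _ (@measurable_face_param R n W)
  (lebesgue_rV n) A (EFin \o g).
by apply => //; [apply/measurable_EFinP; exact: measurable_funTS|move=> x _; rewrite lee_fin].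
Qed.

Lemma face_preimage : face_param W @^-1` (hull W) = simplex_upto 1.
Proof.
apply/seteqP; split => t /=; last exact: simplex_face_param.
by rewrite (hull_row' k aV) => -[Vt _]; exact: (face_param_hull aV Vt).
Qed.

Lemma measurable_face : measurable (hull W).
Proof.
rewrite (hull_row' k aV); apply: measurableI; first exact: measurable_hull.
apply: closed_measurable_rV; have /continuous_closedP := @bary_continuous _ _ V k.
by move=> /(_ [set 0]); apply; exact: closed_eq.
Qed.

Lemma surface_measure_face :
  surface_measure W (hull W) = (gram * n`!%:R^-1)%:E.
Proof.
by rewrite /surface_measure/= /mscale/= /pushforward face_preimage lebesgue_simplex EFinM.
Qed.

(** The set A stands for an interface, possibly a proper part of the face; its parameters lie in the
    unit simplex, so enlarging to the whole face only increases the integral. The ratio [gram / D]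
    is |F_K| / (d |K|) with d = n + 1. *)
Lemma trace_surface (P : 'I_n.+1 -> mpoly.mpoly n.+1 R) (s N : nat) (p : R) (A : set 'rV[R]_n.+1) :
  (forall i, (mpoly.msize (P i) <= s.+1)%N) -> 0 < p -> p <= (2 * N)%:R ->
  measurable A -> A `<=` hull V ->
  (\int[surface_measure W]_(x in A) (enorm (vfield P x) `^ p)%:E
   <= (gram / D * (n.+1%:R * (N * s).+1%:R ^+ 2))%:E *
      \int[lebesgue_rV n.+1]_(x in hull V) (enorm (vfield P x) `^ p)%:E)%E.
Proof.
move=> sP p0 pN mA AV; have mh := measurable_vfield_powR P p.
have D0 : 0 < D := absdet_line_gt0 k aV.
rewrite ge0_integral_surface//; last by move=> x; exact: powR_ge0.
apply: (@le_trans _ _ (gram%:E * \int[lebesgue_rV n]_(t in simplex_upto 1)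
    (enorm (vfield P (face_param W t)) `^ p)%:E)%E).
  apply: lee_wpmul2l; first by rewrite lee_fin sqrtr_ge0.
  apply: ge0_subset_integral.
  - by rewrite -[X in measurable X]setTI; exact: measurable_face_param.
  - exact: measurable_simplex_upto.
  - apply/measurable_EFinP; apply: measurable_funTS.
    exact: (measurableT_comp mh (@measurable_face_param R n W)).
  - by move=> t _; rewrite lee_fin powR_ge0.
  - by move=> t /= /AV; exact: face_param_hull.
rewrite -(@lee_pmul2l _ D%:E)// muleCA.
rewrite [leRHS]muleA -EFinM [D * _]mulrA [D * _]mulrC divfK ?gt_eqF// EFinM -muleA.
apply: lee_wpmul2l; first by rewrite lee_fin sqrtr_ge0.
exact: trace_param.
Qed.

End trace.


(** * Surface measure does not depend on the parametrizing simplex *)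

Section surface_invariance.
Context {R : realType}.
Variable n : nat.

(** A linear relation between the edges is a relation between the vertices whose coefficients sum to
    0. *)
Lemma aff_indep_edges (W : 'M[R]_n.+1) : aff_indep W -> row_free (edges W).
Proof.
move=> aW; apply: inj_row_free => v vE.
pose l : 'rV[R]_n.+1 := \row_j if unlift ord0 j is Some i then v ord0 i else - \sum_i v ord0 i.
have l0 : l ord0 ord0 = - \sum_i v ord0 i by rewrite mxE unlift_none.
have lS i : l ord0 (lift ord0 i) = v ord0 i by rewrite mxE liftK.
have suml : \sum_j l ord0 j = 0.
  rewrite big_ord_recl l0 [X in _ + X](eq_bigr (fun i => v ord0 i)) ?addNr// => i _; exact: lS.
have lW : l *m W = 0.
  rewrite -vE; apply/rowP => j; rewrite [LHS]mxE [RHS]mxE big_ord_recl l0.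
  rewrite [X in _ + X](eq_bigr (fun i => v ord0 i * W (lift ord0 i) j)); last by move=> i _; rewrite lS.
  under [RHS]eq_bigr do rewrite /edges mxE mulrBr.
  by rewrite sumrB -mulr_suml mulNr addrC.
have : l *m row_mx (const_mx 1 : 'cV[R]_n.+1) W = 0.
  rewrite mul_mx_row lW (_ : l *m _ = 0) ?row_mx0//.
  apply/rowP => i; rewrite !mxE -[RHS]suml; apply: eq_bigr => j _; by rewrite [const_mx _ _ _]mxE mulr1.
move/(congr1 (mulmx^~ (pinvmx (row_mx (const_mx 1 : 'cV[R]_n.+1) W)))).
rewrite mul0mx mulmxKp// => l00; apply/rowP => i.
by rewrite -lS l00 !mxE.
Qed.

(** The rows of L are affine coordinates of the vertices of W0 with respect to W, so the two
    parametrizations differ by an affine map of the parameter. *)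
Lemma face_param_affine (W0 W L : 'M[R]_n.+1) :
  (forall i, \sum_j L i j = 1) -> W0 = L *m W ->
  exists A b, edges W0 = A *m edges W /\
    forall t, face_param W0 t = face_param W (b + t *m A).
Proof.
move=> L1 W0E.
pose A : 'M[R]_n := \matrix_(i, j) (L (lift ord0 i) (lift ord0 j) - L ord0 (lift ord0 j)).
pose b : 'rV[R]_n := \row_j L ord0 (lift ord0 j).
have rowE i m : W0 i m = W ord0 m + \sum_j L i (lift ord0 j) * edges W j m.
  rewrite W0E mxE big_ord_recl.
  have -> : L i ord0 = 1 - \sum_j L i (lift ord0 j).
    by rewrite -(L1 i) big_ord_recl addrK.
  under [X in _ = _ + X]eq_bigr do rewrite /edges mxE mulrBr.
  by rewrite sumrB -mulr_suml; ring.
have EA : edges W0 = A *m edges W.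
  apply/matrixP => i m; rewrite [LHS]mxE !rowE [RHS]mxE opprD addrACA subrr add0r -sumrB.
  by apply: eq_bigr => j _; rewrite [A _ _]mxE mulrBl.
exists A, b; split => // t.
rewrite /face_param mulmxDl EA mulmxA addrA; congr (_ + _).
apply/rowP => m; rewrite [LHS]mxE rowE [RHS]mxE [X in _ = X + _]mxE; congr (_ + _).
by rewrite [RHS]mxE; apply: eq_bigr => j _; rewrite [b _ _]mxE.
Qed.

Lemma surface_measureE (W : 'M[R]_n.+1) A :
  surface_measure W A = ((Num.sqrt (\det (edges W *m (edges W)^T)))%:E *
    lebesgue_rV n (face_param W @^-1` A))%E.
Proof. by []. Qed.

(** From [edges W0 = B *m edges W] the Gram factors differ by |det B|, which cancels the Jacobian of
    the change of parameter. Two faces meeting in an interface are compared through a small simplex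
    W0 inside it. *)
Lemma eq_surface_measure (W0 W : 'M[R]_n.+1) A :
  aff_indep W0 -> hull W0 `<=` hull W -> measurable A ->
  surface_measure W A = surface_measure W0 A.
Proof.
move=> aW0 W0W mA.
have /boolp.choice[l Pl] : forall i : 'I_n.+1, exists l : 'rV[R]_n.+1,
    \sum_j l ord0 j = 1 /\ row i W0 = l *m W.
  move=> i; have [|l [l0 l1 lE]] := W0W (row i W0); last by exists l.
  exists (delta_mx ord0 i); split; last by rewrite rowE.
    by move=> j; rewrite mxE ler0n.
  rewrite (bigD1 i)//= big1 ?mxE ?eqxx ?addr0// => j ji.
  by rewrite mxE (negbTE ji) andbF.
pose L : 'M[R]_n.+1 := \matrix_i l i.
have L1 i : \sum_j L i j = 1.
  by have [<- _] := Pl i; apply: eq_bigr => j _; rewrite mxE.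
have W0E : W0 = L *m W.
  by apply/row_matrixP => i; rewrite row_mul rowK; have [_ ->] := Pl i.
have [B [b [EB phiE]]] := face_param_affine L1 W0E.
(* The n independent edges of W0 are B times those of W, which forces B to have rank n. *)
have uB : B \in unitmx.
  rewrite -row_free_unit /row_free eqn_leq rank_leq_row/=.
  have := aff_indep_edges aW0; rewrite /row_free => /eqP {1}<-.
  by rewrite EB mxrankM_maxl.
rewrite !surface_measureE.
have mW : measurable (face_param W @^-1` A).
  by rewrite -[X in measurable X]setTI; exact: measurable_face_param.
have mW0 : measurable (face_param W0 @^-1` A).
  by rewrite -[X in measurable X]setTI; exact: measurable_face_param.
have -> : Num.sqrt (\det (edges W0 *m (edges W0)^T)) =
    `|\det B| * Num.sqrt (\det (edges W *m (edges W)^T)).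
  rewrite EB trmx_mul mulmxA -(mulmxA B) !det_mulmx det_tr mulrAC -expr2.
  by rewrite sqrtrM ?sqr_ge0// sqrtr_sqr.
rewrite mulrC EFinM -muleA; congr (_ * _)%E.
rewrite (measure_integral_indic _ mW) (measure_integral_indic _ mW0).
rewrite (ge0_integral_affine b uB)//; last first.
  by apply/measurable_EFinP; exact: measurable_indic.
congr (_ * _)%E; apply: eq_integral => t _; congr (_%:E); apply: eq_indic.
by rewrite /= phiE.
Qed.

End surface_invariance.

(** * Interior and boundary of a simplex *)

Section simplex_topology.
Context {R : realType}.
Variables (d : nat) (V : 'M[R]_(d.+1, d)).
Hypothesis aV : aff_indep V.

Lemma boundary_hull x :
  boundary (hull V) x <-> hull V x /\ exists k, bary V x ord0 k = 0.
Proof.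
rewrite /boundary -(closure_id _).1; last exact: closed_hull.
rewrite interior_hull// hullE//=; split => -[x0 xk]; split => //.
  apply: contrapT => /forallNP h; apply: xk => k.
  by rewrite lt_neqAle x0 andbT eq_sym; apply/eqP; exact: h.
by have [k xk0] := xk; move=> /(_ k); rewrite xk0 ltxx.
Qed.

Definition midpoint (x y : 'rV[R]_d) := x + 2^-1 *: (y - x).

Lemma bary_midpoint x y k :
  bary V (midpoint x y) ord0 k = 2^-1 * (bary V x ord0 k + bary V y ord0 k).
Proof. by rewrite baryDE; field. Qed.

Lemma hull_midpoint x y : hull V x -> hull V y -> hull V (midpoint x y).
Proof.
rewrite hullE//= => x0 y0 k; rewrite bary_midpoint mulr_ge0// ?invr_ge0//.
by rewrite addr_ge0.
Qed.

(** Otherwise every coordinate is positive somewhere on A. A midpoint keeps the coordinates already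
    positive and gains a new one, so after d + 1 steps A contains an interior point. *)
Lemma midconvex_in_face (A : set 'rV[R]_d) : A !=set0 ->
  A `<=` boundary (hull V) -> (forall x y, A x -> A y -> A (midpoint x y)) ->
  exists k, A `<=` [set x | bary V x ord0 k = 0].
Proof.
move=> A0 AV midA; apply: contrapT => /forallNP h.
have Age x k : A x -> 0 <= bary V x ord0 k.
  by move=> /AV/boundary_hull[+ _]; rewrite hullE//=; apply.
have pos (m : nat) : exists2 x, A x & forall k : 'I_d.+1, (k < m)%N -> 0 < bary V x ord0 k.
  elim: m => [|m [x Ax xm]]; first by have [x Ax] := A0; exists x.
  have [md|md] := ltnP m d.+1; last first.
    exists x => // k km; apply: xm; exact: leq_trans (ltn_ord k) md.
  have [y Ay ym] : exists2 y, A y & 0 < bary V y ord0 (Ordinal md).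
    apply: contrapT => /forall2NP hy; apply: (h (Ordinal md)) => y Ay /=.
    apply/eqP; rewrite eq_le Age// andbT leNgt; apply/negP.
    by have [] := hy y.
  exists (midpoint x y); first exact: midA.
  move=> k; rewrite ltnS leq_eqVlt bary_midpoint => /orP[/eqP km|km].
    rewrite mulr_gt0 ?invr_gt0// ltr_wpDl ?Age//.
    by rewrite (_ : k = Ordinal md)//; exact/val_inj.
  by rewrite mulr_gt0 ?invr_gt0// ltr_wpDr ?Age// xm.
have [x Ax xd] := pos d.+1.
have /boundary_hull[_ [k xk]] := AV x Ax.
by have := xd k (ltn_ord k); rewrite xk ltxx.
Qed.

(** Moving x slightly towards the centroid c makes all coordinates positive. *)
Lemma hull_interior_dense x (U : set 'rV[R]_d) : hull V x -> open U -> U x ->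
  exists2 y, (hull V)° y & U y.
Proof.
move=> Vx oU Ux; pose c : 'rV[R]_d := (\row_i (d.+1%:R^-1 : R) : 'rV_d.+1) *m V.
have bc k : bary V c ord0 k = d.+1%:R^-1.
  rewrite (@bary_uniq _ _ _ aV (\row_i d.+1%:R^-1))//; first by rewrite mxE.
  rewrite (eq_bigr (fun=> d.+1%:R^-1)); last by move=> i _; rewrite mxE.
  by rewrite sumr_const card_ord -[LHS]mulr_natl mulfV// pnatr_eq0.
have : (fun s : R => x + s *: (c - x)) @ (0:R) --> x.
  rewrite [X in _ --> X](_ : x = x + (0 : R) *: (c - x)); last first.
    by rewrite scale0r addr0.
  apply: (@continuousD _ _ _ (cst x) (fun s : R => s *: (c - x)) 0).
    exact: cst_continuous.
  by apply: cvgZr_tmp.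
move=> /(_ _ (open_nbhs_nbhs (conj oU Ux))); rewrite near_simpl => /nbhs_ballP[e /= e0 he].
(* Below e to stay in U, and below 1 so that (1 - s) times a coordinate of x stays nonnegative. *)
pose s := Num.min 2^-1 (e / 2).
have s0 : 0 < s by rewrite lt_min invr_gt0 ltr0n divr_gt0.
have s1 : s <= 2^-1 by rewrite ge_min lexx.
have se : s < e by rewrite gt_min ltr_pdivrMr// mulrDr mulr1 ltrDl e0 orbT.
exists (x + s *: (c - x)); last first.
  by apply: he; rewrite /ball/= sub0r normrN gtr0_norm.
rewrite interior_hull// => k; rewrite baryDE bc.
move: Vx; rewrite hullE//= => /(_ k) Vx.
have -> : bary V x ord0 k + s * (d.+1%:R^-1 - bary V x ord0 k) =
  (1 - s) * bary V x ord0 k + s * d.+1%:R^-1 by ring.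
rewrite ltr_wpDl ?mulr_gt0 ?invr_gt0// mulr_ge0// subr_ge0 (le_trans s1)//.
by rewrite invf_le1// ler1n.
Qed.

End simplex_topology.


(** * Meshes *)

Section mesh_lemmas.
Context {R : realType}.
Variables (n : nat) (Omega : set 'rV[R]_n.+1) (T : mesh Omega).
Hypothesis hOmega : polytopic_domain Omega.
Implicit Types (K L : 'I_(nelt T)) (F : ifc T).

Lemma aff_indep_vert K : aff_indep (vert K).
Proof. exact: mesh_nondegenerate. Qed.
Hint Resolve aff_indep_vert : core.

Lemma open_domain : open Omega.
Proof. by have [_ _ [m [V [_ ->]]]] := hOmega; exact: open_interior. Qed.

Lemma closed_elt K : closed (elt K).
Proof. exact: closed_hull. Qed.

(** The elements only cover the closure of Omega. As Omega is the interior of a closed set C, its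
    closure lies in C, and interiors of subsets of C lie in Omega. *)
Lemma elt_interior_sub K : (elt K)° `<=` Omega.
Proof.
have [_ _ [m [V [aV OE]]]] := hOmega.
set C := \bigcup_(i in [set: 'I_m]) hull (V i) in OE.
have cC : closed C by apply: closed_bigcup => [|i _]; [exact: finite_finset|exact: closed_hull].
suff KC : elt K `<=` C by rewrite [X in _ `<=` X]OE; exact: interiorS.
have OC : closure Omega `<=` C.
  rewrite [X in _ `<=` X]((closure_id C).1 cC); apply: closureS.
  by rewrite [X in X `<=` _]OE; exact: interior_subset.
by apply: subset_trans OC; rewrite -(mesh_cover T); exact: (bigcup_sup I).
Qed.

Lemma face_sub_boundary K k : face K k `<=` boundary (elt K).
Proof.
move=> x; rewrite /face /face_vert hull_row'// => -[Kx xk].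
by apply/boundary_hull => //; split => //; exists k.
Qed.

Lemma ifc_sub_plus F : ifc_set F `<=` boundary (elt (eplus F)).
Proof. by case: F => [[K L]|[K k]] /= x [// xK _]; exact: face_sub_boundary xK. Qed.

Lemma ifc_sub_minus F L : eminus F = Some L -> ifc_set F `<=` boundary (elt L).
Proof. by case: F => [[K L']|[K k]] //= [<-] x []. Qed.

Lemma boundary_sub_elt K : boundary (elt K) `<=` elt K.
Proof. by move=> x /(boundary_hull (aff_indep_vert K))[]. Qed.

Lemma measurable_elt K : measurable (elt K).
Proof. by apply: closed_measurable_rV; exact: closed_elt. Qed.

Lemma measurable_boundary m (A : set 'rV[R]_m) : measurable (boundary A).
Proof.
apply: measurableD; first by apply: closed_measurable_rV; exact: closed_closure.
by apply: open_measurable_rV; exact: open_interior.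
Qed.

Lemma measurable_ifc F : measurable (ifc_set F).
Proof.
case: F => [[K L]|[K k]] /=; apply: measurableI; try exact: measurable_boundary.
exact: measurable_face.
Qed.

(** A common point of two elements cannot be interior to one of them, since points interior to the
    other one are arbitrarily close and the interiors are disjoint. The interface is thus the
    intersection of the closed elements, which is convex. *)
Lemma interior_ifc_midconvex K L : K != L ->
  forall x y, (boundary (elt K) `&` boundary (elt L)) x ->
    (boundary (elt K) `&` boundary (elt L)) y ->
    (boundary (elt K) `&` boundary (elt L)) (midpoint x y).
Proof.
move=> KL x y [xK xL] [yK yL].
have sub (I J : 'I_(nelt T)) z : I != J -> elt I z -> elt J z -> boundary (elt I) z.
  move=> IJ zI zJ; split; first exact: subset_closure.
  move=> zI'; have [w wJ wI] := hull_interior_dense (aff_indep_vert J) zJ (open_interior _) zI'.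
  by have := mesh_disjoint IJ; rewrite -subset0 => /(_ w); apply.
have mid (I : 'I_(nelt T)) : boundary (elt I) x -> boundary (elt I) y -> elt I (midpoint x y).
  by move=> /boundary_sub_elt xI /boundary_sub_elt yI; exact: hull_midpoint.
have LK : L != K by rewrite eq_sym.
by split; [apply: (sub _ _ _ KL)|apply: (sub _ _ _ LK)]; exact: mid.
Qed.

Lemma has_codim1_nonempty (A : set 'rV[R]_n.+1) : has_codim1 A -> A !=set0.
Proof.
move=> [W [_ WA]]; exists (face_param W 0); apply: WA; apply: simplex_face_param.
by split=> [i|]; [rewrite mxE|rewrite big1// => i _; rewrite mxE].
Qed.

Lemma midconvex_sub_face K (A : set 'rV[R]_n.+1) : A !=set0 -> A `<=` boundary (elt K) ->
  (forall x y, A x -> A y -> A (midpoint x y)) -> exists k, A `<=` face K k.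
Proof.
move=> A0 AK midA; have [k Ak] := midconvex_in_face (aff_indep_vert K) A0 AK midA.
exists k => x Ax; rewrite /face /face_vert hull_row'//; split; last exact: Ak.
exact/boundary_sub_elt/AK.
Qed.

Lemma face_of_vert K F : exists k, face_of K F = row' k (vert K).
Proof. by eexists. Qed.

Lemma face_of_sub K F : (exists k, ifc_set F `<=` face K k) ->
  ifc_set F `<=` hull (face_of K F).
Proof.
move=> [k Fk]; rewrite /face_of; case: pickP => [j /asboolP//|/(_ k)].
by move=> /asboolP.
Qed.

Lemma interior_ifcP F L : is_ifc F -> eminus F = Some L ->
  [/\ eplus F != L, has_codim1 (ifc_set F) &
    ifc_set F = boundary (elt (eplus F)) `&` boundary (elt L)].
Proof.
case: F => [[K L']|[K k]] //; rewrite /is_ifc => /andP[/asboolP Fc /= KL] [<-{L}].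
by split => //; apply: contraTneq KL => ->; rewrite ltnn.
Qed.

(** The interface lies in one face of each element and contains a nondegenerate simplex, with which
    both surface measures are compared. *)
Lemma eq_surface_minus F L A : is_ifc F -> eminus F = Some L -> measurable A ->
  surface_measure (face_of (eplus F) F) A = surface_measure (face_of L F) A.
Proof.
move=> Fi FL mA; have [KL Fc FE] := interior_ifcP Fi FL.
have F0 := has_codim1_nonempty Fc.
have midF x y : ifc_set F x -> ifc_set F y -> ifc_set F (midpoint x y).
  by rewrite FE; exact: interior_ifc_midconvex.
have [W [aW WF]] := Fc.
have subK : ifc_set F `<=` hull (face_of (eplus F) F).
  by apply: face_of_sub; apply: midconvex_sub_face midF => //; exact: ifc_sub_plus.
have subL : ifc_set F `<=` hull (face_of L F).
  by apply: face_of_sub; apply: midconvex_sub_face midF => //; exact: ifc_sub_minus.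
rewrite (eq_surface_measure aW (subset_trans WF subK) mA).
by rewrite (eq_surface_measure aW (subset_trans WF subL) mA).
Qed.

Lemma msize_mderiv (P : mpoly.mpoly n.+1 R) i r : (mpoly.msize P <= r.+1)%N ->
  (mpoly.msize (mpoly.mderiv i P) <= r)%N.
Proof.
move=> Pr; rewrite mpoly.msizeE; apply/bigmax_leqP_seq => m mP _.
have : mpoly.mnm_add m (mpoly.mnm1 i) \in mpoly.msupp P.
  move: mP; rewrite !mpoly.mcoeff_msupp mpoly.mcoeff_mderiv.
  by apply: contra => /eqP ->; rewrite mul0rn.
move/mpoly.msize_mdeg_lt => h; move: (leq_trans h Pr); rewrite ltnS.
by rewrite mpoly.mdegD mpoly.mdeg1 addn1.
Qed.

Lemma measurable_pgrad_powR (P : mpoly.mpoly n.+1 R) p :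
  measurable_fun setT (fun x => enorm (pgrad P x) `^ p).
Proof. exact: (measurable_vfield_powR (fun i => mpoly.mderiv i P)). Qed.

Lemma trace_inequality (u : broken T) (r : 'I_(nelt T) -> nat) (p Cp : R) (N : nat) F K :
  in_space r u -> is_ifc F -> K = eplus F \/ eminus F = Some K ->
  0 < p -> p <= (2 * N)%:R -> 0 <= Cp ->
  n.+1%:R * (N * (r K).-1).+1%:R ^+ 2 <= Cp * Cinv n * (2 * ((r K)%:R - 1) ^+ 2 + 1) ->
  (\int[surface_measure (face_of (eplus F) F)]_(x in ifc_set F) (enorm (pgrad (u K) x) `^ p)%:E
   <= (Gconst Cp r K F)%:E * \int[lebesgue_rV n.+1]_(x in elt K) (enorm (pgrad (u K) x) `^ p)%:E)%E.
Proof.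
move=> ur Fi FK p0 pN Cp0 hC.
have mF := measurable_ifc F.
have FsubK : ifc_set F `<=` elt K.
  apply: subset_trans (@boundary_sub_elt K).
  by case: FK => [->|/ifc_sub_minus//]; exact: ifc_sub_plus.
have -> : (\int[surface_measure (face_of (eplus F) F)]_(x in ifc_set F) (enorm (pgrad (u K) x) `^ p)%:E =
  \int[surface_measure (face_of K F)]_(x in ifc_set F) (enorm (pgrad (u K) x) `^ p)%:E)%E.
  case: FK => [->//|FK]; apply: eq_measure_integral => A mA _.
  exact: eq_surface_minus.
have [k WE] := face_of_vert K F; rewrite WE.
apply: le_trans (trace_surface k (aff_indep_vert K) (P := fun i => mpoly.mderiv i (u K)) (s := (r K).-1) (N := N) _ p0 pN mF FsubK) _.
  (* For [r K = 0] the predecessor is truncated to 0, still a valid degree bound for the gradient,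
     which then vanishes. *)
  move=> i; apply: leq_trans (msize_mderiv i (ur K)) _; exact: leqSpred.
apply: lee_wpmul2r; first by apply: integral_ge0 => x _; rewrite lee_fin powR_ge0.
rewrite lee_fin /Gconst /face_area /volume WE surface_measure_face// (hull_volume k (aff_indep_vert K)).
rewrite /fine.
have D0 := absdet_line_gt0 k (aff_indep_vert K).
set D : R := `|_| in D0 *; set g := gram _ _.
have g0 : 0 <= g by exact: sqrtr_ge0.
(* With |F_K| = g / n! and |K| = D / (n + 1)!, the quotient |F_K| / (d |K|) is g / D. *)
have -> : Cp * Cinv n * ((2 * ((r K)%:R - 1) ^+ 2 + 1) * (g / n`!%:R)) / (n.+1%:R * (D / n.+1`!%:R))
  = g / D * (Cp * Cinv n * (2 * ((r K)%:R - 1) ^+ 2 + 1)).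
  rewrite factS natrM; have := lt0r_neq0 D0.
  have : n.+1%:R != 0 :> R by rewrite pnatr_eq0.
  have : n`!%:R != 0 :> R by rewrite pnatr_eq0 -lt0n fact_gt0.
  move: (n.+1%:R : R) (n`!%:R : R) => m f f0 m0 Dn0.
  by field; rewrite Dn0 f0 m0.
by rewrite ler_wpM2l// divr_ge0// ltW.
Qed.

End mesh_lemmas.


(** * Constants *)

Section constants_lemmas.
Context {R : realType}.
Implicit Types a s p : R.

Lemma powR_sqrM s p : 0 <= s -> 2 <= p -> s `^ p = s `^ (p - 2) * s ^+ 2.
Proof.
move=> s0 p2; have [->|sn0] := eqVneq s 0.
  by rewrite expr0n mulr0 powR0// gt_eqF// (lt_le_trans _ p2).
by rewrite -powR_mulrn// -powRD ?subrK// sn0 implybT.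
Qed.

Lemma powR_sqr_half s p : 0 <= s -> (s ^+ 2) `^ ((p - 2) / 2) = s `^ (p - 2).
Proof.
move=> s0; rewrite -powR_mulrn// -powRrM; congr (_ `^ _).
by rewrite mulrC divfK.
Qed.

(** For s < 4 a the stabilization factor S is at most 16^(p-2) a^(p-2); the constant 8 = 4 + 4
    counts the two mixed terms, each with a s <= 4 a^2. *)
Definition absorb p : R := 8 * 16 `^ (p - 2).

Lemma absorb_ge0 p : 0 <= absorb p.
Proof. by rewrite mulr_ge0// powR_ge0. Qed.

Lemma coercivity_pointwise p (th a s S : R) : 2 <= p -> 0 <= a -> 0 <= s -> 0 <= th <= 1 ->
  S = (a ^+ 2 + s ^+ 2) `^ ((p - 2) / 2) ->
  2^-1 * s `^ p - absorb p * a `^ p <= S * s ^+ 2 - a `^ (p - 2) * a * s - th * (S * a * s).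
Proof.
move=> p2 a0 s0 /andP[th0 th1] SE.
have p20 : 0 <= p - 2 by rewrite subr_ge0.
have hp0 : 0 <= (p - 2) / 2 by rewrite divr_ge0.
have as0 : 0 <= a ^+ 2 + s ^+ 2 by rewrite addr_ge0 ?sqr_ge0.
rewrite (powR_sqrM s0 p2) (powR_sqrM a0 p2); set A := a `^ (p - 2); set B := s `^ (p - 2).
have A0 : 0 <= A by exact: powR_ge0.
have B0 : 0 <= B by exact: powR_ge0.
have S0 : 0 <= S by rewrite SE; exact: powR_ge0.
have BS : B <= S.
  rewrite SE /B -powR_sqr_half// ge0_ler_powR ?nnegrE ?sqr_ge0//.
  by rewrite lerDr sqr_ge0.
have k1 : 1 <= 16 `^ (p - 2) :> R.
  by rewrite -[leLHS](powRr0 16) ler_powR// ler1n.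
have Sas0 : 0 <= S * a * s by rewrite !mulr_ge0.
have thS : th * (S * a * s) <= S * a * s by rewrite -[leRHS]mul1r ler_wpM2r.
(* The jump dominates: each mixed term is at most S s^2 / 4, and half of S s^2 is left. *)
have [sa|sa] := leP (4 * a) s.
  have AB : A <= B.
    by rewrite ge0_ler_powR// ?nnegrE//; apply: le_trans sa; rewrite ler_peMl// ler1n.
  have h1 : S * a * s <= 4^-1 * (S * s ^+ 2).
    have -> : 4^-1 * (S * s ^+ 2) = S * (4^-1 * s) * s by ring.
    by rewrite ler_wpM2r// ler_wpM2l//; lra.
  have h2 : A * a * s <= 4^-1 * (B * s ^+ 2).
    have -> : 4^-1 * (B * s ^+ 2) = B * (4^-1 * s) * s by ring.
    by rewrite ler_wpM2r// ler_pM//; lra.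
  have h3 : B * s ^+ 2 <= S * s ^+ 2 by rewrite ler_wpM2r ?sqr_ge0.
  have h4 : 0 <= absorb p * (A * a ^+ 2) by rewrite !mulr_ge0 ?absorb_ge0 ?sqr_ge0.
  lra.
(* The gradient dominates: a^2 + s^2 <= 17 a^2 <= (16 a)^2, so everything is bounded by a^p. *)
have Sle : S <= 16 `^ (p - 2) * A.
  have -> : 16 `^ (p - 2) * A = ((16 * a) ^+ 2) `^ ((p - 2) / 2).
    by rewrite powR_sqr_half ?mulr_ge0// powRM.
  rewrite SE ge0_ler_powR ?nnegrE ?sqr_ge0//.
  have : s ^+ 2 <= (4 * a) ^+ 2 by rewrite ler_sqr ?nnegrE ?mulr_ge0// ltW.
  have := sqr_ge0 a; rewrite !exprMn; lra.
have h1 : S * a * s <= 4 * (16 `^ (p - 2) * A * a ^+ 2).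
  have -> : 4 * (16 `^ (p - 2) * A * a ^+ 2) = (16 `^ (p - 2) * A * a) * (4 * a) by ring.
  by rewrite ler_pM ?mulr_ge0// ?ler_wpM2r// ltW.
have h2 : A * a * s <= 4 * (16 `^ (p - 2) * A * a ^+ 2).
  apply: (@le_trans _ _ (A * a * (4 * a))).
    by rewrite ler_wpM2l ?mulr_ge0// ltW.
  have -> : 4 * (16 `^ (p - 2) * A * a ^+ 2) = 16 `^ (p - 2) * (A * a * (4 * a)) by ring.
  by rewrite ler_peMl// !mulr_ge0.
have h3 : B * s ^+ 2 <= S * s ^+ 2 by rewrite ler_wpM2r ?sqr_ge0.
have h4 : 0 <= B * s ^+ 2 by rewrite mulr_ge0 ?sqr_ge0.
rewrite /absorb -!mulrA; lra.
Qed.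

(** Both inequalities at a unit vector y, z = 0 and a = 1, linked by Cauchy-Schwarz. *)
Lemma monotonicity_le_growth n p (C1 C2 : R) :
  growth_constant n.+1 p C1 -> monotonicity_constant n.+1 p C2 -> C2 <= C1.
Proof.
move=> [C10 h1] [C20 h2]; pose y : 'rV[R]_n.+1 := delta_mx ord0 ord0.
have y1 : enorm y = 1.
  rewrite /enorm /dotp (bigD1 ord0)//= big1 => [|i i0]; last first.
    by rewrite !mxE (negbTE i0) mul0r.
  by rewrite !mxE !eqxx mulr1 addr0 sqrtr1.
have z0 : enorm (0 : 'rV[R]_n.+1) = 0.
  by rewrite /enorm dotp0l sqrtr0.
have {}h1 := h1 y 0 1 ler01; have {}h2 := h2 y 0 1 ler01.
have := le_trans h2 (dotp_le _ _).
rewrite subr0 in h1 *; rewrite y1 z0 expr1n !mulr1 addr0 in h1 * => h.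
have := le_trans h h1; rewrite ler_pM2r// powR_gt0//.
Qed.

Lemma epsilon_bounds p theta (C1 C2 : R) : 2 <= p -> 0 < C1 -> 0 < C2 -> C2 <= C1 ->
  let eps := epsilon p theta C1 C2 in
  [/\ 0 < eps, 4 * eps <= 1 & absorb p * (4 * eps ^+ 2) <= 2^-1].
Proof.
move=> p2 C10 C20 C21 eps; pose x : R := 2 `^ (p - 2).
have x1 : 1 <= x by rewrite -[leLHS](powRr0 2) ler_powR ?ler1n ?subr_ge0.
have x0 : 0 < x by exact: lt_le_trans x1.
have two0 : (2 : R) != 0 by rewrite pnatr_eq0.
have E1 : 2 `^ (p - 1) = 2 * x.
  by rewrite -[X in X * x](powRr1 (a := 2))// -powRD ?two0 ?implybT//; congr (_ `^ _); ring.
have E2 : 2 `^ (2 * p - 4) = x ^+ 2.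
  by rewrite expr2 -powRD ?two0 ?implybT//; congr (_ `^ _); ring.
have E3 : 2 `^ (2 * p - 3) = 2 * x ^+ 2.
  rewrite expr2 -[X in X * (x * x)](powRr1 (a := 2))// -!powRD ?two0 ?implybT//.
  by congr (_ `^ _); ring.
have E4 : 2 `^ (1 - p) = (2 * x)^-1.
  by rewrite -E1 -powRN; congr (_ `^ _); ring.
(* As 16 = 2^4, the constant to be absorbed grows like x^4; it is met by eps^2, of order x^-4. *)
have E5 : absorb p = 8 * x ^+ 4.
  rewrite /absorb; congr (_ * _); rewrite /x -powR_mulrn ?powR_ge0// -powRrM mulrC powRrM.
  by congr (_ `^ _); rewrite powR_mulrn//; ring.
pose den := 2 `^ (p - 2) * C1 + Ctilde p C1 + (2 `^ (p - 1) + 1) * `|theta|.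
pose e1 := 2 `^ (1 - p) * C2 / den.
have denE : den = 3 * x * (1 + x) * C1 + 1 + (2 * x + 1) * `|theta|.
  by rewrite /den /Ctilde E1 E2 E3 -/x; ring.
(* From x >= 1. With C2 <= C1 it gives eps <= C2 / (2 x den) <= 1 / (12 x^2), and the product to be
   bounded is at most 2/9. *)
have den_ge : 6 * x * C1 <= den.
  rewrite denE -addrA ler_wpDr//.
    by rewrite addr_ge0// mulr_ge0// addr_ge0// mulr_ge0// ltW.
  by rewrite ler_wpM2r ?(ltW C10)//; nra.
have den0 : 0 < den by apply: lt_le_trans den_ge; rewrite !mulr_gt0.
have e10 : 0 < e1 by rewrite divr_gt0// mulr_gt0// powR_gt0.
have e1le : e1 <= (12 * x ^+ 2)^-1.
  rewrite /e1 E4 ler_pdivrMr// -[leLHS]mulrC ler_pdivrMr ?mulr_gt0//.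
  rewrite -mulrA ler_pdivlMl ?mulr_gt0 ?exprn_gt0//.
  apply: (@le_trans _ _ (12 * x ^+ 2 * C1)).
    by rewrite ler_pM2l// mulr_gt0// exprn_gt0.
  have -> : 12 * x ^+ 2 * C1 = (6 * x * C1) * (2 * x) by ring.
  by rewrite ler_pM2r// mulr_gt0.
have e30 : 0 < conjugate p / 4 * (p / 4) `^ (p - 1)^-1.
  have pp : 0 < p by exact: lt_le_trans p2.
  by rewrite mulr_gt0 ?powR_gt0 ?divr_gt0// subr_gt0 (lt_le_trans _ p2)// ltr1n.
have [eps0 epse1 eps4] : [/\ 0 < eps, eps <= e1 & eps <= 4^-1].
  rewrite /eps /epsilon -/den -/e1; case: eqVneq => [th0|th0].
    by rewrite !lt_min e10 e30 invr_gt0 ltr0n !ge_min !lexx !orbT.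
  rewrite !lt_min e10 e30 invr_gt0 ltr0n !ge_min !lexx !orbT !andbT; split => //.
  by rewrite divr_gt0 ?powR_gt0 ?normr_gt0.
have epsx : eps <= (12 * x ^+ 2)^-1 by exact: le_trans e1le.
split => //; first lra.
have h : eps ^+ 2 <= ((12 * x ^+ 2)^-1) ^+ 2.
  by rewrite ler_sqr ?nnegrE ?(ltW eps0)// invr_ge0 mulr_ge0 ?sqr_ge0.
rewrite E5; apply: (@le_trans _ _ (8 * x ^+ 4 * (4 * (12 * x ^+ 2)^-1 ^+ 2))).
  by rewrite ler_wpM2l ?ler_wpM2l ?mulr_ge0 ?exprn_ge0 ?(ltW x0).
have -> : 8 * x ^+ 4 * (4 * (12 * x ^+ 2)^-1 ^+ 2) = 2 / 9 by field; rewrite gt_eqF.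
lra.
Qed.

(** The bound eps <= 1/4 makes the maximum in [mu_eps] equal to 1 / (4 eps). *)
Lemma mu_eps_ratio (eps : R) : 0 < eps -> 4 * eps <= 1 -> eps / mu_eps eps = 4 * eps ^+ 2.
Proof.
move=> e0 e4; rewrite /mu_eps max_r; last first.
  by rewrite invf_ge1// mulr_gt0.
by rewrite invrK; ring.
Qed.

(** N is minimal; the upper bound on 2 N is what allows N^2 to be compared with C_p. *)
Lemma even_bound p : 2 <= p -> exists N, [/\ (0 < N)%N, p <= (2 * N)%:R & (2 * N)%:R < p + 2].
Proof.
move=> p2; have ex : exists k, p <= (2 * k)%:R.
  exists (Num.bound p); apply: le_trans (ltW (archi_boundP _)) _; first exact: le_trans p2.
  by rewrite ler_nat leq_pmull.
case: (ex_minnP ex) => N pN minN; exists N; split => //.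
  by rewrite lt0n; apply: contraTneq pN => ->; rewrite muln0 -ltNge (lt_le_trans _ p2).
case: N pN minN => [|N] pN minN; first by rewrite muln0 ltr_wpDl// (le_trans _ p2).
rewrite mulnS addnC natrD ltrD2r ltNge; apply/negP => /minN.
by rewrite ltnn.
Qed.

(** If C_p >= 2^(p+1), then 2 N - 1 < p + 1 and N^2 + 2 <= 4^N suffice. In the rational case all
    factors but p^2 are at least 1, and p^2 is enough: p >= 2 for N = 1, and p > 2 (N - 1) for
    larger N. *)
Lemma inverse_constant_ge p Cp (N : nat) : 2 <= p -> inverse_constant p Cp ->
  (0 < N)%N -> (2 * N)%:R < p + 2 -> N%:R ^+ 2 / 2 + 1 <= Cp.
Proof.
move=> p2 hCp N0 Np; have N1 : 1 <= N%:R :> R by rewrite ler1n.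
rewrite natrM in Np.
case: hCp => [|[k [l [k0 l0 pE ->]]]].
  apply: le_trans; apply: (@le_trans _ _ (2 `^ ((2 * N).-1)%:R)).
    rewrite powR_mulrn//; case: N N0 {N1 Np} => // N _.
    have h : (N.+1 ^ 2 + 2 <= 4 ^ N.+1)%N.
      elim: N => // N IH; rewrite expnS; apply: (@leq_trans (4 * (N.+1 ^ 2 + 2))%N); last by rewrite leq_mul2l.
      by rewrite -!mulnn; lia.
    have : (2 * N.+1).-1.+1 = (2 * N.+1)%N by rewrite prednK// muln_gt0.
    set m := (2 * N.+1).-1 => hm.
    have : (N.+1%:R ^+ 2 + 2 <= 2 * 2 ^+ m :> R).
      by rewrite -exprS hm exprM -!natrX -natrD ler_nat.
    lra.
  rewrite ler_powR ?ler1n//.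
  have -> : ((2 * N).-1)%:R = 2 * N%:R - 1 :> R.
    by rewrite -subn1 natrB ?muln_gt0// natrM.
  lra.
have pk : 1 <= 2 `^ (p / 2 + k%:R^-1) :> R.
  by rewrite -[leLHS](powRr0 2) ler_powR ?ler1n// addr_ge0 ?invr_ge0// divr_ge0// (le_trans _ p2).
have k1 : 1 <= k%:R ^+ 2 :> R by rewrite expr_ge1// ler1n.
apply: (@le_trans _ _ (p ^+ 2)).
  case: N N0 Np {N1} => [//|[|N]] _ Np.
    have : 2 ^+ 2 <= p ^+ 2 by rewrite ler_sqr ?nnegrE// (le_trans _ p2).
    lra.
  have eN : N.+2%:R = N%:R + 2 :> R by rewrite -addn2 natrD.
  rewrite eN in Np *; have NN : 0 <= N%:R :> R by [].
  have hp2 : 2 * (N%:R + 1) <= p by lra.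
  have : (2 * (N%:R + 1)) ^+ 2 <= p ^+ 2.
    by apply: lerXn2r; rewrite ?nnegrE; lra.
  nra.
rewrite -mulrA -[leLHS]mul1r ler_pM ?sqr_ge0//.
by rewrite -[leLHS]mulr1 ler_wpM2l ?sqr_ge0.
Qed.

Lemma trace_constant p Cp (N n r : nat) : 2 <= p -> inverse_constant p Cp ->
  (0 < N)%N -> (2 * N)%:R < p + 2 -> (n < 3)%N ->
  n.+1%:R * (N * r.-1).+1%:R ^+ 2 <= Cp * Cinv n * (2 * (r%:R - 1) ^+ 2 + 1) :> R.
Proof.
move=> p2 hCp N0 Np n3; have hN := inverse_constant_ge p2 hCp N0 Np.
have nC : n.+1%:R <= Cinv n :> R.
  by case: n n3 => [|[|[]]]//= _; rewrite ler_nat.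
(* At r = 0 the truncated predecessor gives 0 on the left, against (0 - 1)^2 = 1 on the right. *)
have hr : (r.-1%:R : R) ^+ 2 <= (r%:R - 1) ^+ 2.
  by case: r => [|r]/=; rewrite ?expr0n ?sqr_ge0// -natr1 addrK.
have -> : (N * r.-1).+1%:R = N%:R * r.-1%:R + 1 :> R by rewrite -natr1 natrM.
set s : R := r.-1%:R in hr *; set M : R := N%:R in hN *.
(* Cauchy-Schwarz; the difference of the two sides is (M - 2 s)^2 / 2. This is how the factor 2 (r -
   1)^2 + 1 of the penalty arises. *)
have h1 : (M * s + 1) ^+ 2 <= (M ^+ 2 / 2 + 1) * (2 * s ^+ 2 + 1).
  by have := sqr_ge0 (M - 2 * s); nra.
have M0 : 0 <= M ^+ 2 / 2 + 1 by rewrite addr_ge0// divr_ge0// sqr_ge0.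
have s0 : 0 <= 2 * s ^+ 2 + 1 by rewrite addr_ge0// mulr_ge0// sqr_ge0.
rewrite [Cp * _]mulrC -mulrA ler_pM ?sqr_ge0//.
apply: le_trans h1 _; apply: ler_pM => //; lra.
Qed.

End constants_lemmas.


(** * Integrability *)

Section locally_bounded.
Context {R : realType}.
Variable n : nat.
Implicit Types f g : 'rV[R]_n.+1 -> R.

Definition box (M : R) : set 'rV[R]_n.+1 := [set x | forall i, `|x ord0 i| <= M].

(** Linearity and monotonicity of the real-valued integral require integrability. This class is
    stable under all operations in the form and is integrable on bounded sets of finite measure;
    unlike continuity, it admits the indicators in [bval]. *)
Definition loc_bounded f : Prop := measurable_fun setT f /\
  forall M, exists C, forall x, box M x -> `|f x| <= C.

Definition loc_bounded_field (v : 'rV[R]_n.+1 -> 'rV[R]_n.+1) : Prop :=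
  forall i, loc_bounded (fun x => v x ord0 i).

Lemma loc_bounded_cst c : loc_bounded (fun=> c).
Proof. by split=> // M; exists `|c|. Qed.

Lemma loc_boundedD f g : loc_bounded f -> loc_bounded g -> loc_bounded (fun x => f x + g x).
Proof.
move=> [mf bf] [mg bg]; split; first exact: measurable_funD.
move=> M; have [C hC] := bf M; have [D hD] := bg M; exists (C + D) => x xM.
by apply: le_trans (ler_normD _ _) _; rewrite lerD ?hC ?hD.
Qed.

Lemma loc_boundedM f g : loc_bounded f -> loc_bounded g -> loc_bounded (fun x => f x * g x).
Proof.
move=> [mf bf] [mg bg]; split; first exact: measurable_funM.
move=> M; have [C hC] := bf M; have [D hD] := bg M; exists (C * D) => x xM.
by rewrite normrM ler_pM ?hC ?hD.
Qed.

Lemma loc_boundedN f : loc_bounded f -> loc_bounded (fun x => - f x).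
Proof.
move=> bf; rewrite (_ : (fun x => - f x) = (fun x => -1 * f x)).
  by apply: loc_boundedM => //; exact: loc_bounded_cst.
by apply/funext => x; rewrite mulN1r.
Qed.

Lemma loc_bounded_sum (I : Type) (s : seq I) (P : pred I) (f : I -> 'rV[R]_n.+1 -> R) :
  (forall i, loc_bounded (f i)) -> loc_bounded (fun x => \sum_(i <- s | P i) f i x).
Proof.
move=> bf; elim: s => [|i s IH].
  rewrite (_ : (fun x => _) = (fun=> 0)); first exact: loc_bounded_cst.
  by apply/funext => x; rewrite big_nil.
rewrite (_ : (fun x => _) = (fun x => (if P i then f i x else 0) + \sum_(j <- s | P j) f j x)).
  by apply: loc_boundedD => //; case: (P i) => //; exact: loc_bounded_cst.
by apply/funext => x; rewrite big_cons; case: (P i) => //; rewrite add0r.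
Qed.

Lemma loc_boundedX f k : loc_bounded f -> loc_bounded (fun x => f x ^+ k).
Proof.
move=> bf; elim: k => [|k IH]; first exact: loc_bounded_cst.
rewrite (_ : (fun x => _) = (fun x => f x * f x ^+ k)); first exact: loc_boundedM.
by apply/funext => x; rewrite exprS.
Qed.

Lemma loc_bounded_prod (I : Type) (s : seq I) (f : I -> 'rV[R]_n.+1 -> R) :
  (forall i, loc_bounded (f i)) -> loc_bounded (fun x => \prod_(i <- s) f i x).
Proof.
move=> bf; elim: s => [|i s IH].
  rewrite (_ : (fun x => _) = (fun=> 1)); first exact: loc_bounded_cst.
  by apply/funext => x; rewrite big_nil.
rewrite (_ : (fun x => _) = (fun x => f i x * \prod_(j <- s) f j x)).
  exact: loc_boundedM.
by apply/funext => x; rewrite big_cons.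
Qed.

Lemma loc_bounded_coord i : loc_bounded (fun x => x ord0 i).
Proof. by split=> [|M]; [exact: measurable_rV_coord|exists M => x; exact]. Qed.

Lemma loc_bounded_powR f q : (forall x, 0 <= f x) -> 0 <= q -> loc_bounded f ->
  loc_bounded (fun x => f x `^ q).
Proof.
move=> f0 q0 [mf bf]; split; first exact: (measurableT_comp (measurable_powR q)).
move=> M; have [C hC] := bf M; exists (C `^ q) => x xM.
rewrite ger0_norm ?powR_ge0// ge0_ler_powR ?nnegrE//.
  by apply: le_trans (hC x xM); exact: normr_ge0.
by apply: le_trans (hC x xM); exact: ler_norm.
Qed.

Lemma loc_bounded_indic (A : set 'rV[R]_n.+1) : measurable A -> loc_bounded \1_A.
Proof.
move=> mA; split; first exact: measurable_indic.
by move=> M; exists 1 => x _; rewrite indicE; case: (_ \in _); rewrite ?normr1 ?normr0.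
Qed.

Lemma loc_bounded_pval (P : mpoly.mpoly n.+1 R) : loc_bounded (pval P).
Proof.
rewrite (_ : pval P = fun x => \sum_(m <- mpoly.msupp P)
    mpoly.mcoeff m P * \prod_i (x ord0 i) ^+ m i); last first.
  by apply/funext => x; rewrite /pval mpoly.mevalE.
apply: loc_bounded_sum => m; apply: loc_boundedM; first exact: loc_bounded_cst.
by apply: loc_bounded_prod => i; apply: loc_boundedX; exact: loc_bounded_coord.
Qed.

Lemma loc_bounded_field_pgrad (P : mpoly.mpoly n.+1 R) : loc_bounded_field (pgrad P).
Proof.
move=> i; rewrite (_ : (fun x => _) = pval (mpoly.mderiv i P)).
  exact: loc_bounded_pval.
by apply/funext => x; rewrite mxE.
Qed.

Lemma loc_bounded_fieldD v w : loc_bounded_field v -> loc_bounded_field w ->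
  loc_bounded_field (fun x => v x + w x).
Proof.
move=> bv bw i; rewrite (_ : (fun x => _) = (fun x => v x ord0 i + w x ord0 i)).
  exact: loc_boundedD.
by apply/funext => x; rewrite mxE.
Qed.

Lemma loc_bounded_fieldZ f v : loc_bounded f -> loc_bounded_field v ->
  loc_bounded_field (fun x => f x *: v x).
Proof.
move=> bf bv i; rewrite (_ : (fun x => _) = (fun x => f x * v x ord0 i)).
  exact: loc_boundedM.
by apply/funext => x; rewrite mxE.
Qed.

Lemma loc_bounded_field_cst c : loc_bounded_field (fun=> c).
Proof. by move=> i; exact: loc_bounded_cst. Qed.

Lemma loc_bounded_dotp v w : loc_bounded_field v -> loc_bounded_field w ->
  loc_bounded (fun x => dotp (v x) (w x)).
Proof. by move=> bv bw; apply: loc_bounded_sum => i; exact: loc_boundedM. Qed.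

Lemma loc_bounded_enorm v : loc_bounded_field v -> loc_bounded (fun x => enorm (v x)).
Proof.
move=> bv; have [mvv bvv] := loc_bounded_dotp bv bv; split.
  exact: measurable_fun_sqrt.
move=> M; have [C hC] := bvv M; exists (Num.sqrt C) => x xM.
rewrite ger0_norm ?enorm_ge0//; apply: ler_wsqrtr.
by apply: le_trans (hC x xM); exact: ler_norm.
Qed.

Lemma loc_bounded_integrable (mu : {measure set 'rV[R]_n.+1 -> \bar R}) A M f :
  measurable A -> (mu A < +oo)%E -> A `<=` box M -> loc_bounded f ->
  mu.-integrable A (EFin \o f).
Proof.
move=> mA Aoo AM [mf bf]; apply: measurable_bounded_integrable => //.
  exact: measurable_funTS.
have [C hC] := bf M; exists C; split; first exact: num_real.
by move=> y Cy x /AM xM; apply: le_trans (hC x xM) (ltW Cy).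
Qed.

End locally_bounded.

Section simplex_integrals.
Context {R : realType}.
Variables (n : nat) (V : 'M[R]_(n.+2, n.+1)).
Hypothesis aV : aff_indep V.

Lemma hull_bounded : exists M, hull V `<=` box M.
Proof.
exists (\sum_i \sum_j `|V j i|) => x [l [l0 l1 ->]] i; rewrite mxE.
apply: le_trans (ler_norm_sum _ _ _) _.
apply: (@le_trans _ _ (\sum_j `|V j i|)).
  apply: ler_sum => j _; rewrite normrM ler_piMl// ger0_norm//.
  by rewrite -l1 (bigD1 j)//= lerDl sumr_ge0.
by rewrite (bigD1 i)//= lerDl sumr_ge0// => j _; exact: sumr_ge0.
Qed.

Lemma hull_finite_measure : (lebesgue_rV n.+1 (hull V) < +oo)%E.
Proof. by rewrite (hull_volume ord0 aV) ltry. Qed.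

Lemma surface_finite_measure k A : A `<=` hull V -> measurable A ->
  (surface_measure (row' k V) A < +oo)%E.
Proof.
move=> AV mA; rewrite surface_measureE.
apply: (@le_lt_trans _ _ ((gram V k)%:E * lebesgue_rV n (simplex_upto 1))%E).
  apply: lee_wpmul2l; first by rewrite lee_fin sqrtr_ge0.
  apply: le_measure; rewrite ?inE.
  - by rewrite -[X in measurable X]setTI; exact: measurable_face_param.
  - exact: measurable_simplex_upto.
  - by move=> t /= /AV; exact: face_param_hull.
by rewrite lebesgue_simplex -EFinM ltry.
Qed.

(** In the coordinates (s, t) the face is the slice s = 0. *)
Lemma hull_face_null k :
  lebesgue_rV n.+1 (hull V `&` [set x | bary V x ord0 k = 0]) = 0%E.
Proof.
set A := _ `&` _.
have mA : measurable A.
  by rewrite /A -hull_row'//; exact: measurable_face.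
rewrite measure_integral_indic//.
rewrite (ge0_integral_affine (row ord0 (row' k V)) (line_mx_unit k aV ord0))//; last first.
  by apply/measurable_EFinP; exact: measurable_indic.
have mI : measurable_fun setT (fun y : 'rV[R]_n.+1 =>
    (\1_A (row ord0 (row' k V) + y *m line_mx V k ord0))%:E : \bar R).
  apply/measurable_EFinP; exact: (measurableT_comp (measurable_indic mA) (measurable_affine _ _)).
rewrite ge0_integral_rV_cons//.
rewrite (_ : (\int[lebesgue_measure]_x _)%E = 0%E) ?mule0//.
pose F (x : R) := (\int[lebesgue_rV n]_t
  (\1_A (row ord0 (row' k V) + rV_cons (x, t) *m line_mx V k ord0))%:E)%E.
have F0 x : x != 0 -> F x = 0%E.
  move=> x0; apply: integral0_eq => t _; rewrite indicE memNset//.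
  rewrite -line_mxE => -[_ /=]; have [-> _] := bary_line k aV t x ord0.
  by apply/eqP.
transitivity (\int[lebesgue_measure]_(x in [set (0 : R)%R]) F x)%E; last exact: integral_set1.
rewrite [RHS]integral_mkcond; apply: eq_integral => x _; rewrite patchE.
case: ifPn => // x0; rewrite -/(F x) F0//.
by move: x0; rewrite notin_setE/= => /eqP.
Qed.

(** [bgrad] sees the open elements and the trace inequality the closed ones; the difference lies in
    finitely many null faces. *)
Lemma ge0_integral_hull_interior (g : 'rV[R]_n.+1 -> R) : measurable_fun setT g ->
  (forall x, 0 <= g x) ->
  (\int[lebesgue_rV n.+1]_(x in (hull V)°) (g x)%:E = \int[lebesgue_rV n.+1]_(x in hull V) (g x)%:E)%E.
Proof.
move=> mg g0; have mV := measurable_hull aV.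
have mI : measurable (hull V)° by apply: open_measurable_rV; exact: open_interior.
have -> : (\int[lebesgue_rV n.+1]_(x in hull V) (g x)%:E)%E =
    (\int[lebesgue_rV n.+1]_(x in (hull V)° `|` (hull V `\` (hull V)°)) (g x)%:E)%E.
  by rewrite setDUK//; exact: interior_subset.
rewrite ge0_integral_setU//; last 4 first.
- exact: measurableD.
- by apply/measurable_EFinP; exact: measurable_funTS.
- by move=> x _; rewrite lee_fin.
- by apply/disj_setPS => x [? []].
rewrite [X in (_ + X)%E](_ : _ = 0%E) ?adde0//.
apply: null_set_integral => //.
- exact: measurableD.
- by apply/measurable_EFinP; exact: measurable_funTS.
apply/negligibleP; first exact: measurableD.
apply: (@negligibleS _ _ _ _
  (\bigcup_m (hull V `&` [set x | bary V x ord0 (inord m) = 0]))) => [x [Vx xI]|].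
  have /boundary_hull[//|_ [k xk]] : boundary (hull V) x by split => //; exact: subset_closure.
  by exists k => //; split => //=; rewrite inord_val.
apply: negligible_bigcup => m; apply/negligibleP; last exact: hull_face_null.
by rewrite -hull_row'//; exact: measurable_face.
Qed.

End simplex_integrals.


(** * Coercivity *)

Section interface_estimates.
Context {R : realType}.
Variables (n : nat) (Omega : set 'rV[R]_n.+1) (T : mesh Omega).
Hypothesis hOmega : polytopic_domain Omega.
Implicit Types (K L : 'I_(nelt T)) (F : ifc T) (u v : broken T).

Definition ifc_measure F := surface_measure (face_of (eplus F) F).

(** The common shape of [zeta_sum], of scalar averages and of sums over the one or two elements at
    an interface. *)
Definition sum_sides F (f : 'I_(nelt T) -> R) : R :=
  f (eplus F) + (if eminus F is Some L then f L else 0).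

Definition side F K : bool := (K == eplus F) || (eminus F == Some K).

(** For an actual interface K^+ and K^- differ, so no element is counted twice. *)
Lemma sum_sidesE F f : is_ifc F -> sum_sides F f = \sum_(K | side F K) f K.
Proof.
move=> Fi; rewrite /sum_sides /side (bigD1 (eplus F)) ?eqxx//=; congr (_ + _).
case E : (eminus F) => [L|]; last first.
  by rewrite big1// => K /andP[+ K1]; rewrite (negbTE K1).
have [KL _ _] := interior_ifcP Fi E.
rewrite (big_pred1 L)// => K /=; rewrite -[RHS]eq_sym.
apply/idP/eqP => [/andP[+ K1]|<-]; first by rewrite (negbTE K1)/= => /eqP[].
by rewrite eqxx orbT eq_sym KL.
Qed.

Lemma ler_sum_sides F f g : (forall K, f K <= g K) -> sum_sides F f <= sum_sides F g.
Proof. by move=> fg; rewrite /sum_sides lerD//; case: (eminus F). Qed.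

Lemma sum_sides_ge0 F f : (forall K, 0 <= f K) -> 0 <= sum_sides F f.
Proof. by move=> f0; rewrite /sum_sides addr_ge0//; case: (eminus F). Qed.

Lemma sum_sidesD F f g : sum_sides F (fun K => f K + g K) = sum_sides F f + sum_sides F g.
Proof. by rewrite /sum_sides; case: (eminus F) => [L|]; rewrite ?addr0// addrACA. Qed.

Lemma sum_sidesZ F c f : sum_sides F (fun K => c * f K) = c * sum_sides F f.
Proof. by rewrite /sum_sides; case: (eminus F) => [L|]; rewrite ?mulr0 ?addr0// mulrDr. Qed.

Lemma avg_scalar (w : ifc T -> 'I_(nelt T) -> R) F (g : 'I_(nelt T) -> R) :
  avg (V := R^o) w F g = sum_sides F (fun K => w F K * g K).
Proof. by []. Qed.

Lemma dotp_avg (w : ifc T -> 'I_(nelt T) -> R) F (g : 'I_(nelt T) -> 'rV[R]_n.+1) y :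
  dotp (avg w F g) y = sum_sides F (fun K => w F K * dotp (g K) y).
Proof.
rewrite /avg /sum_sides dotpDl dotpZl; case: (eminus F) => [L|]; first by rewrite dotpZl.
by rewrite dotp0l.
Qed.

Lemma integrable_ifc F f : loc_bounded f ->
  (ifc_measure F).-integrable (ifc_set F) (EFin \o f).
Proof.
move=> bf; have FK : ifc_set F `<=` hull (vert (eplus F)).
  exact: subset_trans (@ifc_sub_plus _ _ _ _ F) (@boundary_sub_elt _ _ _ _ _).
have [M hM] := hull_bounded (vert (eplus F)).
have mF := measurable_ifc F.
apply: (loc_bounded_integrable mF _ (subset_trans FK hM) bf).
have [k WE] := face_of_vert (eplus F) F; rewrite /ifc_measure WE.
exact: (surface_finite_measure (aff_indep_vert _) k FK mF).
Qed.

Lemma loc_bounded_sum_sides F (f : 'I_(nelt T) -> 'rV[R]_n.+1 -> R) :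
  (forall K, loc_bounded (f K)) -> loc_bounded (fun x => sum_sides F (fun K => f K x)).
Proof.
move=> bf; rewrite /sum_sides; case: (eminus F) => [L|].
  by apply: loc_boundedD.
by apply: loc_boundedD => //; exact: loc_bounded_cst.
Qed.

Lemma Rintegral_sum_sides F (f : 'I_(nelt T) -> 'rV[R]_n.+1 -> R) :
  (forall K, loc_bounded (f K)) ->
  \int[ifc_measure F]_(x in ifc_set F) sum_sides F (fun K => f K x) =
  sum_sides F (fun K => \int[ifc_measure F]_(x in ifc_set F) f K x).
Proof.
move=> bf; have mF := measurable_ifc F; rewrite /sum_sides; case: (eminus F) => [L|].
  by rewrite (RintegralD mF (integrable_ifc F (bf _)) (integrable_ifc F (bf _))).
by rewrite addr0; apply: eq_Rintegral => x _; rewrite addr0.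
Qed.

Lemma loc_bounded_field_jump F u : loc_bounded_field (jump F u).
Proof.
rewrite /jump; apply: loc_bounded_fieldD.
  apply: loc_bounded_fieldZ; [exact: loc_bounded_pval|exact: loc_bounded_field_cst].
case: (eminus F) => [L|]; last exact: loc_bounded_field_cst.
apply: loc_bounded_fieldZ; [exact: loc_bounded_pval|exact: loc_bounded_field_cst].
Qed.

Lemma loc_bounded_stab p sigma F (z u : broken T) K : 2 <= p ->
  loc_bounded (fun x => stab p sigma F z u x K).
Proof.
move=> p2; rewrite /stab; apply: loc_bounded_powR.
- by move=> x; rewrite addr_ge0 ?sqr_ge0// mulr_ge0 ?sqr_ge0.
- by rewrite divr_ge0// subr_ge0.
apply: loc_boundedD.
  by apply: loc_boundedX; apply: loc_bounded_enorm; exact: loc_bounded_field_pgrad.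
apply: loc_boundedM; first exact: loc_bounded_cst.
by apply: loc_boundedX; apply: loc_bounded_enorm; exact: loc_bounded_field_jump.
Qed.

Lemma loc_bounded_enorm_powR q (v : 'rV[R]_n.+1 -> 'rV[R]_n.+1) : 0 <= q ->
  loc_bounded_field v -> loc_bounded (fun x => enorm (v x) `^ q).
Proof.
move=> q0 bv; apply: loc_bounded_powR => //; first by move=> x; exact: enorm_ge0.
exact: loc_bounded_enorm.
Qed.

(* Scaling the jump by [sigma] makes the three interface terms homogeneous of
   degree [p] in (a, sigma j), up to the common factor [sigma^-1 = Z]. *)
Lemma side_coercivity p th z Z a j (S : R) : 2 <= p -> 0 <= th <= 1 -> 0 <= z -> 0 < Z ->
  0 <= a -> 0 <= j ->
  S = (a ^+ 2 + Z^-1 ^+ 2 * j ^+ 2) `^ ((p - 2) / 2) ->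
  z / Z * (2^-1 * (Z^-1 `^ (p - 1) * j `^ p)) - absorb p * (z * a `^ p) <=
  z / Z * (Z^-1 * S * j ^+ 2 - a `^ (p - 2) * a * j - th * (S * a * j)).
Proof.
move=> p2 th01 z0 Z0 a0 j0 SE; have Zi : 0 < Z^-1 by rewrite invr_gt0.
have s0 : 0 <= Z^-1 * j by rewrite mulr_ge0// ltW.
have := coercivity_pointwise p2 a0 s0 th01 (S := S).
rewrite exprMn => /(_ SE); rewrite powRM ?(ltW Zi)//.
have -> : Z^-1 `^ p = Z^-1 `^ (p - 1) * Z^-1.
  rewrite -[X in _ * X]powRr1 ?(ltW Zi)// -powRD ?subrK//.
  by rewrite (gt_eqF Zi) implybT.
set A := a `^ (p - 2); set B := Z^-1 `^ (p - 1); set P := a `^ p; set Q := j `^ p.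
move=> h; have := ler_wpM2l z0 h => {}h.
have -> : z / Z * (2^-1 * (B * Q)) - absorb p * (z * P) =
    z * (2^-1 * (B * Z^-1 * Q) - absorb p * P) by field; rewrite gt_eqF.
apply: le_trans h _; rewrite le_eqVlt; apply/orP; left; apply/eqP.
by field; rewrite gt_eqF.
Qed.

Section interface_terms.
Variables (p theta eps Cp : R) (r : 'I_(nelt T) -> nat).
Hypothesis p2 : 2 <= p.
Hypothesis htheta : -1 <= theta <= 1.
Let sigma := penalty (T := T) eps Cp r.
Let w := weight (T := T) eps Cp r.
Let z := zeta (T := T) eps Cp r.
Hypothesis z0 : forall F K, 0 <= z F K.

Let p0 : 0 < p. Proof. exact: lt_le_trans p2. Qed.
Let p20 : 0 <= p - 2. Proof. by rewrite subr_ge0. Qed.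

Let zeta_sumE F : zeta_sum eps Cp r F = sum_sides F (z F).
Proof. by []. Qed.

Let g2 u F x := sigma F * avg (V := R^o) w F (stab p sigma F u u x)
  * dotp (jump F u x) (jump F u x).
Let g3 u F x := dotp (avg w F (fun K => flux p (pgrad (u K) x))) (jump F u x).
Let g4 u F x := dotp (avg w F (fun K => stab p sigma F u u x K *: pgrad (u K) x)) (jump F u x).
Let low u F x := 2^-1 * (sigma F `^ (p - 1) * enorm (jump F u x) `^ p)
  - absorb p * sum_sides F (fun K => z F K * enorm (pgrad (u K) x) `^ p).

Lemma interface_pointwise u F x : low u F x <= g2 u F x - g3 u F x + theta * g4 u F x.
Proof.
have sumz0 : 0 <= sum_sides F (z F).
  by apply: sum_sides_ge0 => K; exact: z0.
(* If Z = 0, then sigma and w are 0 as well, since 0^-1 = 0. *)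
have [Z0|Zn0] := eqVneq (sum_sides F (z F)) 0.
  have s0 : sigma F = 0 by rewrite /sigma /penalty zeta_sumE Z0 invr0.
  have w0 K : w F K = 0 by rewrite /w /weight zeta_sumE Z0 invr0 mulr0.
  have avg0 (f : 'I_(nelt T) -> R) : sum_sides F (fun K => w F K * f K) = 0.
    by rewrite /sum_sides; case: (eminus F) => [L|]; rewrite !w0 !mul0r addr0.
  have -> : g3 u F x = 0 by rewrite -[RHS](avg0 (fun K => dotp (flux p (pgrad (u K) x)) (jump F u x))); exact: dotp_avg.
  have -> : g4 u F x = 0.
    by rewrite -[RHS](avg0 (fun K => dotp (stab p sigma F u u x K *: pgrad (u K) x) (jump F u x))); exact: dotp_avg.
  rewrite /g2 s0 !mul0r subr0 mulr0 addr0 /low s0.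
  rewrite powR0 ?gt_eqF ?subr_gt0 ?(lt_le_trans _ p2) ?ltr1n// mul0r mulr0 sub0r oppr_le0.
  apply: (mulr_ge0 (absorb_ge0 p)); apply: sum_sides_ge0 => K.
  exact: (mulr_ge0 (z0 F K) (powR_ge0 _ _)).
have Z0 : 0 < sum_sides F (z F) by rewrite lt_def Zn0.
set Z := sum_sides F (z F) in Z0 Zn0.
have sE : sigma F = Z^-1 by rewrite /sigma /penalty zeta_sumE.
have wE K : w F K = z F K / Z by rewrite /w /weight zeta_sumE.
have wge0 K : 0 <= w F K by rewrite wE; exact: (divr_ge0 (z0 F K) (ltW Z0)).
have sumw : sum_sides F (w F) = 1.
  rewrite (_ : w F = fun K => Z^-1 * z F K); last by apply/funext => K; rewrite wE mulrC.
  by rewrite sum_sidesZ mulVf.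
set J := jump F u x; set j := enorm J; have j0 : 0 <= j := enorm_ge0 J.
pose a K := enorm (pgrad (u K) x); have a0 K : 0 <= a K := enorm_ge0 _.
pose S K := stab p sigma F u u x K.
have S0 K : 0 <= S K by exact: powR_ge0.
have th01 : 0 <= `|theta| <= 1 by rewrite normr_ge0 ler_norml.
(* As the weights sum to 1, the jump term can be distributed over the sides. *)
have lowE : low u F x = sum_sides F (fun K =>
    z F K / Z * (2^-1 * (Z^-1 `^ (p - 1) * j `^ p)) - absorb p * (z F K * a K `^ p)).
  rewrite sum_sidesD -[X in _ + sum_sides F X]/(fun K => - (absorb p * (z F K * a K `^ p))).
  rewrite (_ : (fun K => - (_ * _)) = (fun K => (- absorb p) * (z F K * a K `^ p))); last first.
    by apply/funext => K; rewrite mulNr.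
  rewrite sum_sidesZ mulNr /low sE -/j; congr (_ - _).
  rewrite (_ : (fun K => _) = (fun K => (2^-1 * (Z^-1 `^ (p - 1) * j `^ p)) * w F K)); last first.
    by apply/funext => K; rewrite wE mulrC.
  by rewrite sum_sidesZ sumw mulr1.
rewrite lowE; apply: (@le_trans _ _ (sum_sides F (fun K =>
    w F K * (Z^-1 * S K * j ^+ 2 - a K `^ (p - 2) * a K * j - `|theta| * (S K * a K * j))))).
  apply: ler_sum_sides => K; rewrite wE.
  have SE : S K = (a K ^+ 2 + Z^-1 ^+ 2 * j ^+ 2) `^ ((p - 2) / 2) by rewrite /S /stab sE.
  exact: (side_coercivity p2 th01 (z0 F K) Z0 (a0 K) j0 SE).
have -> : g2 u F x - g3 u F x + theta * g4 u F x = sum_sides F (fun K => w F K *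
    (Z^-1 * S K * j ^+ 2 - a K `^ (p - 2) * dotp (pgrad (u K) x) J
      + theta * (S K * dotp (pgrad (u K) x) J))).
  have -> : g3 u F x = sum_sides F (fun K => w F K * dotp (flux p (pgrad (u K) x)) J).
    exact: dotp_avg.
  have -> : g4 u F x = sum_sides F (fun K => w F K * dotp (S K *: pgrad (u K) x) J).
    exact: dotp_avg.
  have -> : g2 u F x = (Z^-1 * j ^+ 2) * sum_sides F (fun K => w F K * S K).
    by rewrite /g2 avg_scalar sE -/J -enorm_sqr -/j mulrAC.
  rewrite -[X in _ - X]mul1r -mulNr -!sum_sidesZ -!sum_sidesD.
  by congr sum_sides; apply/funext => K; rewrite /flux !dotpZl -/(a K); ring.
(* Cauchy-Schwarz bounds the products of gradient and jump by a j, and theta enters through its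
   absolute value. *)
apply: ler_sum_sides => K; rewrite ler_wpM2l// -!addrA lerD2l.
have := normr_dotp_le (pgrad (u K) x) J; rewrite -/(a K) -/j => hd.
apply: lerD.
  rewrite lerN2 -mulrA ler_wpM2l ?powR_ge0//.
  by apply: le_trans (ler_norm _) hd.
rewrite lerNl -mulrN; apply: le_trans (ler_norm _) _.
by rewrite mulrN normrN !normrM (ger0_norm (S0 K)) -mulrA ler_wpM2l// ler_wpM2l.
Qed.

Let bp K u : loc_bounded (fun x => enorm (pgrad (u K) x) `^ p).
Proof. by apply: loc_bounded_enorm_powR; [exact: ltW|exact: loc_bounded_field_pgrad]. Qed.

Let bjp u F : loc_bounded (fun x => sigma F `^ (p - 1) * enorm (jump F u x) `^ p).
Proof.
apply: loc_boundedM; first exact: loc_bounded_cst.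
by apply: loc_bounded_enorm_powR; [exact: ltW|exact: loc_bounded_field_jump].
Qed.

Let bg2 u F : loc_bounded (g2 u F).
Proof.
apply: loc_boundedM; last by apply: loc_bounded_dotp; exact: loc_bounded_field_jump.
apply: loc_boundedM; first exact: loc_bounded_cst.
apply: loc_bounded_sum_sides => K; apply: loc_boundedM; first exact: loc_bounded_cst.
exact: loc_bounded_stab.
Qed.

Let bg3 u F : loc_bounded (g3 u F).
Proof.
rewrite (_ : g3 u F = fun x => sum_sides F (fun K => w F K * dotp (flux p (pgrad (u K) x)) (jump F u x))).
  apply: loc_bounded_sum_sides => K; apply: loc_boundedM; first exact: loc_bounded_cst.
  apply: loc_bounded_dotp; last exact: loc_bounded_field_jump.
  apply: loc_bounded_fieldZ; last exact: loc_bounded_field_pgrad.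
  by apply: loc_bounded_enorm_powR => //; exact: loc_bounded_field_pgrad.
by apply/funext => x; exact: dotp_avg.
Qed.

Let bg4 u F : loc_bounded (g4 u F).
Proof.
rewrite (_ : g4 u F = fun x => sum_sides F (fun K => w F K *
    dotp (stab p sigma F u u x K *: pgrad (u K) x) (jump F u x))).
  apply: loc_bounded_sum_sides => K; apply: loc_boundedM; first exact: loc_bounded_cst.
  apply: loc_bounded_dotp; last exact: loc_bounded_field_jump.
  apply: loc_bounded_fieldZ; last exact: loc_bounded_field_pgrad.
  exact: loc_bounded_stab.
by apply/funext => x; exact: dotp_avg.
Qed.

Lemma interface_coercivity u F :
  2^-1 * \int[ifc_measure F]_(x in ifc_set F) (sigma F `^ (p - 1) * enorm (jump F u x) `^ p)
  - absorb p * sum_sides F (fun K => z F K *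
      \int[ifc_measure F]_(x in ifc_set F) (enorm (pgrad (u K) x) `^ p)) <=
  \int[ifc_measure F]_(x in ifc_set F) g2 u F x
  - \int[ifc_measure F]_(x in ifc_set F) g3 u F x
  + theta * \int[ifc_measure F]_(x in ifc_set F) g4 u F x.
Proof.
have mF := measurable_ifc F.
have bz K : loc_bounded (fun x => z F K * enorm (pgrad (u K) x) `^ p).
  by apply: loc_boundedM; [exact: loc_bounded_cst|exact: bp].
have bs := loc_bounded_sum_sides F bz.
have bt4 : loc_bounded (fun x => theta * g4 u F x).
  by apply: loc_boundedM; [exact: loc_bounded_cst|exact: bg4].
have b23 : loc_bounded (fun x => g2 u F x - g3 u F x).
  by apply: loc_boundedD; [exact: bg2|apply: loc_boundedN; exact: bg3].
have bl1 : loc_bounded (fun x => 2^-1 * (sigma F `^ (p - 1) * enorm (jump F u x) `^ p)).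
  by apply: loc_boundedM; [exact: loc_bounded_cst|exact: bjp].
have bl2 : loc_bounded (fun x => absorb p * sum_sides F (fun K => z F K * enorm (pgrad (u K) x) `^ p)).
  by apply: loc_boundedM; [exact: loc_bounded_cst|exact: bs].
have -> : sum_sides F (fun K => z F K *
      \int[ifc_measure F]_(x in ifc_set F) (enorm (pgrad (u K) x) `^ p)) =
    \int[ifc_measure F]_(x in ifc_set F)
      sum_sides F (fun K => z F K * enorm (pgrad (u K) x) `^ p).
  rewrite (Rintegral_sum_sides F bz); congr sum_sides; apply/funext => K.
  by rewrite (RintegralZl _ mF (integrable_ifc F (bp K u))).
rewrite -(RintegralZl _ mF (integrable_ifc F (bjp u F))) -(RintegralZl _ mF (integrable_ifc F bs)).
rewrite -(RintegralB mF (integrable_ifc F bl1) (integrable_ifc F bl2)).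
rewrite -(RintegralB mF (integrable_ifc F (bg2 u F)) (integrable_ifc F (bg3 u F))).
rewrite -(RintegralZl _ mF (integrable_ifc F (bg4 u F))).
rewrite -(RintegralD mF (integrable_ifc F b23) (integrable_ifc F bt4)).
apply: (le_Rintegral mF).
- by apply: integrable_ifc; apply: loc_boundedD bl1 _; exact: loc_boundedN.
- by apply: integrable_ifc; exact: loc_boundedD.
by move=> x _; exact: interface_pointwise.
Qed.

End interface_terms.

End interface_estimates.


(** The factor 2 of the theorem: half of the volume term a pays for the traces b, and half of the
    jump term x has survived on the interfaces. *)
Lemma half_absorb (R : realFieldType) (a x y2 y3 y4 b : R) : b <= 2^-1 * a ->
  2^-1 * x - b <= y2 - y3 + y4 -> a + x <= 2 * (a + y2 - y3 + y4).
Proof. lra. Qed.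

Section coercivity.
Context {R : realType}.
Variables (n : nat) (Omega : set 'rV[R]_n.+1) (T : mesh Omega).
Hypothesis hOmega : polytopic_domain Omega.
Implicit Types (K L : 'I_(nelt T)) (F : ifc T) (u v : broken T).

Let measurable_elt_int K : measurable (elt K)°.
Proof. by apply: open_measurable_rV; exact: open_interior. Qed.

Let measurable_Omega : measurable Omega.
Proof. by apply: open_measurable_rV; exact: open_domain. Qed.

Lemma bgrad_interior u K x : (elt K)° x -> bgrad u x = pgrad (u K) x.
Proof.
move=> Kx; rewrite /bgrad (bigD1 K)//= indicE mem_set// scale1r big1 ?addr0// => L LK.
rewrite indicE memNset ?scale0r// => Lx.
by have := mesh_disjoint LK; rewrite -subset0 => /(_ x); apply.
Qed.

(** At most one indicator is nonzero. On the skeleton all vanish, and the left side is 0^p, which is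
    0 only for p different from 0. *)
Lemma enorm_bgrad_powR u p x : p != 0 ->
  enorm (bgrad u x) `^ p = \sum_K \1_(elt K)° x * enorm (pgrad (u K) x) `^ p.
Proof.
move=> p0; have [[K Kx]|noK] := pselect (exists K, (elt K)° x).
  rewrite (bgrad_interior u Kx) (bigD1 K)//= indicE mem_set// mul1r big1 ?addr0// => L LK.
  rewrite indicE memNset ?mul0r// => Lx.
  by have := mesh_disjoint LK; rewrite -subset0 => /(_ x); apply.
have notin K : \1_(elt K)° x = 0 :> R.
  by rewrite indicE memNset// => Kx; apply: noK; exists K.
rewrite /bgrad big1 => [|K _]; last by rewrite notin scale0r.
rewrite big1 => [|K _]; last by rewrite notin mul0r.
by rewrite /enorm dotp0l sqrtr0 powR0.
Qed.

Lemma EFin_Rintegral d (X : measurableType d) (mu : {measure set X -> \bar R}) D f :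
  measurable D -> mu.-integrable D (EFin \o f) ->
  (\int[mu]_(x in D) f x)%:E = (\int[mu]_(x in D) (f x)%:E)%E.
Proof. by move=> mD fi; rewrite /Rintegral fineK//; exact: integrable_fin_num. Qed.

Lemma integrable_elt K f : loc_bounded f ->
  (lebesgue_rV n.+1).-integrable (elt K) (EFin \o f).
Proof.
move=> bf; have [M hM] := hull_bounded (vert K).
apply: (loc_bounded_integrable _ _ hM bf).
  exact: measurable_elt.
exact: (hull_finite_measure (aff_indep_vert K)).
Qed.

Lemma Rintegral_bgrad_powR u p : 0 < p ->
  \int[lebesgue_rV n.+1]_(x in Omega) (enorm (bgrad u x) `^ p) =
  \sum_K \int[lebesgue_rV n.+1]_(x in elt K) (enorm (pgrad (u K) x) `^ p).
Proof.
move=> p0; apply: EFin_inj; rewrite -sumEFin.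
have mg K : measurable_fun setT (fun x => enorm (pgrad (u K) x) `^ p).
  exact: measurable_pgrad_powR.
have E : (\int[lebesgue_rV n.+1]_(x in Omega) (enorm (bgrad u x) `^ p)%:E =
    \sum_K \int[lebesgue_rV n.+1]_(x in elt K) (enorm (pgrad (u K) x) `^ p)%:E)%E.
  transitivity (\int[lebesgue_rV n.+1]_(x in Omega)
      (\sum_K (\1_(elt K)° x * enorm (pgrad (u K) x) `^ p)%:E))%E.
    by apply: eq_integral => x _; rewrite enorm_bgrad_powR ?gt_eqF// sumEFin.
  rewrite ge0_integral_sum//; last 2 first.
  - move=> K; apply/measurable_EFinP; apply: measurable_funTS.
    by apply: measurable_funM => //; exact: measurable_indic.
  - by move=> K x _; rewrite lee_fin mulr_ge0// powR_ge0.
  apply: eq_bigr => K _.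
  rewrite -(ge0_integral_hull_interior (aff_indep_vert K) (mg K)); last first.
    by move=> x; exact: powR_ge0.
  rewrite integral_mkcond [RHS]integral_mkcond; apply: eq_integral => x _.
  rewrite !patchE; case: ifPn => [|/negP xO].
    by move=> _; rewrite indicE /elt; case: ifPn => _; rewrite ?mul1r ?mul0r.
  case: ifPn => //; rewrite inE => xK; exfalso; apply: xO; rewrite inE.
  exact: (elt_interior_sub hOmega xK).
have bp K : loc_bounded (fun x => enorm (pgrad (u K) x) `^ p).
  by apply: loc_bounded_enorm_powR; [exact: ltW|exact: loc_bounded_field_pgrad].
rewrite (eq_bigr (fun K => \int[lebesgue_rV n.+1]_(x in elt K) (enorm (pgrad (u K) x) `^ p)%:E)%E).
  rewrite [in LHS]/Rintegral E fineK//; apply/sum_fin_numP => K _ _.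
  by apply: integrable_fin_num; [exact: measurable_elt|exact: integrable_elt].
by move=> K _; apply: EFin_Rintegral; [exact: measurable_elt|exact: integrable_elt].
Qed.

Section sum_of_traces.
Variables (p eps Cp : R) (r : 'I_(nelt T) -> nat) (N : nat).
Hypothesis p0 : 0 < p.
Hypothesis pN : p <= (2 * N)%:R.
Hypothesis Cp0 : 0 <= Cp.
Hypothesis eps0 : 0 < eps.
Hypothesis hC : forall K, n.+1%:R * (N * (r K).-1).+1%:R ^+ 2 <=
  Cp * Cinv n * (2 * ((r K)%:R - 1) ^+ 2 + 1).

Let I u K := \int[lebesgue_rV n.+1]_(x in elt K) (enorm (pgrad (u K) x) `^ p).
Let J u F K := \int[ifc_measure F]_(x in ifc_set F) (enorm (pgrad (u K) x) `^ p).

Let I_ge0 u K : 0 <= I u K.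
Proof. by apply: Rintegral_ge0 => x _; exact: powR_ge0. Qed.

Lemma Gconst_ge0 K F : 0 <= Gconst Cp r K F.
Proof.
rewrite /Gconst; have c0 : 0 <= Cinv n :> R by case: n => [|[|]].
apply: divr_ge0; apply: mulr_ge0 => //.
- exact: mulr_ge0.
- apply: mulr_ge0; last by apply: fine_ge0; exact: measure_ge0.
  by rewrite addr_ge0// mulr_ge0// sqr_ge0.
- by apply: fine_ge0; exact: measure_ge0.
Qed.

Lemma mu_eps_gt0 : 0 < mu_eps eps.
Proof. by rewrite /mu_eps lt_max ltr01. Qed.

Lemma zeta_ge0 F K : 0 <= zeta eps Cp r F K.
Proof.
apply: divr_ge0; first exact: ltW.
by apply: mulr_ge0; [apply: mulr_ge0 => //; exact/ltW/mu_eps_gt0|exact: Gconst_ge0].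
Qed.

(** The constant of the trace inequality is the G in the denominator of zeta and cancels, leaving
    eps / (m_K mu_eps). *)
Lemma zeta_trace u F K : in_space r u -> is_ifc F -> side F K ->
  zeta eps Cp r F K * J u F K <= (n_ifc K)%:R^-1 * (eps / mu_eps eps * I u K).
Proof.
move=> ur Fi sFK.
have FK : K = eplus F \/ eminus F = Some K.
  by case/orP: sFK => /eqP; [left|right].
have bp : loc_bounded (fun x => enorm (pgrad (u K) x) `^ p).
  by apply: loc_bounded_enorm_powR; [exact: ltW|exact: loc_bounded_field_pgrad].
have JGI : J u F K <= Gconst Cp r K F * I u K.
  rewrite -lee_fin EFinM (EFin_Rintegral (measurable_ifc F) (integrable_ifc F bp)).
  rewrite (EFin_Rintegral (measurable_elt K) (integrable_elt K bp)).
  exact: (trace_inequality ur Fi FK p0 pN Cp0 (hC K)).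
apply: le_trans (ler_wpM2l (zeta_ge0 F K) JGI) _.
rewrite [leLHS]mulrA [leRHS]mulrA; apply: (ler_wpM2r (I_ge0 u K)).
(* If G = 0 nothing cancels, but the left side is then 0. *)
rewrite /zeta; move: (Gconst Cp r K F) => G; have [->|G0] := eqVneq G 0.
  rewrite mulr0 mulr_ge0 ?invr_ge0// divr_ge0 ?(ltW eps0)//; exact/ltW/mu_eps_gt0.
by rewrite [(_ * G)^-1]invfM [eps * (_ * _)]mulrA divfK// invfM mulrCA.
Qed.

(** An interface with K on one side lies in the boundary of K, hence is among those counted by
    m_K. *)
Lemma side_count K : (#|[pred F : ifc T | is_ifc F && side F K]| <= n_ifc K)%N.
Proof.
apply: subset_leq_card; apply/fintype.subsetP => F; rewrite !inE => /andP[-> sFK] /=.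
apply/asboolP; case/orP: sFK => /eqP; last exact: ifc_sub_minus.
by move=> ->; exact: ifc_sub_plus.
Qed.

Lemma sum_of_traces u : in_space r u ->
  \sum_(F | is_ifc F) sum_sides F (fun K => zeta eps Cp r F K * J u F K) <=
  eps / mu_eps eps * \sum_K I u K.
Proof.
move=> ur; apply: (@le_trans _ _ (\sum_(F : ifc T | is_ifc F) \sum_(K | side F K)
    (n_ifc K)%:R^-1 * (eps / mu_eps eps * I u K))).
  apply: ler_sum => F Fi; rewrite (sum_sidesE _ Fi).
  by apply: ler_sum => K sFK; exact: zeta_trace.
(* Summed by elements, each K occurs at most m_K times, against the factor 1 / m_K. *)
rewrite (exchange_big_dep predT)//= mulr_sumr; apply: ler_sum => K _.
have c0 : 0 <= eps / mu_eps eps * I u K.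
  by rewrite mulr_ge0// divr_ge0 ?(ltW eps0)//; exact/ltW/mu_eps_gt0.
rewrite sumr_const -[leLHS]mulr_natl mulrA -[leRHS]mul1r ler_wpM2r//.
(* If m_K = 0 the convention 0^-1 = 0 makes the contribution of K vanish. *)
have [n0|n0] := posnP (n_ifc K); first by rewrite n0 invr0 mulr0.
by rewrite ler_pdivrMr ?ltr0n// mul1r ler_nat side_count.
Qed.

End sum_of_traces.

Lemma B_form_coercive (p theta eps Cp : R) (r : 'I_(nelt T) -> nat) (N : nat) u :
  2 <= p -> -1 <= theta <= 1 -> p <= (2 * N)%:R -> 0 <= Cp -> 0 < eps ->
  (forall K, n.+1%:R * (N * (r K).-1).+1%:R ^+ 2 <=
     Cp * Cinv n * (2 * ((r K)%:R - 1) ^+ 2 + 1)) ->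
  absorb p * (eps / mu_eps eps) <= 2^-1 -> in_space r u ->
  dgnorm p (penalty (T := T) eps Cp r) u `^ p <=
  2 * B_form p theta (penalty (T := T) eps Cp r) (weight (T := T) eps Cp r) u u u.
Proof.
move=> p2 hth pN Cp0 eps0 hC habs ur; set sigma := penalty eps Cp r; set w := weight eps Cp r.
have p0 : 0 < p by exact: lt_le_trans p2.
pose I K := \int[lebesgue_rV n.+1]_(x in elt K) (enorm (pgrad (u K) x) `^ p).
pose A := \int[lebesgue_rV n.+1]_(x in Omega) (enorm (bgrad u x) `^ p).
pose G F := \int[ifc_measure F]_(x in ifc_set F) (sigma F `^ (p - 1) * enorm (jump F u x) `^ p).
have AE : A = \sum_K I K by exact: Rintegral_bgrad_powR.
have A0 : 0 <= A by apply: Rintegral_ge0 => x _; exact: powR_ge0.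
have G0 F : 0 <= G F by apply: Rintegral_ge0 => x _; rewrite mulr_ge0 ?powR_ge0.
have normE : dgnorm p sigma u `^ p = A + \sum_(F | is_ifc F) G F.
  have X0 : 0 <= A + \sum_(F | is_ifc F) G F by rewrite addr_ge0// sumr_ge0.
  have -> : dgnorm p sigma u = (A + \sum_(F | is_ifc F) G F) `^ p^-1 by [].
  by rewrite -powRrM mulVf ?gt_eqF// powRr1.
have volE : \int[lebesgue_rV n.+1]_(x in Omega) dotp (flux p (bgrad u x)) (bgrad u x) = A.
  apply: eq_Rintegral => x _; rewrite /flux dotpZl -enorm_sqr.
  by rewrite (powR_sqrM (enorm_ge0 _) p2).
rewrite normE /B_form volE /int_Gamma.
have z0 F K : 0 <= zeta eps Cp r F K by exact: zeta_ge0.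
pose g2 F := \int[ifc_measure F]_(x in ifc_set F) (sigma F *
  avg (V := R^o) w F (stab p sigma F u u x) * dotp (jump F u x) (jump F u x)).
pose g3 F := \int[ifc_measure F]_(x in ifc_set F)
  dotp (avg w F (fun K => flux p (pgrad (u K) x))) (jump F u x).
pose g4 F := \int[ifc_measure F]_(x in ifc_set F)
  dotp (avg w F (fun K => stab p sigma F u u x K *: pgrad (u K) x)) (jump F u x).
pose s F := sum_sides F (fun K => zeta eps Cp r F K *
  \int[ifc_measure F]_(x in ifc_set F) (enorm (pgrad (u K) x) `^ p)).
have hsum : \sum_(F | is_ifc F) (2^-1 * G F - absorb p * s F) <=
    \sum_(F | is_ifc F) (g2 F - g3 F + theta * g4 F).
  by apply: ler_sum => F _; exact: (interface_coercivity p2 hth z0 u F).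
have htr : \sum_(F | is_ifc F) s F <= eps / mu_eps eps * A.
  by rewrite AE; exact: (sum_of_traces p0 pN Cp0 eps0 hC ur).
rewrite !big_split/= !sumrN -!mulr_sumr in hsum.
have h : absorb p * (eps / mu_eps eps * A) <= 2^-1 * A by rewrite mulrA ler_wpM2r.
have hs := le_trans (ler_wpM2l (absorb_ge0 p) htr) h.
change (A + \sum_(F | is_ifc F) G F <= 2 * (A + \sum_(F | is_ifc F) g2 F
  - \sum_(F | is_ifc F) g3 F + theta * \sum_(F | is_ifc F) g4 F)).
exact: half_absorb hs hsum.
Qed.

End coercivity.


(** * The right-hand side *)

Section load.
Context {R : realType}.
Variables (n : nat) (Omega : set 'rV[R]_n.+1) (T : mesh Omega).
Hypothesis hOmega : polytopic_domain Omega.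

Lemma loc_bounded_bval (v : broken T) : loc_bounded (bval v).
Proof.
apply: loc_bounded_sum => K; apply: loc_boundedM; last exact: loc_bounded_pval.
by apply: loc_bounded_indic; apply: open_measurable_rV; exact: open_interior.
Qed.

(** The real-valued integral agrees with the extended one only when the latter is finite; finiteness
    comes from the Hölder bound itself, both norms being finite. *)
Lemma Rintegral_hoelder (f : 'rV[R]_n.+1 -> R) (v : broken T) (p : R) : 1 < p ->
  in_Lp Omega (conjugate p) f -> (LpNorm Omega p (bval v) < +oo)%E ->
  ((\int[lebesgue_rV n.+1]_(x in Omega) (f x * bval v x))%:E <=
   LpNorm Omega (conjugate p) f * LpNorm Omega p (bval v))%E.
Proof.
move=> p1 hf vp; have p0 : 0 < p by exact: lt_trans p1.
have mO : measurable Omega by apply: open_measurable_rV; exact: open_domain.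
have mf : measurable_fun setT (f \_ Omega).
  by have := sub_Lfun_mfun hf; rewrite inE.
have finf : (LpNorm Omega (conjugate p) f < +oo)%E.
  by have := sub_Lfun_finLfun hf; rewrite inE.
have [mb _] := loc_bounded_bval v.
have mbO : measurable_fun setT (bval v \_ Omega).
  by apply/(measurable_restrictT _ _).1 => //; exact: measurable_funTS.
have q0 : 0 < conjugate p by rewrite divr_gt0// subr_gt0.
have pq : (conjugate p)^-1 + p^-1 = 1.
  by rewrite /conjugate invf_div -[X in _ + X]mul1r -mulrDl subrK mulfV// gt_eqF.
have h := hoelder (lebesgue_rV n.+1) mf mbO q0 p0 pq.
have mfO : measurable_fun Omega f by apply/measurable_restrictT.
set X := (\int[lebesgue_rV n.+1]_(x in Omega) (f x * bval v x)%:E)%E.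
have hX : (`|X| <= LpNorm Omega (conjugate p) f * LpNorm Omega p (bval v))%E.
  apply: le_trans h; apply: le_trans (le_abse_integral _ mO _) _.
    by apply/measurable_EFinP; apply: measurable_funM => //; exact: measurable_funTS.
  rewrite Lnorm1 [leLHS]integral_mkcond le_eqVlt; apply/orP; left; apply/eqP.
  apply: eq_integral => x _; rewrite !patchE /= !patchE.
  by case: ifP => _; rewrite ?mul0r ?normr0.
have Xfin : X \is a fin_num.
  rewrite -abse_fin_num ge0_fin_numE ?abse_ge0//; apply: le_lt_trans hX _.
  by apply: lte_mul_pinfty => //; [exact: Lnorm_ge0|rewrite ge0_fin_numE ?Lnorm_ge0].
by rewrite /Rintegral fineK//; apply: le_trans hX; exact: lee_abs.
Qed.

End load.

Theorem theorem6p2 (R : realType) (n : nat) (hn : (n < 3)%N)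
  (Omega : set 'rV[R]_n.+1) (hOmega : polytopic_domain Omega)
  (csr : R) (T : mesh Omega) (hT : shape_regular T csr)
  (r : 'I_(nelt T) -> nat)
  (p : R) (hp : 2 <= p) (theta : R) (htheta : -1 <= theta <= 1)
  (C1 C2 : R) (hC1 : growth_constant n.+1 p C1)
  (hC2 : monotonicity_constant n.+1 p C2)
  (Cp : R) (hCp : inverse_constant p Cp) :
  let eps := epsilon p theta C1 C2 in
  let sigma := penalty (T := T) eps Cp r in
  let w := weight (T := T) eps Cp r in
  forall (CPF : R) (hCPF : 0 < CPF)
    (hPF : forall v : broken T, in_space r v ->
       (LpNorm Omega p (bval v) <= (CPF * dgnorm p sigma v)%:E)%E)
    (f : 'rV[R]_n.+1 -> R) (hf : in_Lp Omega (conjugate p) f)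
    (u : broken T) (hu : in_space r u)
    (hsol : forall v : broken T, in_space r v ->
       B_form p theta sigma w u u v =
       \int[lebesgue_rV n.+1]_(x in Omega) (f x * bval v x)),
  ((dgnorm p sigma u `^ (p - 1))%:E
     <= (2 * CPF)%:E * LpNorm Omega (conjugate p) f)%E.
Proof.
move=> eps sigma w CPF hCPF hPF f hf u hu hsol.
have p1 : 1 < p by apply: lt_le_trans hp; rewrite ltr1n.
have [C10 _] := hC1; have [C20 _] := hC2.
have [eps0 eps4 habs] := epsilon_bounds theta hp C10 C20 (monotonicity_le_growth hC1 hC2).
have [N [N0 pN Np]] := even_bound hp.
have Cp0 : 0 <= Cp.
  by apply: le_trans (inverse_constant_ge hp hCp N0 Np); rewrite addr_ge0// divr_ge0// sqr_ge0.
have hC K := trace_constant (r K) hp hCp N0 Np hn.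
rewrite -(mu_eps_ratio eps0 eps4) in habs.
have := B_form_coercive hOmega hp htheta pN Cp0 eps0 hC habs hu.
rewrite -/eps -/sigma -/w hsol// => hB.
set X := dgnorm p sigma u in hB *; have X0 : 0 <= X by exact: powR_ge0.
set F := LpNorm Omega (conjugate p) f; have F0 : (0 <= F)%E by exact: Lnorm_ge0.
have Ffin : F \is a fin_num.
  by rewrite ge0_fin_numE//; have := sub_Lfun_finLfun hf; rewrite inE.
(* The Poincaré inequality serves twice: it also gives the finite L^p norm of u that Hölder asks
   for. *)
have uX := hPF u hu; rewrite -/X in uX.
have hH := Rintegral_hoelder hOmega p1 hf (le_lt_trans uX (ltry _)).
have {}hH := le_trans hH (lee_wpmul2l F0 uX).
rewrite -(fineK Ffin) -EFinM lee_fin in hH.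
rewrite -(fineK Ffin) -EFinM lee_fin.
(* The estimate obtained is X^p <= 2 CPF |f| X, to be divided by X; for X = 0 the claim is 0^(p-1) =
   0, as p > 1. *)
have [->|Xn0] := eqVneq X 0.
  rewrite powR0 ?gt_eqF ?subr_gt0// !mulr_ge0 ?(ltW hCPF)//.
  exact: fine_ge0.
have Xp : 0 < X by rewrite lt_def Xn0.
rewrite -(ler_pM2r Xp); have -> : X `^ (p - 1) * X = X `^ p.
  by rewrite -[X in _ * X](powRr1 X0) -powRD ?subrK// Xn0 implybT.
apply: le_trans hB _; rewrite -!mulrA ler_pM2l//; apply: le_trans hH _.
by rewrite le_eqVlt; apply/orP; left; apply/eqP; ring.
Qed.
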